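(* Let $n\ge 1$ and let $H(x,y)=H_0(x,y)+H_1(x,y)+\cdots$ be a Hamiltonian, analytic in a neighbourhood of the origin of $\mathbb{C}^{2n}$, where $(x,y)=(x_1,\dots,x_n,y_1,\dots,y_n)$ are canonical coordinates, $H_0(x,y)=\sum_{j=1}^n\lambda_j x_jy_j$ with $(\lambda_1,\dots,\lambda_n)\in\mathbb{C}^n$, and $H_s$ is a homogeneous polynomial of degree $s+2$ for each $s\ge 1$. Assume that $\lambda_1\neq 0$ and that $$\lambda_\nu-k\lambda_1\neq 0\qquad\text{for all }k\in\mathbb{Z}\text{ and all }\nu=2,\dots,n .$$ Then there exists a canonical, near the identity transformation, in the form of a power series convergent in a neighbourhood of the origin, which gives the Hamiltonian the normal form $$H(x,y)=H_0(x,y)+\Gamma(x_1y_1)+F(x,y),$$ where $(x,y)$ now denote the new canonical coordinates, $H_0$ is the same quadratic polynomial, $\Gamma(x_1y_1)$ depends only on the product $x_1y_1$, and $F(x,y)$ is at least quadratic in $x_2,\dots,x_n,y_2,\dots,y_n$.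
   Context: A transformation is canonical if it preserves the symplectic form $\sum_j dx_j\wedge dy_j$ (equivalently, the Poisson bracket $\{f,g\}=\sum_{j}\left(\frac{\partial f}{\partial x_j}\frac{\partial g}{\partial y_j}-\frac{\partial f}{\partial y_j}\frac{\partial g}{\partial x_j}\right)$). ''Near the identity'' means that the old coordinates equal the new coordinates plus power series in the new coordinates starting with terms of degree at least $2$. ''$F$ is at least quadratic in $x_2,\dots,x_n,y_2,\dots,y_n$'' means that every monomial in the power series expansion of $F$ at the origin has total degree at least $2$ in the variables $x_2,\dots,x_n,y_2,\dots,y_n$. *)

(* Defs.v *)
(* The notations of [mpoly] clash with those of MathComp-Analysis and are not
   imported: [multinom N] is 'X_{1..N}, [mpoly N K] is {mpoly K[N]},
   [mpolyX K (mnm1 i)] is the variable 'X_i, [meval v p] is p.@[v] and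
   [ishomog1 d mdeg] is d.-homog. *)
From HB Require Import structures.
From mathcomp Require Import all_boot all_order all_algebra.
From mathcomp Require Import all_classical all_reals all_analysis.
From mathcomp Require Import complex.
From mathcomp Require Import -(notations) mpoly.
From mathcomp.analysis.showcase Require summability.

Set Implicit Arguments.
Unset Strict Implicit.
Unset Printing Implicit Defensive.

Import Order.TTheory GRing.Theory Num.Theory.
Import numFieldNormedType.Exports.

Local Open Scope classical_set_scope.
Local Open Scope ring_scope.

(* R[i] packaged as a numClosedFieldType, so that it is canonically a normed
   space over itself: limits and differentials below are complex ones. *)
Definition Cplx (R : realType) : numClosedFieldType := R[i].

Section PowerSeries.
Variables (R : realType) (N : nat).

Definition monomial (z : 'rV[Cplx R]_N) (m : multinom N) : Cplx R :=
  \prod_(i < N) z ord0 i ^+ m i.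

Definition peval (p : mpoly N (Cplx R)) (z : 'rV[Cplx R]_N) : Cplx R :=
  meval (fun i => z ord0 i) p.

(* The sum is unordered (limit along the finite sets of multi-indices), which
   in Cplx R amounts to absolute convergence. *)
Definition expands_at0 (f : 'rV[Cplx R]_N -> Cplx R)
    (a : multinom N -> Cplx R) : Prop :=
  \forall z \near (0 : 'rV[Cplx R]_N),
    summability.partial_sum (fun m => a m * monomial z m)
      @ summability.totally --> f z.

Definition analytic_at0 (f : 'rV[Cplx R]_N -> Cplx R) : Prop :=
  exists a, expands_at0 f a.

Definition near_identity (Phi : 'rV[Cplx R]_N -> 'rV[Cplx R]_N) : Prop :=
  forall i : 'I_N, exists a : multinom N -> Cplx R,
    (forall m, a m != 0 -> (2 <= mdeg m)%N) /\
    expands_at0 (fun z => Phi z ord0 i - z ord0 i) a.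

End PowerSeries.

Definition analytic1_at0 (R : realType) (g : Cplx R -> Cplx R) : Prop :=
  exists c : nat -> Cplx R,
    \forall t \near (0 : Cplx R), [series c k * t ^+ k]_k @ \oo --> g t.

(* A point of C^{2n} is a row vector (x_1, ..., x_n, y_1, ..., y_n). *)
Section PhaseSpace.
Variables (R : realType) (n : nat).

Definition xc (z : 'rV[Cplx R]_(n + n)) (j : 'I_n) := z ord0 (lshift n j).
Definition yc (z : 'rV[Cplx R]_(n + n)) (j : 'I_n) := z ord0 (rshift n j).

Definition H0poly (lambda : 'I_n -> Cplx R) : mpoly (n + n) (Cplx R) :=
  \sum_(j < n) lambda j *:
    (mpolyX (Cplx R) (mnm1 (lshift n j)) * mpolyX (Cplx R) (mnm1 (rshift n j))).

Definition symp_form (u v : 'rV[Cplx R]_(n + n)) : Cplx R :=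
  \sum_(j < n) (xc u j * yc v j - yc u j * xc v j).

(* Phi^* omega = omega near the origin, with omega = \sum_j dx_j /\ dy_j. *)
Definition canonical_at0
    (Phi : 'rV[Cplx R]_(n + n) -> 'rV[Cplx R]_(n + n)) : Prop :=
  \forall z \near (0 : 'rV[Cplx R]_(n + n)),
    differentiable Phi z /\
    forall u v, symp_form ('d Phi z u) ('d Phi z v) = symp_form u v.

Definition transverse_deg (i1 : 'I_n) (m : multinom (n + n)) : nat :=
  (\sum_(j < n | j != i1) (m (lshift n j) + m (rshift n j)))%N.

Definition transverse_quadratic (i1 : 'I_n)
    (F : 'rV[Cplx R]_(n + n) -> Cplx R) : Prop :=
  exists a : multinom (n + n) -> Cplx R,
    (forall m, a m != 0 -> (2 <= transverse_deg i1 m)%N) /\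
    expands_at0 F a.

End PhaseSpace.

(* Main.v *)
(* The plane of the first conjugate pair is tangent to a two-dimensional invariant manifold W,
   found as a convergent power series in (xi, eta) on which the flow is
   (lambda_1 + alpha(xi eta)) (xi d/dxi - eta d/deta).  The small divisors are
   k lambda_1 -+ lambda_nu and (k -+ 1) lambda_1: by nonresonance only the first pair meets
   zeros, and the divisors grow linearly in k, so that the fixed point of the series equation
   is absolutely convergent even though the equation contains the derivative of W (that
   derivative acts on a monomial as the integer k).  Energy conservation makes the resonant
   equation of y_1 automatic, and a choice of the free resonant terms makes W symplectic; H o W
   then depends on xi eta only.  The embedding W is extended to a symplectic map Phi by a second
   fixed point.  At a point of the manifold dH is omega(., X_H) with X_H tangent to W, and Phi
   is symplectic, so that H o Phi - (H o W)(x_1, y_1) has zero transverse derivatives there: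
   it is at least quadratic in the transverse variables. *)
Require Import Defs.
From HB Require Import structures.
From mathcomp Require Import all_boot all_order all_algebra.
From mathcomp Require Import all_classical all_reals all_analysis.
From mathcomp Require Import complex.
From mathcomp Require Import -(notations) mpoly.
From mathcomp Require Import finmap.
From mathcomp.analysis.showcase Require summability.
From mathcomp Require Import ring lra zify.

Set Implicit Arguments.
Unset Strict Implicit.
Unset Printing Implicit Defensive.

Import Order.TTheory GRing.Theory Num.Theory.
Import numFieldNormedType.Exports.

Local Open Scope classical_set_scope.
Local Open Scope ring_scope.

(** A series is a coefficient function measured by a weighted l1 norm, because this norm is stable,
    without loss of radius, under products, substitution and multiplication of each coefficient by a
    bounded factor. The operator xi d/dxi - eta d/deta is diagonal on monomials, so it merges with
    the small divisor into one bounded factor, whereas an ordinary derivative would shrink the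
    radius at each iteration. Each fixed point then lives in a ball of size K r^2 at a single radius
    r; the square records that the unknowns start at degree 2. Geometric identities (energy,
    pullback of the symplectic form) are proved pointwise and carried back to coefficients by
    uniqueness of expansions, since resonances are visible only there. Symplecticity of W takes two
    steps: the pulled-back form is f dxi /\ deta, and h o W being a function of xi eta forces f to
    be one too; then f is fixed by the powers of xi eta in the primitive sum of y_j dx_j contracted
    with the Euler field, and the free resonant coefficients of W_(x_1) adjust exactly those. *)

Local Notation mon := multinom.
Local Notation "p @_ m" := (mcoeff m p) (at level 3, m at level 2, format "p @_ m") : ring_scope.
Local Notation "p .@[ v ]" := (meval v p) (at level 3, format "p .@[ v ]") : ring_scope.

(** * Polynomials and their weighted norms *)

Section ComplexModulus.
Variable R : realType.
Local Notation C := (Cplx R).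
Implicit Types x y z : C.

(** Norms over [Cplx R] take their values in [Cplx R]. All estimates are made with this real-valued
    modulus, on which real arithmetic applies. *)
Definition nm (z : C) : R := Normc.normc z.

Lemma normE z : `|z| = ((nm z)%:C)%C :> C. Proof. by []. Qed.
Lemma nm_ge0 z : 0 <= nm z.
Proof. by case: z => a b; rewrite /nm /= sqrtr_ge0. Qed.
Lemma nm0 : nm 0 = 0. Proof. exact: Normc.normc0. Qed.
Lemma nm1 : nm 1 = 1. Proof. exact: Normc.normc1. Qed.
Lemma nmM x y : nm (x * y) = nm x * nm y. Proof. exact: Normc.normcM. Qed.
Lemma nmV x : nm (x^-1) = (nm x)^-1. Proof. exact: Normc.normcV. Qed.
Lemma nmD x y : nm (x + y) <= nm x + nm y. Proof. exact: le_normcD. Qed.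
Lemma nmN x : nm (- x) = nm x. Proof. exact: normcN. Qed.
Lemma nm_distC x y : nm (x - y) = nm (y - x).
Proof. by rewrite -nmN opprB. Qed.
Lemma nmB x y : nm (x - y) <= nm x + nm y.
Proof. by rewrite -(nmN y) nmD. Qed.
Lemma nm_eq0 x : (nm x == 0) = (x == 0).
Proof.
apply/eqP/eqP => [h|->]; last exact: nm0.
exact: Normc.eq0_normc.
Qed.
Lemma nm_gt0 x : (0 < nm x) = (x != 0).
Proof. by rewrite lt_neqAle nm_ge0 andbT eq_sym nm_eq0. Qed.
Lemma nmX x k : nm (x ^+ k) = nm x ^+ k.
Proof. by elim: k => [|k IH]; rewrite ?expr0 ?nm1 // !exprS nmM IH. Qed.
Lemma nm_nat k : nm k%:R = k%:R.
Proof.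
apply: (@complexI R); rewrite -normE rmorph_nat.
by rewrite ger0_norm // ler0n.
Qed.
Lemma nm_real (r : R) : nm (r%:C)%C = `|r|.
Proof. by rewrite /nm /= expr0n addr0 sqrtr_sqr. Qed.
Lemma nm_sum (I : Type) (s : seq I) (P : pred I) (F : I -> C) :
  nm (\sum_(i <- s | P i) F i) <= \sum_(i <- s | P i) nm (F i).
Proof.
elim/big_rec2: _ => [|i y x _ h]; first by rewrite nm0.
by apply: le_trans (nmD _ _) _; rewrite lerD2l.
Qed.
Lemma nm_prod (I : Type) (s : seq I) (P : pred I) (F : I -> C) :
  nm (\prod_(i <- s | P i) F i) = \prod_(i <- s | P i) nm (F i).
Proof. by elim/big_rec2: _ => [|i y x _ h]; rewrite ?nm1 // nmM h. Qed.

Lemma nm_Re z : `|complex.Re z| <= nm z.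
Proof. by rewrite -lecR -normE; exact: (@normc_ge_Re R). Qed.

Lemma nm_ImE z : nm z <= `|complex.Re z| + `|complex.Im z|.
Proof.
case: z => a b; rewrite /nm /=.
rewrite -(ler_pXn2r (n := 2)) ?nnegrE ?sqrtr_ge0 ?addr_ge0 //.
rewrite sqr_sqrtr ?addr_ge0 ?sqr_ge0 // -(real_normK (num_real a)) -(real_normK (num_real b)).
have := normr_ge0 a; have := normr_ge0 b; nra.
Qed.

Lemma nm_Im z : `|complex.Im z| <= nm z.
Proof.
case: z => a b; rewrite /nm /=.
rewrite -(ler_pXn2r (n := 2)) ?nnegrE ?sqrtr_ge0 ?normr_ge0 //.
rewrite sqr_sqrtr ?addr_ge0 ?sqr_ge0 // -(real_normK (num_real a)) -(real_normK (num_real b)).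
have := normr_ge0 a; have := normr_ge0 b; nra.
Qed.

Lemma nm_inv_bound x y : nm (x - y) <= nm y / 2 -> y != 0 -> x != 0.
Proof.
move=> h y0; apply/negP => /eqP x0; move: h; rewrite x0 sub0r nmN.
move: y0; rewrite -nm_gt0; lra.
Qed.

End ComplexModulus.

(** * Neighbourhoods of the origin and convergence with real epsilons *)

Section Near0.
Variables (R : realType) (N : nat).
Local Notation C := (Cplx R).

Definition inball (r : R) (z : 'rV[C]_N) := forall i, nm (z ord0 i) <= r.

Lemma near0P (P : 'rV[C]_N -> Prop) :
  (\forall z \near (0 : 'rV[C]_N), P z) <->
  exists2 r : R, 0 < r & forall z, inball r z -> P z.
Proof.
split.
  move=> /nbhs_ballP[e /= e0 h].
  have /complex_realP [e' ee] : e \is Num.real by rewrite realE ltW.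
  have e'0 : 0 < e' by move: e0; rewrite ee ltcR.
  exists (e' / 2) => [|z hz]; first lra.
  apply: h; split => // i j; rewrite ord1 mxE.
  rewrite -ball_normE /ball_ /= sub0r normrN normE ee ltcR.
  by apply: le_lt_trans (hz j) _; lra.
case=> r r0 h; apply/nbhs_ballP; exists (r%:C)%C => /=; first by rewrite ltcR.
move=> z /= [_ hz]; apply: h => i; have := hz ord0 i; rewrite mxE.
by rewrite -ball_normE /ball_ /= sub0r normrN normE ltcR => /ltW.
Qed.

Lemma near0_at (P : 'rV[C]_N -> Prop) :
  (\forall z \near (0 : 'rV[C]_N), P z) -> P 0.
Proof. by move/near0P => [r r0]; apply=> i; rewrite mxE nm0 ltW. Qed.

End Near0.

Lemma cplx_cvgP (R : realType) (u : nat -> Cplx R) (l : Cplx R) :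
  (u @ \oo --> l) <->
  forall e : R, 0 < e -> exists D, forall d, (D <= d)%N -> nm (u d - l) <= e.
Proof.
split.
  move=> /cvgrPdist_le h e e0.
  have : (0 : Cplx R) < (e%:C)%C by rewrite ltcR.
  move=> /h [D _ hD]; exists D => d Dd; have := hD d Dd.
  by rewrite /= normE lecR nm_distC.
move=> h; apply/cvgrPdist_le => e e0.
have /complex_realP [e' ee] : e \is Num.real by rewrite realE ltW.
have e'0 : 0 < e' by move: e0; rewrite ee ltcR.
have [D hD] := h _ e'0; exists D => // d /= Dd.
by rewrite normE ee lecR nm_distC; apply: hD.
Qed.

Lemma cplx_cvg_unique (R : realType) (u : nat -> Cplx R) (l l' : Cplx R) :
  (u @ \oo --> l) -> (u @ \oo --> l') -> l = l'.
Proof.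
move=> /cplx_cvgP h /cplx_cvgP h'; apply/eqP; rewrite -subr_eq0 -nm_eq0.
apply/negPn/negP => n0; have p : 0 < nm (l - l') by rewrite lt_neqAle nm_ge0 eq_sym n0.
have e0 : 0 < nm (l - l') / 4 by lra.
have [D hD] := h _ e0; have [D' hD'] := h' _ e0.
have h1 := hD (maxn D D') (leq_maxl _ _); have h2 := hD' (maxn D D') (leq_maxr _ _).
set x := u _ in h1 h2.
have : nm (l - l') <= nm (x - l) + nm (x - l').
  rewrite (nm_distC x l); apply: le_trans (nmD _ _).
  by rewrite addrA subrK.
lra.
Qed.

Lemma geom_small (R : realType) (K : R) : 0 <= K ->
  forall e : R, 0 < e -> exists D, forall d, (D <= d)%N -> K / 2 ^+ d <= e.
Proof.
move=> K0 e e0; have [D hD] : exists D, K / e <= D%:R.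
  exists (Num.bound (K / e)); apply/ltW/archi_boundP; exact: divr_ge0 (ltW e0).
exists D => d Dd; rewrite ler_pdivrMr ?exprn_gt0 // mulrC -ler_pdivrMr //.
apply: le_trans hD _; apply: (@le_trans _ _ d%:R); first by rewrite ler_nat.
rewrite -natrX ler_nat; exact/ltnW/ltn_expl.
Qed.

(* Completeness of C in the only form needed: geometric Cauchy sequences. *)
Lemma cplx_geometric_cvg (R : realType) (u : nat -> Cplx R) (K : R) :
  (forall d e, (d <= e)%N -> nm (u e - u d) <= K / 2 ^+ d) ->
  exists l : Cplx R, u @ \oo --> l.
Proof.
move=> h.
have K0 : 0 <= K by have := h 0%N 0%N (leqnn _); rewrite subrr nm0 expr0; lra.
have small := geom_small K0.
have aux (p : Cplx R -> R) : (forall x y, p (x - y) = p x - p y) ->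
   (forall z, `|p z| <= nm z) -> cvgn (fun d => p (u d)).
  move=> pB pn; apply: cauchy_cvg.
  apply/cauchy_ballP => e e0.
  have e2 : 0 < e / 3 by lra.
  have [D hD] := small _ e2.
  have hb x y : (D <= x)%N -> (D <= y)%N -> `|p (u x) - p (u y)| < e.
    move=> hx hy; have h1 := h _ _ hx; have h2 := h _ _ hy.
    have h3 := hD _ (leqnn D).
    have p1 := pn (u x - u D); have p2 := pn (u y - u D).
    rewrite (_ : _ - _ = (p (u x) - p (u D)) - (p (u y) - p (u D))); last ring.
    rewrite -(pB (u x)) -(pB (u y)); have := ler_normB (p (u x - u D)) (p (u y - u D)); lra.
  pose A := [set y | exists2 x, (D <= x)%N & y = p (u x)].
  exists (A, A); first by split; exists D => // x /= Dx; exists x.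
  by move=> [_ _] /= [[x hx ->] [y hy ->]]; rewrite /ball /= /ball_; exact: hb.
have c1 : cvgn (fun d => complex.Re (u d)).
  apply: (aux (@complex.Re R)); last exact: nm_Re.
  by case=> a b [c d].
have c2 : cvgn (fun d => complex.Im (u d)).
  apply: (aux (@complex.Im R)); last exact: nm_Im.
  by case=> a b [c d].
exists (Complex (limn (fun d => complex.Re (u d))) (limn (fun d => complex.Im (u d)))).
apply/cplx_cvgP => e e0; have e2 : 0 < e / 2 by lra.
move/cvgrPdist_le: c1 => /(_ _ e2)[D1 _ h1]; move/cvgrPdist_le: c2 => /(_ _ e2)[D2 _ h2].
exists (maxn D1 D2) => d; rewrite geq_max => /andP[/h1 /= k1 /h2 /= k2].
apply: le_trans (nm_ImE _) _.
case E: (u d) k1 k2 => [a b] /= k1 k2; rewrite distrC in k1; rewrite distrC in k2; lra.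
Qed.

Section PolyNorm.
Variables (R : realType) (N : nat).
Local Notation C := (Cplx R).
Implicit Types (p q : mpoly N C) (m : mon N) (r : R).

(** The weighted l1 norm, a majorant of the sup norm on the polydisc of radius [r]. It is
    submultiplicative and monotone in the moduli of the coefficients, which the sup norm is not. *)
Definition nrm r p : R := \sum_(m <- msupp p) nm (p@_m) * r ^+ mdeg m.

(** Polynomials with different supports can be compared termwise once both norms are summed over a
    common list. *)
Lemma nrmE r p (s : seq (mon N)) : uniq s -> {subset msupp p <= s} ->
  nrm r p = \sum_(m <- s) nm (p@_m) * r ^+ mdeg m.
Proof.
move=> us sub; rewrite /nrm [RHS](bigID (fun m => m \in msupp p)) /=.
rewrite [X in _ = _ + X]big1 ?addr0; last first.
  by move=> m /memN_msupp_eq0 ->; rewrite nm0 mul0r.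
rewrite -[RHS]big_filter; apply: perm_big; apply: uniq_perm.
- exact: msupp_uniq.
- exact: filter_uniq.
by move=> m; rewrite mem_filter; case: (boolP (m \in msupp p)) => // /sub ->.
Qed.

Lemma nrm_ge0 r p : 0 <= r -> 0 <= nrm r p.
Proof. by move=> r0; apply: sumr_ge0 => m _; rewrite mulr_ge0 ?nm_ge0 ?exprn_ge0. Qed.

Lemma nrm0 r : nrm r 0 = 0.
Proof. by rewrite /nrm msupp0 big_nil. Qed.

Lemma nrmD r p q : 0 <= r -> nrm r (p + q) <= nrm r p + nrm r q.
Proof.
move=> r0; set s := undup (msupp (p + q) ++ (msupp p ++ msupp q)).
have us : uniq s by exact: undup_uniq.
have h1 : {subset msupp (p + q) <= s}.
  by move=> m hm; rewrite mem_undup mem_cat hm.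
have h2 : {subset msupp p <= s}.
  by move=> m hm; rewrite mem_undup !mem_cat hm ?orbT.
have h3 : {subset msupp q <= s}.
  by move=> m hm; rewrite mem_undup !mem_cat hm ?orbT.
rewrite (nrmE r us h1) (nrmE r us h2) (nrmE r us h3) -big_split /=.
apply: ler_sum => m _; rewrite -mulrDl mcoeffD.
by apply: ler_wpM2r; rewrite ?exprn_ge0 ?nmD.
Qed.

Lemma nrmZ r c p : 0 <= r -> nrm r (c *: p) = nm c * nrm r p.
Proof.
move=> r0; rewrite (nrmE r (msupp_uniq p)); last exact: msuppZ_le.
rewrite mulr_sumr; apply: eq_bigr => m _; by rewrite mcoeffZ nmM mulrA.
Qed.

(* Restated at [mpoly N C]: the library lemmas rewrite to a scaling that [nrmZ] does not match. *)
Lemma mscalerAr c p q : p * (c *: q) = c *: (p * q).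
Proof. by rewrite -scalerAr. Qed.
Lemma mscalerAl c p q : (c *: p) * q = c *: (p * q).
Proof. by rewrite -scalerAl. Qed.

Lemma nrmN r p : 0 <= r -> nrm r (- p) = nrm r p.
Proof. by move=> r0; rewrite -scaleN1r nrmZ // nmN nm1 mul1r. Qed.

Lemma nrmB r p q : 0 <= r -> nrm r (p - q) <= nrm r p + nrm r q.
Proof. by move=> r0; rewrite -(nrmN q r0) nrmD. Qed.

Lemma nrm_sum r (I : Type) (s : seq I) (P : pred I) (F : I -> mpoly N C) : 0 <= r ->
  nrm r (\sum_(i <- s | P i) F i) <= \sum_(i <- s | P i) nrm r (F i).
Proof.
move=> r0; elim/big_rec2: _ => [|i y x _ h]; first by rewrite nrm0.
by apply: le_trans (nrmD _ _ r0) _; rewrite lerD2l.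
Qed.

Lemma nrmX r m : nrm r (mpolyX C m) = r ^+ mdeg m.
Proof. by rewrite /nrm msuppX big_seq1 mcoeffX eqxx nm1 mul1r. Qed.

Lemma nrm1 r : nrm r 1 = 1.
Proof. by rewrite -mpolyX0 nrmX mdeg0 expr0. Qed.

Lemma nrmMX r m p : 0 <= r -> nrm r (mpolyX C m * p) <= r ^+ mdeg m * nrm r p.
Proof.
move=> r0; rewrite [X in mpolyX _ _ * X]mpolyE mulr_sumr.
apply: le_trans (nrm_sum _ _ _ r0) _; rewrite mulr_sumr; apply: ler_sum => k _.
rewrite mscalerAr -mpolyXD nrmZ // nrmX mdegD exprD.
by rewrite mulrCA.
Qed.

Lemma nrmM r p q : 0 <= r -> nrm r (p * q) <= nrm r p * nrm r q.
Proof.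
move=> r0; rewrite [X in X * _]mpolyE mulr_suml.
apply: le_trans (nrm_sum _ _ _ r0) _; rewrite [X in _ <= X * _]/nrm mulr_suml; apply: ler_sum => k _.
rewrite mscalerAl nrmZ // -mulrA; apply: (ler_wpM2l (nm_ge0 _)).
exact: nrmMX.
Qed.

Lemma nrm_le r s p : 0 <= r <= s -> nrm r p <= nrm s p.
Proof.
move=> /andP[r0 rs]; apply: ler_sum => m _; apply: (ler_wpM2l (nm_ge0 _)).
exact: lerXn2r (r0) (le_trans r0 rs) rs.
Qed.

Definition ordge d p := forall m, (mdeg m < d)%N -> p@_m = 0.

(** The Schwarz lemma for this norm: every monomial present has degree at least [d] and gains the
    factor [r / s] that many times. *)
Lemma nrm_ordge r s p d : 0 <= r -> 0 < s -> r <= s -> ordge d p ->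
  nrm r p <= (r / s) ^+ d * nrm s p.
Proof.
move=> r0 s0 rs hp; rewrite /nrm mulr_sumr; apply: ler_sum => m _.
have [/hp ->|dm] := ltnP (mdeg m) d; first by rewrite nm0 !mul0r mulr0.
rewrite mulrCA; apply: (ler_wpM2l (nm_ge0 _)).
rewrite -(subnK dm) !exprD mulrCA.
rewrite -[(r/s)^+d]/((r / s) ^+ d) expr_div_n divfK ?expf_neq0 ?gt_eqF //.
apply: ler_wpM2r; first exact: exprn_ge0.
apply: lerXn2r => //; rewrite nnegrE; lra.
Qed.

Lemma meval_nrm r p (v : 'I_N -> C) : (forall i, nm (v i) <= r) -> nm p.@[v] <= nrm r p.
Proof.
move=> h; rewrite mevalE; apply: le_trans (nm_sum _ _ _) _; apply: ler_sum => m _.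
rewrite nmM; apply: (ler_wpM2l (nm_ge0 _)); rewrite nm_prod mdegE.
rewrite (big_morph (fun k => r ^+ k) (exprD r) (expr0 r)).
by apply: ler_prod => i _; rewrite nmX exprn_ge0 ?nm_ge0 //= lerXn2r // nnegrE ?nm_ge0 // (le_trans (nm_ge0 _) (h i)).
Qed.

Lemma ordgeD d p q : ordge d p -> ordge d q -> ordge d (p + q).
Proof. by move=> hp hq m hm; rewrite mcoeffD hp // hq // addr0. Qed.
Lemma ordgeN d p : ordge d p -> ordge d (- p).
Proof. by move=> hp m hm; rewrite mcoeffN hp // oppr0. Qed.
Lemma ordgeB d p q : ordge d p -> ordge d q -> ordge d (p - q).
Proof. by move=> hp hq; apply: ordgeD => //; exact: ordgeN. Qed.
Lemma ordgeZ d c p : ordge d p -> ordge d (c *: p).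
Proof. by move=> hp m hm; rewrite mcoeffZ hp // mulr0. Qed.
Lemma ordge_0 d : ordge d 0. Proof. by move=> m _; rewrite mcoeff0. Qed.
Lemma ordge0 p : ordge 0 p. Proof. by []. Qed.
Lemma ordge_le d e p : (e <= d)%N -> ordge d p -> ordge e p.
Proof. by move=> ed hp m hm; apply: hp; exact: leq_trans ed. Qed.
Lemma ordge_sum d (I : Type) (s : seq I) (P : pred I) (F : I -> mpoly N C) :
  (forall i, P i -> ordge d (F i)) -> ordge d (\sum_(i <- s | P i) F i).
Proof.
by move=> h; elim/big_rec: _ => [|i x /h hi hx]; [exact: ordge_0|exact: ordgeD].
Qed.
Lemma ordgeM d e p q : ordge d p -> ordge e q -> ordge (d + e) (p * q).
Proof.
move=> hp hq m hm; apply: memN_msupp_eq0; apply/negP => /msuppM_le /allpairsP.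
move=> [[m1 m2] /= [h1 h2 em]].
have d1 : (d <= mdeg m1)%N.
  by rewrite leqNgt; apply/negP => /hp h; move: h1; rewrite mcoeff_msupp h eqxx.
have d2 : (e <= mdeg m2)%N.
  by rewrite leqNgt; apply/negP => /hq h; move: h2; rewrite mcoeff_msupp h eqxx.
by move: hm; rewrite em mdegD ltnNge leq_add.
Qed.

End PolyNorm.

Lemma multinom_ind N (P : mon N -> Prop) :
  P mnm0 -> (forall i m, P m -> P (mnm_add (mnm1 i) m)) -> forall m, P m.
Proof.
move=> P0 PS m; have [k] := ubnP (mdeg m); elim: k m => // k IH m hm.
have [/eqP|] := boolP (mdeg m == 0%N); first by move/eqP; rewrite mdeg_eq0 => /eqP ->.
move=> n0; have [i hi] : exists i, m i != 0%N.
  apply/existsP; apply: contraNT n0; rewrite negb_exists => /forallP h.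
  rewrite mdegE big1 // => i _; apply/eqP; have := h i; by rewrite negbK.
have le : mpoly.lem (mnm1 i) m by rewrite lep1mP.
rewrite -(submK le) addmC; apply: PS; apply: IH.
by move: hm; rewrite -{1}(submK le) mdegD mdeg1 addn1 ltnS.
Qed.

Section Comp.
Variables (R : realType) (M N : nat).
Local Notation C := (Cplx R).
Implicit Types (p q : mpoly M C) (g : 'I_M -> mpoly N C).

Definition polyc p g : mpoly N C := comp_mpoly [tuple g i | i < M] p.

Definition mprod g (m : mon M) : mpoly N C := \prod_(i < M) g i ^+ m i.

Lemma polycE p g : polyc p g = \sum_(m <- msupp p) p@_m *: mprod g m.
Proof.
rewrite /polyc comp_mpolyE; apply: eq_bigr => m _; congr (_ *: _).
by apply: eq_bigr => i _; rewrite tnth_mktuple.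
Qed.

Lemma polycD p q g : polyc (p + q) g = polyc p g + polyc q g.
Proof. exact: comp_mpolyD. Qed.
Lemma polycB p q g : polyc (p - q) g = polyc p g - polyc q g.
Proof. exact: comp_mpolyB. Qed.

Lemma polycM p q g : polyc (p * q) g = polyc p g * polyc q g.
Proof. by rewrite /polyc rmorphM. Qed.
Lemma polycZ c p g : polyc (c *: p) g = c *: polyc p g.
Proof. exact: comp_mpolyZ. Qed.
Lemma polyc0 g : polyc 0 g = 0. Proof. exact: comp_mpoly0. Qed.
Lemma polyc1 g : polyc 1 g = 1. Proof. exact: comp_mpoly1. Qed.
Lemma polycX m g : polyc (mpolyX C m) g = mprod g m.
Proof. by rewrite polycE msuppX big_seq1 mcoeffX eqxx scale1r. Qed.
Lemma polyc_sum (I : Type) (s : seq I) (P : pred I) (F : I -> mpoly M C) g :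
  polyc (\sum_(i <- s | P i) F i) g = \sum_(i <- s | P i) polyc (F i) g.
Proof. by rewrite /polyc raddf_sum. Qed.

Lemma meval_polyc p g (v : 'I_N -> C) : (polyc p g).@[v] = p.@[fun i => (g i).@[v]].
Proof.
by rewrite /polyc comp_mpoly_meval; apply: meval_eq => i; rewrite tnth_mktuple.
Qed.

Lemma mprod0 g : mprod g mnm0 = 1.
Proof. by rewrite /mprod big1 // => i _; rewrite mnm0E expr0. Qed.

Lemma mprodU g i m : mprod g (mnm_add (mnm1 i) m) = g i * mprod g m.
Proof.
rewrite /mprod (bigD1 i) //= [in RHS](bigD1 i) //= mnmDE mnm1E eqxx exprD expr1 -mulrA.
congr (_ * (_ * _)); apply: eq_bigr => j ji.
by rewrite mnmDE mnm1E eq_sym (negbTE ji).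
Qed.

Lemma nrm_mprod r s g m : 0 <= r -> (forall i, nrm r (g i) <= s) ->
  nrm r (mprod g m) <= s ^+ mdeg m.
Proof.
move=> r0 h; elim/multinom_ind: m => [|i m IH]; first by rewrite mprod0 nrm1 mdeg0.
rewrite mprodU mdegD mdeg1 exprS; apply: le_trans (nrmM _ _ r0) _.
by apply: ler_pM => //; exact: nrm_ge0.
Qed.

Lemma nrm_polyc r s p g : 0 <= r -> (forall i, nrm r (g i) <= s) ->
  nrm r (polyc p g) <= nrm s p.
Proof.
move=> r0 h; rewrite polycE; apply: le_trans (nrm_sum _ _ _ r0) _.
apply: ler_sum => m _; rewrite nrmZ //; apply: (ler_wpM2l (nm_ge0 _)).
exact: nrm_mprod.
Qed.

Lemma ordge_mprod g m : (forall i, ordge 1 (g i)) -> ordge (mdeg m) (mprod g m).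
Proof.
move=> h; elim/multinom_ind: m => [|i m IH]; first by rewrite mdeg0; exact: ordge0.
by rewrite mprodU mdegD mdeg1; exact: ordgeM.
Qed.

Lemma ordge_polyc k p g : (forall i, ordge 1 (g i)) -> ordge k p -> ordge k (polyc p g).
Proof.
move=> h hp; rewrite polycE big_seq_cond; apply: ordge_sum => m /andP[hm _].
have [/hp e|km] := ltnP (mdeg m) k; first by rewrite mcoeff_msupp e eqxx in hm.
by apply: ordgeZ; apply: ordge_le km _; exact: ordge_mprod.
Qed.

(** One factor is exchanged at a time; each of the remaining [(mdeg m).-1] factors contributes order
    1. The predecessor is harmless at the constant monomial, where the difference is 0. *)
Lemma ordge_mprodB d g g' m : (forall i, ordge 1 (g i)) -> (forall i, ordge 1 (g' i)) ->
  (forall i, ordge d (g i - g' i)) -> ordge (d + (mdeg m).-1) (mprod g m - mprod g' m).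
Proof.
move=> h h' hd; elim/multinom_ind: m => [|i m IH].
  by rewrite !mprod0 subrr; exact: ordge_0.
rewrite !mprodU mdegD mdeg1 /= (_ : _ - _ = (g i - g' i) * mprod g m + g' i * (mprod g m - mprod g' m)); last by rewrite mulrBl mulrBr addrA subrK.
apply: ordgeD; first by apply: ordgeM => //; exact: ordge_mprod.
case E : (mdeg m) => [|k].
  move/eqP: E; rewrite mdeg_eq0 => /eqP ->; rewrite !mprod0 subrr mulr0; exact: ordge_0.
by rewrite E /= in IH; rewrite add0n -add1n addnCA; apply: ordgeM.
Qed.

(** Substituting into a polynomial of order [k] improves agreement by [k.-1] degrees. With [k = 2]
    this is the formal contraction behind the construction of the manifold. *)
Lemma ordge_polycB d k p g g' : (forall i, ordge 1 (g i)) -> (forall i, ordge 1 (g' i)) ->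
  (forall i, ordge d (g i - g' i)) -> ordge k p ->
  ordge (d + k.-1) (polyc p g - polyc p g').
Proof.
move=> h h' hd hp; rewrite !polycE -sumrB big_seq_cond; apply: ordge_sum => m /andP[hm _].
have [/hp e|km] := ltnP (mdeg m) k; first by rewrite mcoeff_msupp e eqxx in hm.
rewrite -scalerBr; apply: ordgeZ.
apply: ordge_le (ordge_mprodB h h' hd); rewrite leq_add2l.
by case: (k) km => // k' /=; case: (mdeg m).
Qed.

End Comp.

(** * Taylor and Cauchy estimates for polynomials *)

Section Taylor.
Variables (R : realType) (N : nat).
Local Notation C := (Cplx R).
Implicit Types (p q : mpoly N C).

Definition pdiff p (z u : 'I_N -> C) : C := \sum_i u i * (mderiv i p).@[z].

Lemma pdiffZ c p z u : pdiff (c *: p) z u = c * pdiff p z u.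
Proof.
by rewrite /pdiff mulr_sumr; apply: eq_bigr => i _; rewrite mderivZ mevalZ mulrCA.
Qed.
Lemma pdiffD p q z u : pdiff (p + q) z u = pdiff p z u + pdiff q z u.
Proof.
by rewrite /pdiff -big_split; apply: eq_bigr => i _; rewrite mderivD mevalD mulrDr.
Qed.
Lemma pdiff_sum (I : Type) (s : seq I) (P : pred I) (F : I -> mpoly N C) z u :
  pdiff (\sum_(i <- s | P i) F i) z u = \sum_(i <- s | P i) pdiff (F i) z u.
Proof.
elim/big_rec2: _ => [|i y x _ <-]; last by rewrite pdiffD.
by rewrite /pdiff big1 // => i _; rewrite mderiv0 meval0 mulr0.
Qed.

Lemma pdiffXM i p z u : pdiff (mpolyX C (mnm1 i) * p) z u = u i * p.@[z] + z i * pdiff p z u.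
Proof.
rewrite /pdiff mulr_sumr (bigD1 i) //= [in RHS](bigD1 i) //= addrA; congr (_ + _).
  rewrite mderivM mderivX mnm1E eqxx scale1r -[X in mnm_sub X _]add0m addmK mpolyX0 mul1r mevalD mevalM mevalXU; ring.
apply: eq_bigr => j ji.
rewrite mderivM mderivX mnm1E eq_sym (negbTE ji) scale0r mul0r add0r mevalM mevalXU; ring.
Qed.

Lemma meval_sumX p v : p.@[v] = \sum_(m <- msupp p) p@_m * (mpolyX C m).@[v].
Proof. by rewrite mevalE; apply: eq_bigr => m _; rewrite mevalX. Qed.

Lemma pdiff_sumX p z u : pdiff p z u = \sum_(m <- msupp p) p@_m * pdiff (mpolyX C m) z u.
Proof.
by rewrite {1}(mpolyE p) pdiff_sum; apply: eq_bigr => m _; rewrite pdiffZ.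
Qed.

(** Adding a variable gives [t] plus a quarter of the previous constant 2, so 2 is preserved. Powers
    of [r] stay on the left to avoid division. *)
Lemma pdiff_mon_bound m (r t : R) (z u : 'I_N -> C) (r0 : 0 < r) (tr : t <= r / 4)
  (hz : forall i, nm (z i) <= r / 4) (hu : forall i, nm (u i) <= t) :
  0 <= t -> nm (pdiff (mpolyX C m) z u) * r <= 2 * r ^+ mdeg m * t.
Proof.
move=> t0; elim/multinom_ind: m => [|i m IH].
  rewrite /pdiff big1 ?nm0 ?mul0r; last first.
    by move=> i _; rewrite mpolyX0 -mpolyC1 mderivC meval0 mulr0.
  by rewrite mdeg0 expr0 mulr1 mulr_ge0.
rewrite mpolyXD pdiffXM mdegD mdeg1 exprS.
have h1 : nm (mpolyX C m).@[z] <= r ^+ mdeg m.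
  rewrite -(nrmX (R := R) r m); apply: meval_nrm => i'; have := hz i'; lra.
apply: le_trans (ler_wpM2r (ltW r0) (nmD _ _)) _.
rewrite !nmM mulrDl.
have h2 : nm (u i) * nm (mpolyX C m).@[z] <= t * r ^+ mdeg m.
  by apply: ler_pM => //; exact: nm_ge0.
have h3 : nm (z i) * nm (pdiff (mpolyX C m) z u) * r <= r / 4 * (2 * r ^+ mdeg m * t).
  by rewrite -mulrA; apply: ler_pM => //; [exact: nm_ge0 | rewrite mulr_ge0 ?nm_ge0 // ltW].
have h4 := ler_wpM2r (ltW r0) h2.
have : 0 <= r * r ^+ mdeg m * t by rewrite !mulr_ge0 ?exprn_ge0 // ltW.
lra.
Qed.

(** Induction on the monomial: the remainder of [z_i * M] is [(z_i + u_i)] times that of [M], plus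
    [u_i] times the differential of [M]. As both vectors are bounded by [r / 4], the constant 4
    reproduces itself as 4 / 2 + 2. *)
Lemma taylor_mon m (r t : R) (z u : 'I_N -> C) (r0 : 0 < r) (tr : t <= r / 4)
  (hz : forall i, nm (z i) <= r / 4) (hu : forall i, nm (u i) <= t) :
  0 <= t ->
  nm ((mpolyX C m).@[fun i => z i + u i] - (mpolyX C m).@[z] - pdiff (mpolyX C m) z u) * r ^+ 2
  <= 4 * r ^+ mdeg m * t ^+ 2.
Proof.
move=> t0; elim/multinom_ind: m => [|i m IH].
  rewrite /pdiff big1 ?nm0 ?mul0r; last first.
    by move=> i _; rewrite mpolyX0 -mpolyC1 mderivC meval0 mulr0.
  rewrite mpolyX0 !meval1 !subrr nm0 mul0r; rewrite mdeg0 expr0 mulr1.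
  by rewrite mulr_ge0 ?exprn_ge0.
rewrite mpolyXD pdiffXM mdegD mdeg1 (exprS r (mdeg m)) !mevalM !mevalXU.
set A := (mpolyX C m).@[_] in IH *; set B := (mpolyX C m).@[z] in IH *.
set D := pdiff _ _ _ in IH *.
rewrite (_ : _ - _ = (z i + u i) * (A - B - D) + u i * D); last ring.
have hD : nm D * r <= _ := pdiff_mon_bound m r0 tr hz hu t0.
have hs : nm (z i + u i) <= r / 2.
  have := nmD (z i) (u i); have := hz i; have := hu i; lra.
have h1 : nm (z i + u i) * (nm (A - B - D) * r ^+ 2) <= r / 2 * (4 * r ^+ mdeg m * t ^+ 2).
  apply: ler_pM => //; first exact: nm_ge0.
  by apply: mulr_ge0; [exact: nm_ge0 | exact/exprn_ge0/ltW].
have h2 : nm (u i) * (nm D * r) <= t * (2 * r ^+ mdeg m * t).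
  apply: ler_pM => //; first exact: nm_ge0.
  by rewrite mulr_ge0 ?nm_ge0 // ltW.
have h3 := ler_wpM2r (ltW r0) h2.
have r20 : 0 <= r ^+ 2 by exact/exprn_ge0/ltW.
apply: le_trans (ler_wpM2r r20 (nmD _ _)) _.
rewrite !nmM; lra.
Qed.

Lemma taylor_poly p (r t : R) (z u : 'I_N -> C) (r0 : 0 < r) (tr : t <= r / 4)
  (hz : forall i, nm (z i) <= r / 4) (hu : forall i, nm (u i) <= t) :
  0 <= t ->
  nm (p.@[fun i => z i + u i] - p.@[z] - pdiff p z u) * r ^+ 2 <= 4 * nrm r p * t ^+ 2.
Proof.
move=> t0; rewrite !(meval_sumX p) pdiff_sumX -!sumrB.
have r20 : 0 <= r ^+ 2 by exact/exprn_ge0/ltW.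
apply: le_trans (ler_wpM2r r20 (nm_sum _ _ _)) _.
rewrite /nrm mulr_sumr !mulr_suml; apply: ler_sum => m _.
rewrite -!mulrBr nmM.
have := ler_wpM2l (nm_ge0 p@_m) (taylor_mon m r0 tr hz hu t0); lra.
Qed.

(** The differential contributes the constant 2; for [t <= r / 4] the quadratic remainder is at most
    linear in [t] with constant 1. *)
Lemma lipschitz_poly p (r t : R) (z u : 'I_N -> C) (r0 : 0 < r) (tr : t <= r / 4)
  (hz : forall i, nm (z i) <= r / 4) (hu : forall i, nm (u i) <= t) :
  0 <= t ->
  nm (p.@[fun i => z i + u i] - p.@[z]) * r <= 3 * nrm r p * t.
Proof.
move=> t0.
have hd : nm (pdiff p z u) * r <= 2 * nrm r p * t.
  rewrite pdiff_sumX.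
  apply: le_trans (ler_wpM2r (ltW r0) (nm_sum _ _ _)) _.
  rewrite /nrm mulr_sumr !mulr_suml; apply: ler_sum => m _.
  rewrite nmM.
  have := ler_wpM2l (nm_ge0 p@_m) (pdiff_mon_bound m r0 tr hz hu t0); lra.
have h1 := taylor_poly p r0 tr hz hu t0.
set X := p.@[_] - p.@[z] in h1 *; have := nmD (X - pdiff p z u) (pdiff p z u); rewrite subrK => h2.
have P0 := nrm_ge0 p (ltW r0).
have h3 : nm (X - pdiff p z u) * r <= nrm r p * t.
  rewrite -(ler_pM2r r0); move: h1; rewrite !expr2 => h1.
  have : 0 <= nrm r p * t by rewrite mulr_ge0.
  move=> /ler_wpM2l /(_ _ _ tr) => h3.
  lra.
have := ler_wpM2r (ltW r0) h2; lra.
Qed.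

End Taylor.

(** A Cauchy estimate: halving the radius gains a factor 2 per degree, and an exponent is at most
    the degree, which is at most the corresponding power of 2. *)
Lemma nrm_mderiv (R : realType) N r (p : mpoly N (Cplx R)) i : 0 < r ->
  nrm (r / 2) (mderiv i p) * r <= 2 * nrm r p.
Proof.
move=> r0; have r2 : 0 <= r / 2 by lra.
have -> : mderiv i p = \sum_(m <- msupp p) p@_m *: mderiv i (mpolyX _ m).
  by rewrite {1}(mpolyE p) raddf_sum; apply: eq_bigr => m _ /=; rewrite mderivZ.
apply: le_trans (ler_wpM2r (ltW r0) (nrm_sum _ _ _ r2)) _.
rewrite [X in _ <= 2 * X]/nrm mulr_suml mulr_sumr; apply: ler_sum => m _.
rewrite mderivX !nrmZ // nrmX nm_nat.
have [->|mi] := eqVneq (m i) 0%N.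
  by rewrite mul0r mulr0 mul0r !mulr_ge0 ?nm_ge0 // exprn_ge0 // ltW.
have le : mpoly.lem (mnm1 i) m by rewrite lep1mP.
have hm : mdeg m = (mdeg (mnm_sub m (mnm1 i))).+1.
  by rewrite -{1}(submK le) mdegD mdeg1 addn1.
have hi : (m i <= mdeg m)%N by rewrite mdegE (bigD1 i) //= leq_addr.
set k := mdeg (mnm_sub _ _) in hm *.
have : (m i)%:R * (r / 2) ^+ k * r <= 2 * r ^+ mdeg m.
  rewrite hm exprS expr_div_n.
  have : (m i)%:R <= 2 * 2 ^+ k :> R.
    rewrite -exprS -natrX ler_nat; apply: leq_trans hi _; rewrite hm; exact/ltnW/ltn_expl.
  move=> h; have h2 : 0 < 2 ^+ k :> R by rewrite exprn_gt0.
  have : (m i)%:R / 2 ^+ k <= 2 :> R by rewrite ler_pdivrMr.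
  have rk : 0 <= r ^+ k * r by rewrite mulr_ge0 ?exprn_ge0 // ltW.
  move/(ler_wpM2r rk); lra.
move/(ler_wpM2l (nm_ge0 p@_m)); lra.
Qed.

(** * Power series and their sums *)

Section Series.
Variables (R : realType) (N : nat).
Local Notation C := (Cplx R).
Implicit Types (a b : mon N -> C) (p : mpoly N C) (m : mon N).

(* [tr], [ev] and the series operations are locked: otherwise unification compares
   two of them by unfolding, which is prohibitively slow. *)
Definition tr : nat -> (mon N -> C) -> mpoly N C :=
  locked (fun d a => \sum_(m : bmultinom N d) a m *: mpolyX C m).

Lemma trE d a : tr d a = \sum_(m : bmultinom N d) a m *: mpolyX C m.
Proof. by rewrite /tr -lock. Qed.

Lemma mcoeff_tr d a m : (tr d a)@_m = if (mdeg m < d)%N then a m else 0.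
Proof.
case: ifP => h; first by rewrite trE mcoeff_mpoly.
rewrite trE raddf_sum big1 // => k _ /=; rewrite mcoeffZ mcoeffX.
case: eqP => [e|_]; last by rewrite mulr0.
by move: h; rewrite -e bmdeg.
Qed.

(** A bound on the whole majorant series, phrased through truncations so that no infinite sum of
    norms has to be formed. *)
Definition bnd r a (K : R) := forall d, nrm r (tr d a) <= K.
Definition sconv a := exists2 r : R, 0 < r & exists K, bnd r a K.
Definition ev : (mon N -> C) -> 'rV[C]_N -> C :=
  locked (fun a z => lim ((fun d => (tr d a).@[fun i => z ord0 i]) @ \oo)).
Definition sord d a := forall m, (mdeg m < d)%N -> a m = 0.

(** Bounds for an operation on series come from any one polynomial with the correct coefficients
    below degree [d], such as a product of truncations; its higher terms only enlarge the norm. *)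
Lemma nrm_tr_le r d a p : 0 <= r -> (forall m, (mdeg m < d)%N -> p@_m = a m) ->
  nrm r (tr d a) <= nrm r p.
Proof.
move=> r0 h; set s := undup (msupp (tr d a) ++ msupp p).
have us : uniq s by exact: undup_uniq.
rewrite (nrmE r us) => [|m hm]; last by rewrite mem_undup mem_cat hm.
rewrite (nrmE r us (p := p)) => [|m hm]; last by rewrite mem_undup mem_cat hm orbT.
apply: ler_sum => m _; apply: ler_wpM2r; first exact: exprn_ge0.
by rewrite mcoeff_tr; case: ifP => [/h ->|_] //; rewrite nm0 nm_ge0.
Qed.

Lemma ordge_tr_sub d a p q : (forall m, (mdeg m < d)%N -> p@_m = a m) ->
  (forall m, (mdeg m < d)%N -> q@_m = a m) -> ordge d (p - q).
Proof. by move=> h h' m hm; rewrite mcoeffB h // h' // subrr. Qed.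

Lemma mcoeff_tr_lt d a m : (mdeg m < d)%N -> (tr d a)@_m = a m.
Proof. by rewrite mcoeff_tr => ->. Qed.

Lemma sum_nrm_le r p (s : seq (mon N)) : 0 <= r -> uniq s ->
  \sum_(m <- s) nm (p@_m) * r ^+ mdeg m <= nrm r p.
Proof.
move=> r0 us.
have u2 : uniq (s ++ [seq m <- msupp p | m \notin s]).
  rewrite cat_uniq us filter_uniq ?msupp_uniq // andbT.
  by apply/hasPn => m; rewrite mem_filter => /andP[].
rewrite (nrmE r u2) => [|m hm]; last by rewrite mem_cat mem_filter hm andbT orbN.
rewrite big_cat /= lerDl; apply: sumr_ge0 => m _.
by rewrite mulr_ge0 ?nm_ge0 ?exprn_ge0.
Qed.

Lemma bnd_sum r a K (s : seq (mon N)) : 0 <= r -> bnd r a K -> uniq s ->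
  \sum_(m <- s) nm (a m) * r ^+ mdeg m <= K.
Proof.
move=> r0 h us; pose D := (\max_(m <- s) mdeg m).+1.
apply: le_trans (h D); apply: le_trans (sum_nrm_le _ r0 us).
rewrite le_eqVlt; apply/orP; left; apply/eqP; apply: eq_big_seq => m hm.
by rewrite mcoeff_tr_lt // ltnS; apply: leq_bigmax_seq.
Qed.

Lemma bndP r a K : 0 <= r ->
  (forall s : seq (mon N), uniq s -> \sum_(m <- s) nm (a m) * r ^+ mdeg m <= K) ->
  bnd r a K.
Proof.
move=> r0 h d; apply: le_trans (h _ (msupp_uniq (tr d a))).
apply: ler_sum => m _; apply: ler_wpM2r; first exact: exprn_ge0.
by rewrite mcoeff_tr; case: ifP => // _; rewrite nm0 nm_ge0.
Qed.

Lemma bnd_ge0 r a K : 0 <= r -> bnd r a K -> 0 <= K.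
Proof. by move=> r0 /(_ 0%N); apply: le_trans; exact: nrm_ge0. Qed.

Lemma bnd_le r s a K L : 0 <= r <= s -> K <= L -> bnd s a K -> bnd r a L.
Proof. by move=> rs KL h d; apply: le_trans (nrm_le _ rs) (le_trans (h d) KL). Qed.

Section Realize.
Variables (r K : R) (a : mon N -> C) (P : nat -> mpoly N C).

Lemma bnd_realize : 0 <= r -> (forall d m, (mdeg m < d)%N -> (P d)@_m = a m) ->
  (forall d, nrm r (P d) <= K) -> bnd r a K.
Proof. by move=> r0 h hK d; apply: le_trans (hK d); apply: nrm_tr_le => //; exact: h. Qed.

End Realize.

Lemma meval_ordge r p d K (z : 'I_N -> C) : 0 < r -> ordge d p -> nrm r p <= K ->
  (forall i, nm (z i) <= r / 2) -> nm p.@[z] <= K / 2 ^+ d.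
Proof.
move=> r0 hp hK hz; apply: le_trans (meval_nrm _ hz) _.
have h1 : 0 <= r / 2 by lra.
have h2 : r / 2 <= r by lra.
apply: le_trans (nrm_ordge h1 r0 h2 hp) _.
have -> : r / 2 / r = 2^-1 by field; rewrite gt_eqF.
by rewrite exprVn mulrC; apply: ler_wpM2r.
Qed.

(** Two truncations differ by terms of order [d], worth a factor [2^-d] at half the radius. The
    explicit rate serves later to identify limits. *)
Lemma tr_cvg r a K (z : 'rV[C]_N) : 0 < r -> bnd r a K -> inball (r / 2) z ->
  forall d, nm ((tr d a).@[fun i => z ord0 i] - ev a z) <= (2 * K) / 2 ^+ d.
Proof.
move=> r0 ha hz.
have cauchy d e : (d <= e)%N ->
    nm ((tr e a).@[fun i => z ord0 i] - (tr d a).@[fun i => z ord0 i]) <= (2 * K) / 2 ^+ d.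
  move=> de; rewrite -mevalB; apply: (meval_ordge r0) => //.
    apply: ordge_tr_sub (mcoeff_tr_lt a) => m hm.
    by apply: mcoeff_tr_lt; exact: leq_trans hm de.
  by apply: le_trans (nrmB _ _ (ltW r0)) _; have := ha d; have := ha e; lra.
have [l hl] := cplx_geometric_cvg cauchy.
have -> : ev a z = l by rewrite /ev -lock; apply: (cvg_lim (@norm_hausdorff _ _)).
move=> d; apply/ler_addgt0Pr => e e0.
move/cplx_cvgP: hl => /(_ e e0)[D hD].
have h1 := hD (maxn D d) (leq_maxl _ _).
have h2 := cauchy _ _ (leq_maxr D d).
rewrite nm_distC in h2.
apply: le_trans (lerD h2 h1); apply: le_trans (nmD _ _).
by rewrite addrA subrK.
Qed.

(** The value of a series can be computed along any bounded polynomials with the right low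
    coefficients. Products and compositions of truncations are such polynomials without being
    truncations. *)
Lemma realize_cvg r K a (P : nat -> mpoly N C) (z : 'rV[C]_N) : 0 < r ->
  (forall d m, (mdeg m < d)%N -> (P d)@_m = a m) ->
  (forall d, nrm r (P d) <= K) -> inball (r / 2) z ->
  forall d, nm ((P d).@[fun i => z ord0 i] - ev a z) <= (4 * K) / 2 ^+ d.
Proof.
move=> r0 h hK hz d.
have ha := bnd_realize (ltW r0) h hK.
have h1 := tr_cvg r0 ha hz d.
have h2 : nm ((P d).@[fun i => z ord0 i] - (tr d a).@[fun i => z ord0 i]) <= (2 * K) / 2 ^+ d.
  rewrite -mevalB; apply: (meval_ordge r0) => //.
    by apply: ordge_tr_sub (h d) _ => m; exact: mcoeff_tr_lt.
  by apply: le_trans (nrmB _ _ (ltW r0)) _; have := ha d; have := hK d; lra.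
set x := _.@[_] in h2 *; set y := _.@[_] in h1 h2.
have -> : x - ev a z = (x - y) + (y - ev a z) by rewrite addrA subrK.
have := nmD (x - y) (y - ev a z); lra.
Qed.

Lemma geom_unique (K L : R) (u : nat -> C) (x y : C) :
  (forall d, nm (u d - x) <= K / 2 ^+ d) -> (forall d, nm (u d - y) <= L / 2 ^+ d) -> x = y.
Proof.
have aux (Z : R) w : (forall d, nm (u d - w) <= Z / 2 ^+ d) -> u @ \oo --> w.
  move=> h; apply/cplx_cvgP => e e0.
  have Z0 : 0 <= Z by have := h 0%N; rewrite expr0 divr1; apply: le_trans; exact: nm_ge0.
  have [D hD] := geom_small Z0 e0; exists D => d /hD; exact: le_trans.
by move=> /aux h /aux h'; exact: cplx_cvg_unique h h'.
Qed.

Lemma ev_bound r a K z : 0 < r -> bnd r a K -> inball (r / 2) z -> nm (ev a z) <= 3 * K.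
Proof.
move=> r0 ha hz; have := tr_cvg r0 ha hz 0%N; rewrite expr0 divr1.
have -> : tr 0 a = 0.
  by apply/mpolyP => m; rewrite mcoeff_tr ltn0 mcoeff0.
by rewrite meval0 sub0r nmN; have := bnd_ge0 (ltW r0) ha; lra.
Qed.

Lemma ev_at0 a : sconv a -> ev a 0 = a mnm0.
Proof.
move=> [r r0 [K ha]].
have hz : inball (r / 2) (0 : 'rV[C]_N) by move=> i; rewrite mxE nm0; lra.
apply: (@geom_unique (2 * K) (nm (a mnm0)) (fun d => (tr d a).@[fun i => (0 : 'rV[C]_N) ord0 i])).
  exact: tr_cvg ha hz.
(* The truncation at 0 is the zero polynomial, which explains the constant [nm (a mnm0)]; all later
   ones take the value [a mnm0] at the origin. *)
move=> [|d].
  rewrite (_ : tr 0 a = 0) ?meval0 ?sub0r ?nmN ?expr0 ?divr1 //.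
  by apply/mpolyP => m; rewrite mcoeff_tr ltn0 mcoeff0.
rewrite (_ : _.@[_] = a mnm0) ?subrr ?nm0 ?mulr_ge0 ?nm_ge0 ?invr_ge0 ?exprn_ge0 //.
rewrite trE raddf_sum (bigD1 (bm0 : bmultinom N d.+1)) //= mevalZ mpolyX0 meval1 mulr1 big1 ?addr0 // => m hm.
rewrite mevalZ mevalX; have [i hi] : exists i, m i != 0%N.
  apply/existsP; apply: contraNT hm; rewrite negb_exists => /forallP h.
  by apply/eqP/val_inj/mnmP => i /=; rewrite mnm0E; apply/eqP; have := h i; rewrite negbK.
by rewrite (bigD1 i) //= mxE expr0n (negbTE hi) mul0r mulr0.
Qed.

End Series.

Section SeriesOps.
Variables (R : realType).
Local Notation C := (Cplx R).

Section Ops.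
Variable N : nat.
Implicit Types (a b : mon N -> C) (p : mpoly N C) (m : mon N).

Definition sadd a b m := a m + b m.
Definition ssub a b m := a m - b m.
Definition sscl (c : C) a m := c * a m.
Definition ssum (I : finType) (P : pred I) (F : I -> mon N -> C) m := \sum_(i | P i) F i m.
Definition spol p m := p@_m.
Definition svar : 'I_N -> mon N -> C := locked (fun i => spol (mpolyX C (mnm1 i))).
(** A coefficient of degree k is read from truncations at k + 1, the shortest that see it; [sprodE]
    shows that longer ones agree. [scomp] is built in the same way, which is legitimate when the
    inner series have no constant term. *)
Definition sprod : (mon N -> C) -> (mon N -> C) -> mon N -> C :=
  locked (fun a b m => (tr (mdeg m).+1 a * tr (mdeg m).+1 b)@_m).
Definition sder : 'I_N -> (mon N -> C) -> mon N -> C :=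
  locked (fun i a m => a (mnm_add m (mnm1 i)) *+ (m i).+1).
Definition smul (k : mon N -> C) a m := k m * a m.
(** Division by the monomial [u], discarding the terms that it does not divide. *)
Definition sshift (u : mon N) a m := a (mnm_add m u).

End Ops.

Definition scomp M N : (mon M -> C) -> ('I_M -> mon N -> C) -> mon N -> C :=
  locked (fun h g m => (polyc (tr (mdeg m).+1 h) (fun i => tr (mdeg m).+1 (g i)))@_m).

Lemma svarE N (i : 'I_N) : svar i = spol (mpolyX C (mnm1 i)).
Proof. by rewrite /svar -lock. Qed.
Lemma sprod_coef N (a b : mon N -> C) m :
  sprod a b m = (tr (mdeg m).+1 a * tr (mdeg m).+1 b)@_m.
Proof. by rewrite /sprod -lock. Qed.
Lemma sderE N (i : 'I_N) (a : mon N -> C) m : sder i a m = a (mnm_add m (mnm1 i)) *+ (m i).+1.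
Proof. by rewrite /sder -lock. Qed.
Lemma scomp_coef M N (h : mon M -> C) (g : 'I_M -> mon N -> C) m :
  scomp h g m = (polyc (tr (mdeg m).+1 h) (fun i => tr (mdeg m).+1 (g i)))@_m.
Proof. by rewrite /scomp -lock. Qed.

Section OpsTheory.
Variable N : nat.
Implicit Types (a b : mon N -> C) (p : mpoly N C) (m : mon N).

Lemma tr_sadd d a b : tr d (sadd a b) = tr d a + tr d b.
Proof.
by apply/mpolyP => m; rewrite mcoeffD !mcoeff_tr /sadd; case: ifP; rewrite ?addr0.
Qed.
Lemma tr_ssub d a b : tr d (ssub a b) = tr d a - tr d b.
Proof.
by apply/mpolyP => m; rewrite mcoeffB !mcoeff_tr /ssub; case: ifP; rewrite ?subr0.
Qed.
Lemma tr_sscl d c a : tr d (sscl c a) = c *: tr d a.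
Proof.
by apply/mpolyP => m; rewrite mcoeffZ !mcoeff_tr /sscl; case: ifP; rewrite ?mulr0.
Qed.
Lemma tr_ssum d (I : finType) (P : pred I) (F : I -> mon N -> C) :
  tr d (ssum P F) = \sum_(i | P i) tr d (F i).
Proof.
apply/mpolyP => m; rewrite mcoeff_tr raddf_sum /ssum; case: ifP => h.
  by apply: eq_bigr => i _ /=; rewrite mcoeff_tr h.
by rewrite big1 // => i _ /=; rewrite mcoeff_tr h.
Qed.

Lemma ordge_tr_tr d e a : (d <= e)%N -> ordge d (tr e a - tr d a).
Proof.
move=> de; apply: ordge_tr_sub (mcoeff_tr_lt a) => m hm.
by apply: mcoeff_tr_lt; exact: leq_trans hm de.
Qed.

Lemma coef_ordge d p q m : ordge d (p - q) -> (mdeg m < d)%N -> p@_m = q@_m.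
Proof. by move=> h /h; rewrite mcoeffB => /eqP; rewrite subr_eq0 => /eqP. Qed.

Lemma ordge_tr_spol d p : ordge d (p - tr d (spol p)).
Proof. by move=> m hm; rewrite mcoeffB mcoeff_tr_lt // subrr. Qed.

Lemma ordge_prodB d p p' q q' : ordge d (p - p') -> ordge d (q - q') ->
  ordge d (p * q - p' * q').
Proof.
move=> h h'; rewrite (_ : _ - _ = (p - p') * q + p' * (q - q')); last first.
  by rewrite mulrBl mulrBr addrA subrK.
apply: ordgeD; first by rewrite -[d]addn0; apply: ordgeM => //; exact: ordge0.
by rewrite -[d]add0n; apply: ordgeM => //; exact: ordge0.
Qed.

Lemma sprodE d a b m : (mdeg m < d)%N -> (tr d a * tr d b)@_m = sprod a b m.
Proof.
move=> hm; rewrite sprod_coef; apply: (@coef_ordge (mdeg m).+1); last exact: ltnSn.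
by apply: ordge_prodB; apply: ordge_tr_tr.
Qed.

Lemma bnd_sadd r a b K L : 0 <= r -> bnd r a K -> bnd r b L -> bnd r (sadd a b) (K + L).
Proof.
move=> r0 ha hb d; rewrite tr_sadd; apply: le_trans (nrmD _ _ r0) _; exact: lerD.
Qed.
Lemma bnd_ssub r a b K L : 0 <= r -> bnd r a K -> bnd r b L -> bnd r (ssub a b) (K + L).
Proof.
move=> r0 ha hb d; rewrite tr_ssub; apply: le_trans (nrmB _ _ r0) _; exact: lerD.
Qed.
Lemma bnd_sscl r c a K : 0 <= r -> bnd r a K -> bnd r (sscl c a) (nm c * K).
Proof.
by move=> r0 ha d; rewrite tr_sscl nrmZ //; apply: (ler_wpM2l (nm_ge0 _)).
Qed.
Lemma bnd_ssum r (I : finType) (P : pred I) (F : I -> mon N -> C) (K : I -> R) : 0 <= r ->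
  (forall i, P i -> bnd r (F i) (K i)) -> bnd r (ssum P F) (\sum_(i | P i) K i).
Proof.
move=> r0 h d; rewrite tr_ssum; apply: le_trans (nrm_sum _ _ _ r0) _.
by apply: ler_sum => i /h.
Qed.
Lemma bnd_spol r p : 0 <= r -> bnd r (spol p) (nrm r p).
Proof. by move=> r0 d; apply: nrm_tr_le. Qed.
Lemma bnd_svar r (i : 'I_N) : 0 <= r -> bnd r (svar i) r.
Proof. by move=> r0; have := @bnd_spol r (mpolyX C (mnm1 i)) r0; rewrite svarE nrmX mdeg1 expr1. Qed.
Lemma bnd_sprod r a b K L : 0 <= r -> bnd r a K -> bnd r b L -> bnd r (sprod a b) (K * L).
Proof.
move=> r0 ha hb d; apply: (@le_trans _ _ (nrm r (tr d a * tr d b))).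
  by apply: (@nrm_tr_le _ _ r d (sprod a b) (tr d a * tr d b) r0) => m hm; exact: sprodE.
apply: le_trans (nrmM _ _ r0) _.
by apply: ler_pM => //; exact: nrm_ge0.
Qed.
Lemma bnd_smul r k a c K : 0 <= r -> 0 <= c -> (forall m, nm (k m) <= c) ->
  bnd r a K -> bnd r (smul k a) (c * K).
Proof.
move=> r0 c0 hk ha; apply: bndP => // s us.
apply: le_trans (ler_wpM2l c0 (bnd_sum r0 ha us)).
rewrite mulr_sumr; apply: ler_sum => m _; rewrite mulrA; apply: ler_wpM2r; first exact: exprn_ge0.
by rewrite nmM; apply: ler_wpM2r; first exact: nm_ge0.
Qed.
Lemma bnd_sshift r u a K : 0 < r -> bnd r a K -> bnd r (sshift u a) (K / r ^+ mdeg u).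
Proof.
move=> r0 ha; apply: bndP; first exact: ltW.
move=> s us; rewrite ler_pdivlMr ?exprn_gt0 //.
have us' : uniq [seq mnm_add m u | m <- s] by rewrite map_inj_uniq //; exact: addIm.
apply: le_trans (bnd_sum (ltW r0) ha us').
rewrite big_map mulr_suml le_eqVlt; apply/orP; left; apply/eqP; apply: eq_bigr => m _.
by rewrite /sshift mdegD exprD mulrA.
Qed.
Lemma tr_sder d i a : tr d (sder i a) = mderiv i (tr d.+1 a).
Proof.
apply/mpolyP => m; rewrite mcoeff_deriv !mcoeff_tr sderE mdegD mdeg1 addn1 ltnS.
by case: ifP => // _; rewrite mul0rn.
Qed.
Lemma bnd_sder r i a K : 0 < r -> bnd r a K -> bnd (r / 2) (sder i a) (2 * K / r).
Proof.
move=> r0 ha d; rewrite tr_sder ler_pdivlMr //.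
by apply: le_trans (nrm_mderiv _ _ r0) _; rewrite ler_wpM2l.
Qed.

Lemma bnd_sord r s a K d : 0 <= r -> 0 < s -> r <= s -> sord d a -> bnd s a K ->
  bnd r a ((r / s) ^+ d * K).
Proof.
move=> r0 s0 rs ha hb e; have h : ordge d (tr e a).
  by move=> m hm; rewrite mcoeff_tr ha // if_same.
apply: le_trans (nrm_ordge r0 s0 rs h) _; apply: ler_wpM2l => //.
by rewrite exprn_ge0 // divr_ge0 // ltW.
Qed.

Lemma sconv_family (I : finType) (a : I -> mon N -> C) : (forall i, sconv (a i)) ->
  exists2 r : R, 0 < r & exists K, forall i, bnd r (a i) K.
Proof.
move=> h.
have : forall i, exists rK : R * R, 0 < rK.1 /\ bnd rK.1 (a i) rK.2.
  by move=> i; have [r r0 [K hK]] := h i; exists (r, K).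
move=> /boolp.choice [f hf].
exists (\big[Num.min/1]_i (f i).1).
  by apply: (big_ind (fun x => 0 < x)) => // [x y hx hy|i _]; [rewrite lt_min hx | case: (hf i)].
exists (\sum_i (f i).2) => i; have [p q] := hf i.
apply: bnd_le q.
  apply/andP; split; last exact: bigmin_le_cond.
  by apply: (big_ind (fun x => 0 <= x)) => // [x y hx hy|j _]; [rewrite le_min hx | case: (hf j) => /ltW].
rewrite (bigD1 i) //= lerDl; apply: sumr_ge0 => j _.
by have [p' q'] := hf j; exact: bnd_ge0 (ltW p') q'.
Qed.

Lemma sconv_both a b : sconv a -> sconv b ->
  exists2 r : R, 0 < r & exists2 K, bnd r a K & bnd r b K.
Proof.
move=> ha hb; have := @sconv_family bool (fun c => if c then a else b).
by case=> [[]//|r r0 [K h]]; exists r => //; exists K; [exact: (h true)|exact: (h false)].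
Qed.

Lemma sconv_sadd a b : sconv a -> sconv b -> sconv (sadd a b).
Proof.
move=> ha hb; have [r r0 [K h h']] := sconv_both ha hb.
by exists r => //; exists (K + K); apply: bnd_sadd => //; exact: ltW.
Qed.
Lemma sconv_ssub a b : sconv a -> sconv b -> sconv (ssub a b).
Proof.
move=> ha hb; have [r r0 [K h h']] := sconv_both ha hb.
by exists r => //; exists (K + K); apply: bnd_ssub => //; exact: ltW.
Qed.
Lemma sconv_sprod a b : sconv a -> sconv b -> sconv (sprod a b).
Proof.
move=> ha hb; have [r r0 [K h h']] := sconv_both ha hb.
by exists r => //; exists (K * K); apply: bnd_sprod => //; exact: ltW.
Qed.
Lemma sconv_sscl c a : sconv a -> sconv (sscl c a).
Proof.
by move=> [r r0 [K h]]; exists r => //; exists (nm c * K); apply: bnd_sscl => //; exact: ltW.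
Qed.
Lemma sconv_spol p : sconv (spol p).
Proof. by exists 1 => //; exists (nrm 1 p); exact: bnd_spol. Qed.
Lemma sconv_svar (i : 'I_N) : sconv (svar i). Proof. by rewrite svarE; exact: sconv_spol. Qed.
Lemma sconv_sder i a : sconv a -> sconv (sder i a).
Proof.
by move=> [r r0 [K h]]; exists (r / 2); [lra | exists (2 * K / r); exact: bnd_sder].
Qed.
Lemma sconv_sshift u a : sconv a -> sconv (sshift u a).
Proof.
by move=> [r r0 [K h]]; exists r => //; exists (K / r ^+ mdeg u); exact: bnd_sshift.
Qed.
Lemma sconv_ssum (I : finType) (P : pred I) (F : I -> mon N -> C) :
  (forall i, P i -> sconv (F i)) -> sconv (ssum P F).
Proof.
move=> h.
have -> : ssum P F = ssum P (fun i => if P i then F i else spol 0).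
  by apply/funext => m; apply: eq_bigr => i ->.
have [i|r r0 [K hK]] := @sconv_family I (fun i => if P i then F i else spol 0).
  by case: ifP => [/h //|_]; exact: sconv_spol.
exists r => //; exists (\sum_(i | P i) K); apply: bnd_ssum; first exact: ltW.
by move=> i _; exact: hK.
Qed.
Lemma sconv_smul k a c : (forall m, nm (k m) <= c) -> sconv a -> sconv (smul k a).
Proof.
move=> hk [r r0 [K h]]; exists r => //; exists (c * K); apply: bnd_smul => //; first exact: ltW.
by apply: le_trans (hk mnm0); exact: nm_ge0.
Qed.

Lemma sconv_cvg a : sconv a -> \forall z \near (0 : 'rV[C]_N),
  (fun d => (tr d a).@[fun i => (z : 'rV[C]_N) ord0 i]) @ \oo --> ev a z.
Proof.
move=> [r r0 [K h]]; apply/near0P; exists (r / 2); first lra.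
move=> z hz; apply/cplx_cvgP => e e0.
have K0 : 0 <= 2 * K by have := bnd_ge0 (ltW r0) h; lra.
have [D hD] := geom_small K0 e0; exists D => d /hD.
exact: le_trans (tr_cvg r0 h hz d).
Qed.

Lemma ev_lim a (z : 'rV[C]_N) (l : C) :
  ((fun d => (tr d a).@[fun i => z ord0 i]) @ \oo --> l) -> ev a z = l.
Proof. by move=> h; rewrite /ev -lock; apply: (cvg_lim (@norm_hausdorff _ _)). Qed.

Lemma ev_sadd a b : sconv a -> sconv b ->
  \forall z \near (0 : 'rV[C]_N), ev (sadd a b) z = ev a z + ev b z.
Proof.
move=> /sconv_cvg ha /sconv_cvg hb; apply: filterS2 ha hb => z ha hb; apply: ev_lim.
under eq_fun do rewrite tr_sadd mevalD.
exact: (cvgD ha hb).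
Qed.

Lemma ev_ssub a b : sconv a -> sconv b ->
  \forall z \near (0 : 'rV[C]_N), ev (ssub a b) z = ev a z - ev b z.
Proof.
move=> /sconv_cvg ha /sconv_cvg hb; apply: filterS2 ha hb => z ha hb; apply: ev_lim.
under eq_fun do rewrite tr_ssub mevalB.
exact: (cvgB ha hb).
Qed.

Lemma ev_sscl c a : sconv a ->
  \forall z \near (0 : 'rV[C]_N), ev (sscl c a) z = c * ev a z.
Proof.
move=> /sconv_cvg ha; apply: filterS ha => z ha; apply: ev_lim.
under eq_fun do rewrite tr_sscl mevalZ.
exact: (cvgM (cvg_cst c) ha).
Qed.

Lemma ev_spol p (z : 'rV[C]_N) : ev (spol p) z = p.@[fun i => z ord0 i].
Proof.
apply: ev_lim; apply: cvg_near_cst; exists (msize p) => // d /= hd.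
congr (meval _ _); apply/mpolyP => m; rewrite mcoeff_tr; case: ltnP => // h.
by rewrite memN_msupp_eq0 //; apply: msize_mdeg_ge; exact: leq_trans hd h.
Qed.

Lemma ev_svar (i : 'I_N) (z : 'rV[C]_N) : ev (svar i) z = z ord0 i.
Proof. by rewrite svarE ev_spol mevalXU. Qed.

Lemma ev_sprod a b : sconv a -> sconv b ->
  \forall z \near (0 : 'rV[C]_N), ev (sprod a b) z = ev a z * ev b z.
Proof.
move=> ha hb; have [r r0 [K h h']] := sconv_both ha hb.
have c1 := sconv_cvg ha; have c2 := sconv_cvg hb.
have cr : \forall z \near (0 : 'rV[C]_N), inball (r / 2) z.
  by apply/near0P; exists (r / 2); first lra.
apply: filterS3 c1 c2 cr => z h1 h2 hz.
apply: (@cplx_cvg_unique R (fun d => (tr d a * tr d b).@[fun i => z ord0 i])); last first.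
  under eq_fun do rewrite mevalM.
  exact: (cvgM h1 h2).
apply/cplx_cvgP => e e0.
have K0 : 0 <= 4 * (K * K) by have := bnd_ge0 (ltW r0) h; nra.
have [D hD] := geom_small K0 e0; exists D => d /hD.
apply: le_trans; apply: (@realize_cvg R N r (K * K) (sprod a b) (fun d => tr d a * tr d b)) => //.
- by move=> d' m; exact: sprodE.
- move=> d'; apply: le_trans (nrmM _ _ (ltW r0)) _.
  by apply: ler_pM => //; exact: nrm_ge0 (ltW r0).
Qed.

Lemma cvg_bigsum (I : Type) (s : seq I) (P : pred I) (f : I -> nat -> C) (l : I -> C) :
  (forall i, f i @ \oo --> l i) ->
  (fun d => \sum_(i <- s | P i) f i d) @ \oo --> \sum_(i <- s | P i) l i.
Proof.
move=> h; elim: s => [|i s IH].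
  by rewrite big_nil; under eq_fun do rewrite big_nil; exact: cvg_cst.
rewrite big_cons; under eq_fun do rewrite big_cons.
case: (P i); last exact: IH.
exact: (cvgD (h i) IH).
Qed.

Lemma ev_ssum (I : finType) (P : pred I) (F : I -> mon N -> C) :
  (forall i, P i -> sconv (F i)) ->
  \forall z \near (0 : 'rV[C]_N), ev (ssum P F) z = \sum_(i | P i) ev (F i) z.
Proof.
move=> h.
have -> : ssum P F = ssum P (fun i => if P i then F i else spol 0).
  by apply/funext => m; apply: eq_bigr => i ->.
have [i|r r0 [K hK]] := @sconv_family I (fun i => if P i then F i else spol 0).
  by case: ifP => [/h //|_]; exact: sconv_spol.
apply/near0P; exists (r / 2); first lra.
move=> z hz; apply: ev_lim.
have -> : \sum_(i | P i) ev (F i) z = \sum_(i | P i) ev (if P i then F i else spol 0) z.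
  by apply: eq_bigr => i ->.
have -> : (fun d => (tr d (ssum P (fun i => if P i then F i else spol 0))).@[fun i => z ord0 i])
  = (fun d => \sum_(i | P i) (tr d (if P i then F i else spol 0)).@[fun i => z ord0 i]).
  by apply/funext => d; rewrite tr_ssum raddf_sum.
apply: cvg_bigsum => i; apply/cplx_cvgP => e e0.
have K0 : 0 <= 2 * K by have := bnd_ge0 (ltW r0) (hK i); lra.
have [D hD] := geom_small K0 e0; exists D => d /hD.
exact: le_trans (tr_cvg r0 (hK i) hz d).
Qed.

End OpsTheory.
End SeriesOps.

(** * Order of vanishing, agreement up to a degree, formal derivatives *)

Section Coefficients.
Variables (R : realType) (N : nat).
Local Notation C := (Cplx R).
Implicit Types (a b : mon N -> C) (p q : mpoly N C) (m : mon N).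

Definition eqd d a b := forall m, (mdeg m < d)%N -> a m = b m.

Lemma ordge_tr_sord d e a : sord d a -> ordge d (tr e a).
Proof. by move=> ha m hm; rewrite mcoeff_tr ha // if_same. Qed.

Lemma ordge_tr_eqd d e a b : eqd d a b -> ordge d (tr e a - tr e b).
Proof. by move=> h m hm; rewrite mcoeffB !mcoeff_tr h // subrr. Qed.

Lemma sord_le d e a : (d <= e)%N -> sord e a -> sord d a.
Proof. by move=> de h m hm; apply: h; exact: leq_trans hm de. Qed.

Lemma sord_sprod d e k a b : sord d a -> sord e b -> (k <= d + e)%N -> sord k (sprod a b).
Proof.
move=> ha hb kde m hm; rewrite sprod_coef; apply: (ordgeM (d := d) (e := e)); try exact: ordge_tr_sord.
exact: leq_trans hm kde.
Qed.
Lemma sord_sadd d a b : sord d a -> sord d b -> sord d (sadd a b).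
Proof. by move=> ha hb m hm; rewrite /sadd ha // hb // addr0. Qed.
Lemma sord_ssub d a b : sord d a -> sord d b -> sord d (ssub a b).
Proof. by move=> ha hb m hm; rewrite /ssub ha // hb // subr0. Qed.
Lemma sord_sscl d c a : sord d a -> sord d (sscl c a).
Proof. by move=> ha m hm; rewrite /sscl ha // mulr0. Qed.
Lemma sord_smul d k a : sord d a -> sord d (smul k a).
Proof. by move=> ha m hm; rewrite /smul ha // mulr0. Qed.
Lemma sord_ssum d (I : finType) (P : pred I) (F : I -> mon N -> C) :
  (forall i, P i -> sord d (F i)) -> sord d (ssum P F).
Proof. by move=> h m hm; rewrite /ssum big1 // => i /h; apply. Qed.
Lemma sord_sshift d u a : sord (d + mdeg u) a -> sord d (sshift u a).
Proof. by move=> ha m hm; rewrite /sshift ha // mdegD ltn_add2r. Qed.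
Lemma sord_sder d i a : sord d.+1 a -> sord d (sder i a).
Proof. by move=> ha m hm; rewrite sderE ha ?mul0rn // mdegD mdeg1 addn1. Qed.
Lemma sord_svar (i : 'I_N) : sord 1 (svar R i).
Proof.
move=> m; rewrite ltnS leqn0 mdeg_eq0 => /eqP ->.
by rewrite svarE /spol mcoeffX mnm1_eq0.
Qed.

Lemma eqd_sprod d d' e e' k a a' b b' : sord e b -> sord e' a' ->
  eqd d a a' -> eqd d' b b' -> (k <= d + e)%N -> (k <= d' + e')%N ->
  eqd k (sprod a b) (sprod a' b').
Proof.
move=> hb ha' haa hbb k1 k2 m hm; rewrite !sprod_coef; apply: (@coef_ordge _ _ k) => //.
rewrite (_ : _ - _ = (tr (mdeg m).+1 a - tr (mdeg m).+1 a') * tr (mdeg m).+1 b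
   + tr (mdeg m).+1 a' * (tr (mdeg m).+1 b - tr (mdeg m).+1 b')); last first.
  by rewrite mulrBl mulrBr addrA subrK.
apply: ordgeD.
  by apply: ordge_le k1 _; apply: ordgeM; [exact: ordge_tr_eqd | exact: ordge_tr_sord].
apply: ordge_le k2 _; rewrite addnC.
by apply: ordgeM; [exact: ordge_tr_sord | exact: ordge_tr_eqd].
Qed.
Lemma eqd_sadd d a a' b b' : eqd d a a' -> eqd d b b' -> eqd d (sadd a b) (sadd a' b').
Proof. by move=> h h' m hm; rewrite /sadd h // h'. Qed.
Lemma eqd_ssub d a a' b b' : eqd d a a' -> eqd d b b' -> eqd d (ssub a b) (ssub a' b').
Proof. by move=> h h' m hm; rewrite /ssub h // h'. Qed.
Lemma eqd_smul d k a a' : eqd d a a' -> eqd d (smul k a) (smul k a').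
Proof. by move=> h m hm; rewrite /smul h. Qed.
Lemma eqd_ssum d (I : finType) (P : pred I) (F F' : I -> mon N -> C) :
  (forall i, P i -> eqd d (F i) (F' i)) -> eqd d (ssum P F) (ssum P F').
Proof. by move=> h m hm; apply: eq_bigr => i /h; apply. Qed.
Lemma eqd_sshift d u a a' : eqd (d + mdeg u) a a' -> eqd d (sshift u a) (sshift u a').
Proof. by move=> h m hm; rewrite /sshift h // mdegD ltn_add2r. Qed.

Lemma sder_sadd i a b : sder i (sadd a b) = sadd (sder i a) (sder i b).
Proof. by apply/funext => m; rewrite /sadd !sderE mulrnDl. Qed.
Lemma sder_ssub i a b : sder i (ssub a b) = ssub (sder i a) (sder i b).
Proof. by apply/funext => m; rewrite /ssub !sderE mulrnBl. Qed.
Lemma sder_ssum i (I : finType) (P : pred I) (F : I -> mon N -> C) :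
  sder i (ssum P F) = ssum P (fun k => sder i (F k)).
Proof. by apply/funext => m; rewrite /ssum sderE -sumrMnl; apply: eq_bigr => k _; rewrite sderE. Qed.
Lemma sder_spol i p : sder i (spol p) = spol (mderiv i p).
Proof. by apply/funext => m; rewrite /spol sderE mcoeff_deriv. Qed.
Lemma sder_svar (i j : 'I_N) : sder i (svar R j) = spol (i == j)%:R.
Proof.
rewrite svarE sder_spol mderivX mnm1E eq_sym; congr spol.
case: eqP => [->|_]; last by rewrite scale0r.
by rewrite scale1r -[X in mnm_sub X _]add0m addmK mpolyX0.
Qed.
Lemma sderC i j a : sder i (sder j a) = sder j (sder i a).
Proof.
apply/funext => m; rewrite !sderE -!addmA [mnm_add (mnm1 i) _]addmC -!mulrnA.
congr (_ *+ _); rewrite !mnmDE !mnm1E [j == i]eq_sym; case: eqP => [->|_] //.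
by rewrite !addn0 mulnC.
Qed.

Lemma sder_sprod i a b :
  sder i (sprod a b) = sadd (sprod (sder i a) b) (sprod a (sder i b)).
Proof.
apply/funext => m; rewrite sderE /sadd.
rewrite -(sprodE (d := (mdeg m).+2)) ?mdegD ?mdeg1 ?addn1 // -mcoeff_deriv mderivM mcoeffD.
rewrite -!tr_sder !sprod_coef.
apply: (f_equal2 (fun x y : C => x + y)).
all: apply: (@coef_ordge _ _ (mdeg m).+1 _ _ m _ (ltnSn _)); apply: ordge_prodB.
- by rewrite subrr; exact: ordge_0.
- by apply: ordge_tr_tr.
- by apply: ordge_tr_tr.
- by rewrite subrr; exact: ordge_0.
Qed.

End Coefficients.

(** * Substitution of series *)

Section Composition.
Variables (R : realType) (M N : nat).
Local Notation C := (Cplx R).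
Implicit Types (h : mon M -> C) (g : 'I_M -> mon N -> C) (p : mpoly M C).

Lemma scompE d h g m : (forall i, sord 1 (g i)) -> (mdeg m < d)%N ->
  (polyc (tr d h) (fun i => tr d (g i)))@_m = scomp h g m.
Proof.
move=> hg hm; rewrite scomp_coef; apply: (@coef_ordge _ _ (mdeg m).+1 _ _ m _ (ltnSn _)).
set e := (mdeg m).+1; set G := fun i => tr d (g i); set G' := fun i => tr e (g i).
have hG i : ordge 1 (G i) by exact: ordge_tr_sord.
have hG' i : ordge 1 (G' i) by exact: ordge_tr_sord.
rewrite (_ : _ - _ = polyc (tr d h - tr e h) G + (polyc (tr e h) G - polyc (tr e h) G')); last first.
  by rewrite polycB addrA subrK.
apply: ordgeD; first by apply: ordge_polyc => //; exact: ordge_tr_tr.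
rewrite -[e]addn0; apply: (@ordge_polycB _ _ _ e 0) => //.
by move=> i; exact: ordge_tr_tr.
Qed.

Lemma bnd_scomp r s h g K : 0 <= r -> bnd s h K -> (forall i, sord 1 (g i)) ->
  (forall i, bnd r (g i) s) -> bnd r (scomp h g) K.
Proof.
move=> r0 hh hg bg d.
apply: (@le_trans _ _ (nrm r (polyc (tr d h) (fun i => tr d (g i))))).
  apply: (@nrm_tr_le _ _ r d (scomp h g) (polyc (tr d h) (fun i => tr d (g i))) r0) => m hm.
  exact: scompE hg hm.
by apply: le_trans (hh d); apply: nrm_polyc => // i; exact: bg.
Qed.

Lemma sord_scomp k h g : sord k h -> (forall i, sord 1 (g i)) -> sord k (scomp h g).
Proof.
move=> hh hg m hm; rewrite scomp_coef; apply: (@ordge_polyc _ _ _ k) => // [i|]; exact: ordge_tr_sord.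
Qed.

Lemma eqd_scomp d k e h g g' : sord k h -> (forall i, sord 1 (g i)) ->
  (forall i, sord 1 (g' i)) -> (forall i, eqd d (g i) (g' i)) -> (e <= d + k.-1)%N ->
  eqd e (scomp h g) (scomp h g').
Proof.
move=> hh hg hg' hgg ek m hm; rewrite !scomp_coef; apply: (@coef_ordge _ _ e) => //; apply: ordge_le ek _.
by apply: ordge_polycB => [i|i|i|]; [exact: ordge_tr_sord|exact: ordge_tr_sord|exact: ordge_tr_eqd|exact: ordge_tr_sord].
Qed.

(** Without constant term the norm is at most linear in the radius, hence as small as desired. *)
Lemma bnd_small (g : 'I_M -> mon N -> C) e : (forall i, sconv (g i)) -> (forall i, sord 1 (g i)) -> 0 < e ->
  exists2 r, 0 < r & forall i, bnd r (g i) e.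
Proof.
move=> cg hg e0; have [s s0 [K hK]] := sconv_family cg.
have [L L0 KL] : exists2 L, 0 < L & K <= L.
  by exists (Num.max 1 K); rewrite ?lt_max ?ltr01 // le_max lexx orbT.
pose r := Num.min s (s * e / L).
have r0 : 0 < r by rewrite lt_min s0 divr_gt0 // mulr_gt0.
exists r => // i.
have hL : bnd s (g i) L by apply: bnd_le (hK i) => //; rewrite lexx ltW.
have rs : r <= s by rewrite /r ge_min lexx.
have rL : r <= s * e / L by rewrite /r ge_min lexx orbT.
apply: bnd_le (bnd_sord (ltW r0) s0 rs (hg i) hL); first by rewrite (ltW r0) lexx.
by rewrite expr1 -ler_pdivlMr // ler_pdivrMr // [_ * s]mulrC mulrA.
Qed.

Lemma sconv_scomp h g : sconv h -> (forall i, sconv (g i)) -> (forall i, sord 1 (g i)) ->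
  sconv (scomp h g).
Proof.
move=> [s s0 [K hK]] cg hg; have [r r0 hr] := bnd_small cg hg s0.
by exists r => //; exists K; apply: bnd_scomp hK hg hr; exact: ltW.
Qed.

Lemma ev_scomp h g : sconv h -> (forall i, sconv (g i)) -> (forall i, sord 1 (g i)) ->
  \forall z \near (0 : 'rV[C]_N), ev (scomp h g) z = ev h (\row_i ev (g i) z).
Proof.
move=> [s s0 [K hK]] cg hg.
(* [ev_bound] loses a factor 3, and 3 s / 16 is below s / 4, the range in which [lipschitz_poly]
   applies at radius [s]. *)
have s16 : 0 < s / 16 by lra.
have [r r0 hr] := bnd_small cg hg s16.
have hrs i : bnd r (g i) s.
  by apply: bnd_le (hr i); rewrite ?lexx ?ltW //; lra.
apply/near0P; exists (r / 2); first lra.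
move=> z hz; set x := \row_i _.
have K0 : 0 <= K := bnd_ge0 (ltW s0) hK.
have hx i : nm (x ord0 i) <= s / 4.
  by rewrite mxE; have := ev_bound r0 (hr i) hz; lra.
have hx2 : inball (s / 2) x by move=> i; have := hx i; lra.
have P1 d' m : (mdeg m < d')%N -> (polyc (tr d' h) (fun i => tr d' (g i)))@_m = scomp h g m.
  exact: scompE.
have P2 d' : nrm r (polyc (tr d' h) (fun i => tr d' (g i))) <= K.
  by apply: le_trans (hK d'); apply: nrm_polyc => [|i]; [exact: ltW | exact: hrs].
apply: (@geom_unique _ (4 * K) (2 * K + 3 * K * (2 / 16))
  (fun d => (polyc (tr d h) (fun i => tr d (g i))).@[fun i => z ord0 i])).
  exact: (realize_cvg r0 P1 P2 hz).
move=> d; rewrite meval_polyc.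
set y := fun i => (tr d (g i)).@[_].
pose u := fun i => y i - x ord0 i.
pose t := 2 * (s / 16) / 2 ^+ d.
have p2 : 1 <= 2 ^+ d :> R by rewrite exprn_ege1 // ler1n.
have p20 : 0 < 2 ^+ d :> R by rewrite exprn_gt0.
have t0 : 0 <= t by rewrite /t mulr_ge0 ?invr_ge0 ?ltW // mulr_gt0.
have ts : t <= s / 4.
  by rewrite /t ler_pdivrMr //; nra.
have hu i : nm (u i) <= t by rewrite /u /x mxE; exact: (tr_cvg r0 (hr i) hz d).
have := lipschitz_poly (tr d h) s0 ts hx hu t0.
rewrite (_ : (tr d h).@[fun i => _ + u i] = (tr d h).@[y]); last first.
  by apply: meval_eq => i; rewrite /u addrC subrK.
move=> h1; have h2 := tr_cvg s0 hK hx2 d.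
set A := _.@[y] in h1 *; set B := _.@[_] in h1 h2.
have h3 : nm (A - B) <= 3 * K * (2 / 16) / 2 ^+ d.
  rewrite -(ler_pM2r s0); apply: le_trans h1 _.
  have : 3 * nrm s (tr d h) * t <= 3 * K * t.
    by apply: ler_wpM2r => //; rewrite ler_wpM2l.
  rewrite /t; lra.
have -> : A - ev h x = (A - B) + (B - ev h x) by rewrite addrA subrK.
have := nmD (A - B) (B - ev h x); lra.
Qed.

Lemma mderiv_mprod i (G : 'I_M -> mpoly N C) (m : mon M) :
  mderiv i (mprod G m) = \sum_k polyc (mderiv k (mpolyX C m)) G * mderiv i (G k).
Proof.
elim/multinom_ind: m => [|j m IH].
  rewrite mprod0 -mpolyC1 mderivC big1 // => k _.
  by rewrite mpolyX0 -mpolyC1 mderivC polyc0 mul0r.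
rewrite mprodU mderivM IH mpolyXD.
have e k : polyc (mderiv k (mpolyX C (mnm1 j) * mpolyX C m)) G
    = (k == j)%:R * mprod G m + G j * polyc (mderiv k (mpolyX C m)) G.
  rewrite mderivM polycD !polycM polycX polycX -[X in _ + mprod G X * _]addm0 mprodU mprod0 mulr1.
  congr (_ * _ + _); rewrite mderivX mnm1E eq_sym; case: eqP => [->|_]; last by rewrite scale0r polyc0.
  by rewrite scale1r -[X in mnm_sub X _]add0m addmK mpolyX0 polyc1.
transitivity (\sum_k ((k == j)%:R * mprod G m * mderiv i (G k)
    + G j * (polyc (mderiv k (mpolyX C m)) G * mderiv i (G k)))); last first.
  by apply: eq_bigr => k _; rewrite e mulrDl mulrA.
rewrite big_split /= -mulr_sumr; congr (_ + _).
rewrite (bigD1 j) //= eqxx mul1r big1 ?addr0 1?mulrC // => k kj.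
by rewrite (negbTE kj) !mul0r.
Qed.

Lemma mderiv_polyc i p (G : 'I_M -> mpoly N C) :
  mderiv i (polyc p G) = \sum_k polyc (mderiv k p) G * mderiv i (G k).
Proof.
have e k : polyc (mderiv k p) G = \sum_(m <- msupp p) p@_m *: polyc (mderiv k (mpolyX C m)) G.
  rewrite {1}(mpolyE p) raddf_sum polyc_sum; apply: eq_bigr => m _ /=.
  by rewrite mderivZ polycZ.
transitivity (\sum_k \sum_(m <- msupp p)
    p@_m *: (polyc (mderiv k (mpolyX C m)) G * mderiv i (G k))); last first.
  apply: eq_bigr => k _; rewrite e mulr_suml; apply: eq_bigr => m _.
  by rewrite mscalerAl.
rewrite exchange_big /= polycE raddf_sum; apply: eq_bigr => m _ /=.
by rewrite mderivZ mderiv_mprod scaler_sumr.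
Qed.

Lemma sder_scomp i h g : (forall i, sord 1 (g i)) ->
  sder i (scomp h g) = ssum predT (fun k => sprod (scomp (sder k h) g) (sder i (g k))).
Proof.
move=> hg; apply/funext => m; rewrite sderE /ssum.
set d := (mdeg m).+2.
rewrite -(scompE (d := d)) // ?mdegD ?mdeg1 ?addn1 // -mcoeff_deriv mderiv_polyc raddf_sum /=.
apply: eq_bigr => k _; rewrite -!tr_sder.
rewrite -(@sprodE R N (mdeg m).+1 _ _ m (ltnSn _)).
apply: (@coef_ordge _ _ (mdeg m).+1 _ _ m _ (ltnSn _)); apply: ordge_prodB; last first.
  by rewrite subrr; exact: ordge_0.
move=> m' hm'; rewrite mcoeffB (mcoeff_tr_lt _ hm') -(scompE (d := (mdeg m).+1)) //.
rewrite -mcoeffB; apply: (@ordge_polycB _ _ _ (mdeg m).+1 0) => //.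
- by move=> j; exact: ordge_tr_sord.
- by move=> j; exact: ordge_tr_sord.
- by move=> j; apply: ordge_tr_tr.
- by rewrite addn0.
Qed.

End Composition.

(** * Taylor expansion of sums and the identity theorem *)

Section Uniqueness.
Variables (R : realType) (N : nat).
Local Notation C := (Cplx R).
Implicit Types (a b : mon N -> C) (p q : mpoly N C) (m : mon N).

Lemma nm_lim_le (u : nat -> C) (l : C) (B : R) :
  u @ \oo --> l -> (forall d, nm (u d) <= B) -> nm l <= B.
Proof.
move=> /cplx_cvgP h hB; apply/ler_addgt0Pr => e e0; have [D hD] := h e e0.
have h1 := hD _ (leqnn D); rewrite nm_distC in h1.
have := nmD (l - u D) (u D); rewrite subrK; have := hB D; lra.
Qed.

Lemma tr_cvgS r a K (z : 'rV[C]_N) : 0 < r -> bnd r a K -> inball (r / 2) z ->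
  (fun d => (tr d.+1 a).@[fun i => z ord0 i]) @ \oo --> ev a z.
Proof.
move=> r0 ha hz; apply/cplx_cvgP => e e0.
have K0 : 0 <= 2 * K by have := bnd_ge0 (ltW r0) ha; lra.
have [D hD] := geom_small K0 e0; exists D => d hd.
exact: le_trans (tr_cvg r0 ha hz d.+1) (hD _ (leqW hd)).
Qed.

Lemma tr_cvg0 r a K (z : 'rV[C]_N) : 0 < r -> bnd r a K -> inball (r / 2) z ->
  (fun d => (tr d a).@[fun i => z ord0 i]) @ \oo --> ev a z.
Proof.
move=> r0 ha hz; apply/cplx_cvgP => e e0.
have K0 : 0 <= 2 * K by have := bnd_ge0 (ltW r0) ha; lra.
have [D hD] := geom_small K0 e0; exists D => d hd.
exact: le_trans (tr_cvg r0 ha hz d) (hD _ hd).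
Qed.

Lemma taylor_ev r a K t (z u : 'rV[C]_N) : 0 < r -> bnd r a K -> inball (r / 4) z ->
  0 <= t -> t <= r / 4 -> inball t u ->
  nm (ev a (z + u) - ev a z - \sum_i u ord0 i * ev (sder i a) z) * r ^+ 2 <= 4 * K * t ^+ 2.
Proof.
move=> r0 ha hz t0 tr4 hu.
have r20 : 0 < r ^+ 2 by rewrite exprn_gt0.
rewrite -ler_pdivlMr //.
have hz2 : inball (r / 2) z by move=> i; have := hz i; lra.
have hzu : inball (r / 2) (z + u).
  by move=> i; rewrite mxE; have := nmD (z ord0 i) (u ord0 i); have := hz i; have := hu i; lra.
(* The truncations are taken at [d.+1] because their derivatives are the truncations at [d] of the
   derivative series. *)
have c1 := tr_cvgS r0 ha hzu; have c2 := tr_cvgS r0 ha hz2.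
have r2 : 0 < r / 2 by lra.
have hz4 : inball (r / 2 / 2) z by move=> i; have := hz i; lra.
have c3 : (fun d => \sum_i u ord0 i * (tr d (sder i a)).@[fun i => z ord0 i]) @ \oo
    --> \sum_i u ord0 i * ev (sder i a) z.
  apply: cvg_bigsum => i.
  have h := tr_cvg0 r2 (bnd_sder i r0 ha) hz4.
  exact: (cvgM (cvg_cst (u ord0 i)) h).
have c : (fun d => (tr d.+1 a).@[fun i => (z + u) ord0 i] - (tr d.+1 a).@[fun i => z ord0 i]
    - \sum_i u ord0 i * (tr d (sder i a)).@[fun i => z ord0 i]) @ \oo -->
    ev a (z + u) - ev a z - \sum_i u ord0 i * ev (sder i a) z.
  exact: (cvgB (cvgB c1 c2) c3).
apply: (nm_lim_le c) => d; rewrite ler_pdivlMr // => {c c1 c2 c3}.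
have h := @taylor_poly _ _ (tr d.+1 a) r t (fun i => z ord0 i) (fun i => u ord0 i) r0 tr4 hz hu t0.
have h2 : 4 * nrm r (tr d.+1 a) * t ^+ 2 <= 4 * K * t ^+ 2.
  by apply: ler_wpM2r; [exact: exprn_ge0 | rewrite ler_wpM2l].
apply: le_trans h2; apply: le_trans h.
have -> : \sum_i u ord0 i * (tr d (sder i a)).@[fun i => z ord0 i]
    = pdiff (tr d.+1 a) (fun i => z ord0 i) (fun i => u ord0 i).
  by rewrite /pdiff; apply: eq_bigr => i _; rewrite tr_sder.
have -> : (tr d.+1 a).@[fun i => (z + u) ord0 i] = (tr d.+1 a).@[fun i => z ord0 i + u ord0 i].
  by apply: meval_eq => i; rewrite mxE.
by [].
Qed.

(* [S] is the set of free coordinates: [a] vanishes near 0 on the coordinate plane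
   where all the other coordinates are zero. *)
Definition vanish (S : pred 'I_N) a := \forall z \near (0 : 'rV[C]_N),
  (forall i, ~~ S i -> (z : 'rV[C]_N) ord0 i = 0) -> ev a z = 0.

(** A step of length [t] along a free coordinate stays in the plane, so both values of [a] are 0 and
    Taylor leaves only [t] times the derivative, of size O(t^2). Dividing by [t] and letting it tend
    to 0 gives the claim. *)
Lemma vanish_sder S i a : sconv a -> vanish S a -> S i -> vanish S (sder i a).
Proof.
move=> [r r0 [K ha]] /near0P[s s0 hs] Si.
pose q := Num.min (r / 4) (s / 2).
have qr : q <= r / 4 by rewrite ge_min lexx.
have qs : q <= s / 2 by rewrite ge_min lexx orbT.
have q0 : 0 < q by rewrite lt_min; apply/andP; split; lra.
apply/near0P; exists q => // z hz hzS.
have hzr : inball (r / 4) z by move=> j; have := hz j; lra.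
have K0 := bnd_ge0 (ltW r0) ha.
suff h t : 0 < t -> t <= q -> nm (ev (sder i a) z) * r ^+ 2 <= 4 * K * t.
  apply/eqP; rewrite -nm_eq0; apply/negPn/negP => n0.
  have n1 : 0 < nm (ev (sder i a) z) by rewrite lt_neqAle nm_ge0 eq_sym n0.
  set w := nm _ in h n1; have w0 : 0 < w * r ^+ 2 by rewrite mulr_gt0 // exprn_gt0.
  (* Small enough that [4 * K * t] is less than [w * r ^+ 2], against the bound [h]. *)
  pose t := Num.min q (w * r ^+ 2 / (8 * (K + 1))).
  have k8 : 0 < 8 * (K + 1) by lra.
  have t0 : 0 < t by rewrite lt_min q0 divr_gt0.
  have tq : t <= q by rewrite ge_min lexx.
  have : t <= w * r ^+ 2 / (8 * (K + 1)) by rewrite ge_min lexx orbT.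
  rewrite ler_pdivlMr // => h2; have := h t t0 tq; nra.
move=> t0 tq; pose u : 'rV[C]_N := \row_j ((j == i)%:R * (t%:C)%C).
have hu : inball t u.
  move=> j; rewrite mxE; case: eqP => _; last by rewrite mul0r nm0 ltW.
  by rewrite mul1r nm_real ger0_norm // ltW.
have tr4 : t <= r / 4 by lra.
have h := taylor_ev r0 ha hzr (ltW t0) tr4 hu.
have e1 : ev a z = 0 by apply: hs => // j; have := hz j; lra.
have e2 : ev a (z + u) = 0.
  apply: hs => [j|j nj].
    by rewrite mxE; have := nmD (z ord0 j) (u ord0 j); have := hz j; have := hu j; lra.
  rewrite !mxE hzS //; case: eqP nj => [->|_ _]; first by rewrite Si.
  by rewrite mul0r addr0.
rewrite e1 e2 (bigD1 i) //= big1 ?addr0 in h; last first.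
  by move=> j ji; rewrite mxE (negbTE ji) !mul0r.
move: h; rewrite mxE eqxx mul1r subr0 sub0r nmN nmM nm_real ger0_norm ?(ltW t0) //.
rewrite !expr2 => h; rewrite -(ler_pM2l t0); lra.
Qed.

(** Differentiating along the free coordinates preserves vanishing, and a constant coefficient is
    the value at the origin. Used with all coordinates free for uniqueness, and with the plane of
    the first pair for the transverse degree. *)
Lemma vanish_coef S a : sconv a -> vanish S a ->
  forall m, (forall i, m i != 0%N -> S i) -> a m = 0.
Proof.
move=> ca va m; have [k] := ubnP (mdeg m); elim: k a ca va m => // k IH a ca va m hk hm.
have [e|n0] := eqVneq m mnm0.
  rewrite e -ev_at0 //; have := near0_at va; apply => i _; exact: mxE.
have [i hi] : exists i, m i != 0%N.
  apply/existsP; apply: contraNT n0; rewrite negb_exists => /forallP h.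
  by apply/eqP/mnmP => i; rewrite mnm0E; apply/eqP; have := h i; rewrite negbK.
have le : mpoly.lem (mnm1 i) m by rewrite lep1mP.
have e := submK le; set m' := mnm_sub _ _ in e.
have hd : mdeg m = (mdeg m').+1 by rewrite -e mdegD mdeg1 addn1.
have := IH (sder i a) (sconv_sder i ca) (vanish_sder ca va (hm i hi)) m'.
rewrite hd ltnS in hk; move=> /(_ hk) h.
have : sder i a m' = 0.
  apply: h => j hj; apply: hm; rewrite -e mnmDE; move: hj; case: (m' j) => //.
by rewrite sderE e => /eqP; rewrite mulrn_eq0 /= => /eqP.
Qed.

(** The bridge back from pointwise identities to coefficients. *)
Lemma ev_inj a b : sconv a -> sconv b ->
  (\forall z \near (0 : 'rV[C]_N), ev a z = ev b z) -> a = b.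
Proof.
move=> ca cb h; apply/funext => m; apply/eqP; rewrite -subr_eq0; apply/eqP.
apply: (@vanish_coef predT (ssub a b)) => //; first exact: sconv_ssub.
apply: filterS2 h (ev_ssub ca cb) => z e1 e2 _.
by rewrite e2 e1 subrr.
Qed.

Lemma geom_sum_le (D : nat) : \sum_(k < D) (2^-1 : R) ^+ k <= 2.
Proof.
suff : \sum_(k < D) (2^-1 : R) ^+ k <= 2 - 2 * 2^-1 ^+ D.
  by move/le_trans; apply; rewrite lerBlDr lerDl mulr_ge0 // exprn_ge0.
elim: D => [|D IH]; first by rewrite big_ord0 expr0; lra.
by rewrite big_ord_recr /= exprS; lra.
Qed.

(** The list embeds in a finite box of exponents, over which the sum factors into [N] geometric
    sums, each at most 2. *)
Lemma sum_half_mdeg_le (s : seq (mon N)) : uniq s ->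
  \sum_(m <- s) (2^-1 : R) ^+ mdeg m <= 2 ^+ N.
Proof.
move=> us; pose D := (\max_(m <- s) mdeg m)%N.
have hD m : m \in s -> forall i, (m i <= D)%N.
  move=> ms i; apply: leq_trans (leq_bigmax_seq _ ms _) => //.
  by rewrite mdegE (bigD1 i) //= leq_addr.
pose F (f : {ffun 'I_N -> 'I_D.+1}) : R := \prod_i 2^-1 ^+ f i.
pose phi (m : mon N) : {ffun 'I_N -> 'I_D.+1} := [ffun i => inord (m i)].
have F0 f : 0 <= F f by apply: prodr_ge0 => i _; exact: exprn_ge0.
have -> : \sum_(m <- s) (2^-1 : R) ^+ mdeg m = \sum_(f <- map phi s) F f.
  rewrite big_map; apply: eq_big_seq => m ms; rewrite /F mdegE.
  rewrite (big_morph (fun k => (2^-1 : R) ^+ k) (exprD _) (expr0 _)).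
  by apply: eq_bigr => i _; rewrite ffunE inordK // ltnS hD.
have up : uniq (map phi s).
  rewrite map_inj_in_uniq // => m1 m2 h1 h2 /ffunP e; apply/mnmP => i.
  by have := congr1 val (e i); rewrite !ffunE /= !inordK ?ltnS ?hD.
rewrite big_uniq //=; apply: (@le_trans _ _ (\sum_f F f)).
  rewrite [X in _ <= X](bigID (mem (map phi s))) /= lerDl.
  by apply: sumr_ge0 => f _.
rewrite /F -(bigA_distr_bigA (fun (i : 'I_N) (k : 'I_D.+1) => (2^-1 : R) ^+ k)) /=.
rewrite prodr_const card_ord; apply: lerXn2r; rewrite ?nnegrE.
- by apply: sumr_ge0 => k _; exact: exprn_ge0.
- by [].
exact: geom_sum_le.
Qed.

End Uniqueness.

(** * Formal fixed points *)

Section FixedPoint.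
Variables (R : realType) (N : nat) (I : Type).
Local Notation C := (Cplx R).
Implicit Types U V : I -> mon N -> C.

(* A fixed point of a degree-raising operator is built coefficient by coefficient, so
   it inherits every ball that the operator preserves: no completeness is involved. *)
Lemma formal_fixpoint (T : (I -> mon N -> C) -> I -> mon N -> C) (r : R) (K : I -> R) :
  0 <= r -> (forall i, 0 <= K i) ->
  (forall U i, (forall i, sord 2 (U i)) -> sord 2 (T U i)) ->
  (forall U V d, (forall i, sord 2 (U i)) -> (forall i, sord 2 (V i)) ->
     (forall i, eqd d (U i) (V i)) -> forall i, eqd d.+1 (T U i) (T V i)) ->
  (forall U, (forall i, sord 2 (U i)) -> (forall i, bnd r (U i) (K i)) ->
     forall i, bnd r (T U i) (K i)) ->
  exists U, [/\ forall i, sord 2 (U i), forall i, bnd r (U i) (K i) & T U = U].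
Proof.
move=> r0 K0 h2 hT hb.
pose U0 (i : I) (m : mon N) : C := 0.
pose W k := iter k T U0.
have W2 k : forall i, sord 2 (W k i).
  by elim: k => [|k IH] i; [move=> m _ | exact: h2].
have Wb k : forall i, bnd r (W k i) (K i).
  elim: k => [|k IH]; last exact: hb.
  move=> i d; rewrite (_ : tr d _ = 0) ?nrm0 //.
  by apply/mpolyP => m; rewrite mcoeff_tr mcoeff0 if_same.
have Ws k : forall i, eqd k (W k i) (W k.+1 i).
  elim: k => [|k IH] // i; exact: (hT (W k) (W k.+1) k (W2 k) (W2 k.+1) IH i).
have Wl k l : (k <= l)%N -> forall i, eqd k (W k i) (W l i).
  move=> /subnK <-; elim: (l - k)%N => [|j IH] i m hm //.
  by rewrite (IH i m hm) addSn; apply: Ws; exact: leq_trans hm (leq_addl _ _).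
(* Coefficients of degree below [k] no longer change from iterate [k] on, so a coefficient of degree
   d is final at iterate d + 1. One application of [T] gains exactly the degree needed for
   [T U = U]. *)
pose U i m := W (mdeg m).+1 i m.
have UW d i : eqd d (U i) (W d i) by move=> m hm; exact: Wl.
have U2 i : sord 2 (U i) by move=> m hm; exact: W2.
exists U; split => //.
- move=> i d; rewrite (_ : tr d (U i) = tr d (W d i)); first exact: Wb.
  by apply/mpolyP => m; rewrite !mcoeff_tr; case: ifP => // /UW.
- apply/funext => i; apply/funext => m; set d := mdeg m.
  have h := hT U (W d) d U2 (W2 d) (UW d) i m (ltnSn _).
  by rewrite h.
Qed.

End FixedPoint.

#[local] Existing Instance summability.totally_filter.

(** * Unordered sums, and complex differentiability of sums *)

Section Expansions.
Variables (R : realType) (N : nat).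
Local Notation C := (Cplx R).
Implicit Types (a b : mon N -> C) (f : 'rV[C]_N -> C).

Lemma partial_sumE (F : mon N -> C) (A : {fset mon N}) :
  summability.partial_sum F A = \sum_(m <- A) F m.
Proof. by rewrite /summability.partial_sum big_seq_fsetE. Qed.

Lemma totally_cvgP (F : mon N -> C) (l : C) :
  (summability.partial_sum F @ summability.totally --> l) <->
  forall e : R, 0 < e -> exists A : {fset mon N}, forall B : {fset mon N},
    fsubset A B -> nm (\sum_(m <- B) F m - l) <= e.
Proof.
split.
  move=> /cvgrPdist_le h e e0.
  have : (0 : C) < (e%:C)%C by rewrite ltcR.
  case/h => A _ hA; exists A => B AB; have := hA B AB.
  by rewrite /= normE lecR nm_distC partial_sumE.
move=> h; apply/cvgrPdist_le => e e0.
have /complex_realP [e' ee] : e \is Num.real by rewrite realE ltW.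
have e'0 : 0 < e' by move: e0; rewrite ee ltcR.
have [A hA] := h _ e'0; exists A => // B /= AB.
by rewrite normE ee lecR nm_distC partial_sumE; apply: hA.
Qed.

Lemma totally_cvg_unique (F : mon N -> C) (l l' : C) :
  (summability.partial_sum F @ summability.totally --> l) ->
  (summability.partial_sum F @ summability.totally --> l') -> l = l'.
Proof.
move=> /totally_cvgP h /totally_cvgP h'; apply/eqP; rewrite -subr_eq0 -nm_eq0.
apply/negPn/negP => n0; have p : 0 < nm (l - l') by rewrite lt_neqAle nm_ge0 eq_sym n0.
have e0 : 0 < nm (l - l') / 4 by lra.
have [A hA] := h _ e0; have [A' hA'] := h' _ e0.
have h1 := hA (fsetU A A') (fsubsetUl _ _); have h2 := hA' (fsetU A A') (fsubsetUr _ _).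
set x := \sum_(m <- _) _ in h1 h2.
have := nmB (x - l') (x - l); rewrite (_ : x - l' - (x - l) = l - l'); last ring.
lra.
Qed.

(** A finite set of monomials that contains all those of degree below [D] has a partial sum agreeing
    with the truncation at [D], hence lying within a multiple of [2^-D] of the value. *)
Lemma expands_ev a f : sconv a -> (\forall z \near (0 : 'rV[C]_N), f z = ev a z) ->
  expands_at0 f a.
Proof.
move=> [r r0 [K ha]] /near0P[s s0 hs]; apply/near0P.
exists (Num.min s (r / 2)); first by rewrite lt_min s0; lra.
move=> z hz.
have hzs : inball s z by move=> i; apply: le_trans (hz i) _; rewrite ge_min lexx.
have hzr : inball (r / 2) z.
  by move=> i; apply: le_trans (hz i) _; rewrite ge_min lexx orbT.
rewrite (hs z hzs); apply/totally_cvgP => e e0.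
have K4 : 0 <= 4 * K by have := bnd_ge0 (ltW r0) ha; lra.
have [D hD] := geom_small K4 e0.
pose A : {fset mon N} := seq_fset tt [seq (val m : mon N) | m : bmultinom N D].
exists A => B AB.
pose p : mpoly N C := \sum_(m <- B) a m *: mpolyX C m.
have cp m : p@_m = if m \in B then a m else 0.
  rewrite /p raddf_sum /=; case: ifP => hm.
    rewrite (bigD1_seq m) ?fset_uniq //= mcoeffZ mcoeffX eqxx mulr1 big1 ?addr0 // => k km.
    by rewrite mcoeffZ mcoeffX (negbTE km) mulr0.
  rewrite big_seq big1 // => k hk; rewrite mcoeffZ mcoeffX.
  by case: eqP => [e1|_]; [rewrite e1 hm in hk | rewrite mulr0].
have hp m : (mdeg m < D)%N -> p@_m = a m.
  move=> hm; rewrite cp (fsubsetP AB) // /A seq_fsetE.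
  by apply/fintype.imageP; exists (BMultinom hm).
have np : nrm r p <= K.
  rewrite (nrmE r (fset_uniq B)) => [|m]; last first.
    by rewrite mcoeff_msupp cp; case: ifP; rewrite ?eqxx.
  apply: le_trans (bnd_sum (ltW r0) ha (fset_uniq B)).
  rewrite le_eqVlt; apply/orP; left; apply/eqP; apply: eq_big_seq => m hm.
  by rewrite cp hm.
have vp : p.@[fun i => z ord0 i] = \sum_(m <- B) a m * monomial z m.
  by rewrite /p raddf_sum; apply: eq_bigr => m _ /=; rewrite mevalZ mevalX.
rewrite -vp; apply: le_trans (hD D (leqnn _)).
have h1 := tr_cvg r0 ha hzr D.
have h2 : nm (p.@[fun i => z ord0 i] - (tr D a).@[fun i => z ord0 i]) <= (2 * K) / 2 ^+ D.
  rewrite -mevalB; apply: (meval_ordge r0 _ _ hzr).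
    by apply: ordge_tr_sub hp _ => m; exact: mcoeff_tr_lt.
  by apply: le_trans (nrmB _ _ (ltW r0)) _; have := ha D; lra.
set x := _.@[_] in h2 *; set y := _.@[_] in h1 h2.
have h3 := nmD (x - y) (y - ev a z); rewrite addrA subrK in h3.
by apply: le_trans h3 _; lra.
Qed.

(** Unordered convergence at the single point with all coordinates [r] bounds every term there. At
    radius [r / 2] the majorant is then dominated by a product of geometric series. *)
Lemma ev_expands a f : expands_at0 f a ->
  sconv a /\ \forall z \near (0 : 'rV[C]_N), f z = ev a z.
Proof.
move=> hf; have ca : sconv a; last first.
  split => //.
  have h := @expands_ev a (ev a) ca (filterE (nbhs_filter _) (fun z => erefl)).
  rewrite /expands_at0 in hf h; apply: filterS2 hf h => z h1 h2.
  exact: totally_cvg_unique h1 h2.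
move/near0P: hf => [r r0 hr].
pose z : 'rV[C]_N := \row_i (r%:C)%C.
have hz : inball r z by move=> i; rewrite mxE nm_real ger0_norm // ltW.
have /totally_cvgP h := hr z hz.
have [A hA] := h 1 ltr01.
pose F m := a m * monomial z m.
have nF m : nm (F m) = nm (a m) * r ^+ mdeg m.
  rewrite /F nmM /monomial nm_prod mdegE (big_morph (fun k => r ^+ k) (exprD r) (expr0 r)).
  by congr (_ * _); apply: eq_bigr => i _; rewrite mxE nmX nm_real ger0_norm // ltW.
(* A term outside [A] is the difference of two partial sums that both lie within 1 of the limit; a
   term inside is one summand. *)
pose K := 2 + \sum_(m <- A) nm (F m).
have S0 : 0 <= \sum_(m <- A) nm (F m) by apply: sumr_ge0 => m _; exact: nm_ge0.
have hK m : nm (a m) * r ^+ mdeg m <= K.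
  rewrite -nF; case: (boolP (m \in A)) => mA.
    rewrite /K (bigD1_seq m) ?fset_uniq //=.
    have : 0 <= \sum_(i <- A | i != m) nm (F i) by apply: sumr_ge0 => i _; exact: nm_ge0.
    lra.
  have h1 := hA (fsetU [fset m]%fset A) (fsubsetUr _ _).
  have h2 := hA A (fsubset_refl _).
  have e : \sum_(k <- fsetU [fset m]%fset A) a k * monomial z k = F m + \sum_(k <- A) a k * monomial z k.
    by rewrite big_fsetU1.
  rewrite e in h1; move: h1 h2; set x := \sum_(k <- A) _; set l := f z => h1 h2.
  have := nmB (F m + x - l) (x - l); rewrite (_ : F m + x - l - (x - l) = F m); last ring.
  rewrite /K; lra.
exists (r / 2); first lra.
exists (K * 2 ^+ N); apply: bndP; first lra.
move=> s us; have K0 : 0 <= K by rewrite /K; lra.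
apply: le_trans (ler_wpM2l K0 (sum_half_mdeg_le R us)).
rewrite mulr_sumr; apply: ler_sum => m _.
rewrite exprMn mulrA; apply: ler_wpM2r; first by rewrite exprn_ge0.
exact: hK.
Qed.

End Expansions.

Section Differential.
Variables (R : realType) (M N : nat).
Local Notation C := (Cplx R).

(** The norm of a row vector lives in [Cplx R]; this extracts the real number behind it and
    identifies it as the largest modulus of a coordinate. *)
Lemma row_norm K (z : 'rV[C]_K) :
  exists2 t : R, `|z| = (t%:C)%C & [/\ 0 <= t, inball t z &
    forall s, 0 <= s -> inball s z -> t <= s].
Proof.
have /complex_realP [t et] : `|z| \is Num.real by exact: normr_real.
exists t => //; have t0 : 0 <= t by have := normr_ge0 z; rewrite et ler0c.
split => // [i|s s0 hs].
  rewrite leNgt; apply/negP => ti.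
  have : ball (0 : 'rV[C]_K) ((nm (z ord0 i))%:C)%C z.
    by rewrite -ball_normE /ball_ /= sub0r normrN et ltcR.
  move=> [_ /(_ ord0 i)]; rewrite mxE -ball_normE /ball_ /= sub0r normrN normE ltcR ltxx.
  by [].
have [e|n0] := eqVneq (mx_norm z) 0.
  by have := et; rewrite /Num.norm /= e => /eqP; rewrite eq_complex /= => /andP[/eqP <-].
have [[i j] /= e] := mx_norm_neq0 n0; move: e; rewrite ord1 normE => e.
have : `|z| = ((nm (z ord0 j))%:C)%C by exact: e.
by rewrite et => /complexI ->.
Qed.

(** The quadratic Taylor remainder is the required little-o, and continuity of the linear part is an
    explicit matrix bound; [diff_unique] then identifies the differential. *)
Lemma differentiable_ev (phi : 'I_M -> mon N -> C) : (forall i, sconv (phi i)) ->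
  \forall z \near (0 : 'rV[C]_N),
    differentiable (fun z => \row_i ev (phi i) z : 'rV[C]_M) z /\
    forall u, 'd (fun z => \row_i ev (phi i) z : 'rV[C]_M) z u =
      \row_i \sum_k u ord0 k * ev (sder k (phi i)) z.
Proof.
move=> cphi; have [r r0 [K hK]] := sconv_family cphi.
have [L L0 KL] : exists2 L, 0 < L & K <= L.
  by exists (Num.max 1 K); rewrite ?lt_max ?ltr01 // le_max lexx orbT.
apply/near0P; exists (r / 4); first lra.
move=> z hz; set f := fun z => _.
pose A : 'M[C]_(N, M) := \matrix_(k, i) ev (sder k (phi i)) z.
have dfE u : mulmxr A u = \row_i \sum_k u ord0 k * ev (sder k (phi i)) z.
  by apply/rowP => i; rewrite /= !mxE; apply: eq_bigr => k _; rewrite mxE.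
have dfc : continuous (mulmxr A : 'rV[C]_N -> 'rV[C]_M).
  apply: (@continuousfor0_continuous _ _ _ (mulmxr A)); rewrite /prop_for /continuous_at linear0.
  suff hc : (mulmxr A : 'rV[C]_N -> 'rV[C]_M) x @[x --> (0 : 'rV[C]_N)] --> (0 : 'rV[C]_M) by exact: hc.
  apply/(@cvgrPdist_le _ _ _ (nbhs (0 : 'rV[C]_N)) (nbhs_filter _)) => e e0.
  have /complex_realP [e' ee] : e \is Num.real by rewrite realE ltW.
  have e'0 : 0 < e' by move: e0; rewrite ee ltcR.
  pose B := 1 + \sum_k \sum_i nm (A k i).
  have S0 : 0 <= \sum_k \sum_i nm (A k i).
    by apply: sumr_ge0 => k _; apply: sumr_ge0 => i _; exact: nm_ge0.
  apply/near0P; exists (e' / B); first by rewrite divr_gt0 // /B; lra.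
  move=> u hu; rewrite sub0r normrN.
  have [t -> [t0 ht hmin]] := row_norm (mulmxr A u); rewrite ee lecR.
  apply: hmin; first exact: ltW.
  move=> i; rewrite /= !mxE; apply: le_trans (nm_sum _ _ _) _.
  have B0 : 0 < B by rewrite /B; lra.
  apply: (@le_trans _ _ (\sum_k (e' / B) * nm (A k i))).
    by apply: ler_sum => k _; rewrite nmM; apply: ler_wpM2r; [exact: nm_ge0 | exact: hu].
  rewrite -mulr_sumr mulrAC ler_pdivrMr // ; apply: ler_wpM2l; first exact: ltW.
  apply: (@le_trans _ _ (\sum_k \sum_i nm (A k i))); last by rewrite /B; lra.
  apply: ler_sum => k _; rewrite (bigD1 i) //= lerDl.
  by apply: sumr_ge0 => j _; exact: nm_ge0.
have dfo : f \o shift z = cst (f z) + (mulmxr A : 'rV[C]_N -> 'rV[C]_M) +o_ (0 : 'rV[C]_N) id.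
  apply/eqaddoP => e e0.
  have /complex_realP [e' ee] : e \is Num.real by rewrite realE ltW.
  have e'0 : 0 < e' by move: e0; rewrite ee ltcR.
  pose q := Num.min (r / 4) (e' * r ^+ 2 / (4 * L)).
  have q0 : 0 < q.
    by rewrite lt_min; apply/andP; split; [lra|rewrite divr_gt0 // mulr_gt0 // exprn_gt0].
  apply/near0P; exists q => // u hu.
  have [t tE [t0 ht hmin]] := row_norm u.
  have tq : t <= q by apply: hmin => //; exact: ltW.
  have tr4 : t <= r / 4 by apply: le_trans tq _; rewrite ge_min lexx.
  have te : t * (4 * L) <= e' * r ^+ 2.
    by rewrite -ler_pdivlMr ?mulr_gt0 //; apply: le_trans tq _; rewrite ge_min lexx orbT.
  rewrite tE ee -rmorphM /=.
  set D := (f \o shift z - _) u.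
  have [s sE [s0 hs smin]] := row_norm D; rewrite sE lecR; apply: smin.
    by rewrite mulr_ge0 // ltW.
  move=> i.
  have -> : D ord0 i = ev (phi i) (z + u) - ev (phi i) z - \sum_k u ord0 k * ev (sder k (phi i)) z.
    rewrite /D !fctE /= /f -[u *m A]/(mulmxr A u) dfE !mxE opprD addrA.
    by rewrite [u + z]addrC.
  have h := taylor_ev r0 (hK i) hz t0 tr4 ht.
  have r20 : 0 < r ^+ 2 by rewrite exprn_gt0.
  rewrite -(ler_pM2r r20); apply: le_trans h _.
  have : 4 * K * t ^+ 2 <= 4 * L * t ^+ 2.
    by apply: ler_wpM2r; [exact: exprn_ge0 | rewrite ler_wpM2l].
  have := ler_wpM2l t0 te; rewrite !expr2; lra.
have dE : 'd f z = mulmxr A :> ('rV[C]_N -> 'rV[C]_M) by exact: diff_unique dfc dfo.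
split; last by move=> u; rewrite -dfE dE.
apply/diff_locallyP; split; rewrite dE //.
Qed.

End Differential.

(** * The invariant manifold *)

Section Conjugate.
Variables (R : realType) (n : nat).
Local Notation C := (Cplx R).

(* In Hamilton's equations d/dt z_i = sg_i dH/dz_(cj i), and [mu] lists the eigenvalues
   of the linear part. *)
Definition cj (i : 'I_(n + n)) : 'I_(n + n) :=
  match fintype.split i with inl j => rshift n j | inr j => lshift n j end.
Definition sg (i : 'I_(n + n)) : C := match fintype.split i with inl _ => 1 | inr _ => -1 end.
Definition mu (lambda : 'I_n -> C) (i : 'I_(n + n)) : C :=
  match fintype.split i with inl j => lambda j | inr j => - lambda j end.

Lemma cjl j : cj (lshift n j) = rshift n j.
Proof. by rewrite /cj (unsplitK (inl j)). Qed.
Lemma cjr j : cj (rshift n j) = lshift n j.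
Proof. by rewrite /cj (unsplitK (inr j)). Qed.
Lemma sgl j : sg (lshift n j) = 1.
Proof. by rewrite /sg (unsplitK (inl j)). Qed.
Lemma sgr j : sg (rshift n j) = -1.
Proof. by rewrite /sg (unsplitK (inr j)). Qed.
Lemma mu_lshift lambda j : mu lambda (lshift n j) = lambda j.
Proof. by rewrite /mu (unsplitK (inl j)). Qed.
Lemma mu_rshift lambda j : mu lambda (rshift n j) = - lambda j.
Proof. by rewrite /mu (unsplitK (inr j)). Qed.

Lemma phaseP (P : 'I_(n + n) -> Prop) :
  (forall j, P (lshift n j)) -> (forall j, P (rshift n j)) -> forall i, P i.
Proof. by move=> hl hr i; rewrite -(splitK i); case: (fintype.split i) => j; [exact: hl | exact: hr]. Qed.

Lemma sum_phase (F : 'I_(n + n) -> C) :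
  \sum_i F i = \sum_(j < n) (F (lshift n j) + F (rshift n j)).
Proof. by rewrite big_split_ord big_split. Qed.

(** The quadratic part generates a diagonal linear field, which is what makes the equation of the
    manifold solvable monomial by monomial. *)
Lemma H0poly_deriv lambda i (v : 'I_(n + n) -> C) :
  sg i * (mderiv (cj i) (H0poly lambda)).@[v] = mu lambda i * v i.
Proof.
rewrite /H0poly (raddf_sum (mderiv (cj i))) (raddf_sum (meval v)) /=.
elim/phaseP: i => j; rewrite ?sgl ?sgr ?cjl ?cjr ?mu_lshift ?mu_rshift.
  rewrite (bigD1 j) //= big1 ?addr0 => [|k kj].
    rewrite mderivZ mevalZ mderivM !mderivX !mnm1E eqxx eq_lrshift scale0r mul0r add0r scale1r.
    by rewrite -[X in mnm_sub X _]add0m addmK mpolyX0 mulr1 mevalXU mul1r.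
  rewrite mderivZ mevalZ mderivM !mderivX !mnm1E eq_lrshift eq_rshift (negbTE kj).
  by rewrite !scale0r mul0r mulr0 addr0 meval0 mulr0.
rewrite (bigD1 j) //= big1 ?addr0 => [|k kj].
  rewrite mderivZ mevalZ mderivM !mderivX !mnm1E eqxx eq_rlshift scale0r mulr0 addr0 scale1r.
  by rewrite -[X in mnm_sub X _]add0m addmK mpolyX0 mul1r mevalXU mulN1r mulNr.
rewrite mderivZ mevalZ mderivM !mderivX !mnm1E eq_rlshift eq_lshift (negbTE kj).
by rewrite !scale0r mul0r mulr0 addr0 meval0 mulr0.
Qed.

End Conjugate.

(** * Small divisors along one integer parameter *)

Section SmallDivisors.
Variable R : realType.
Local Notation C := (Cplx R).

Lemma nm_int (e : int) : nm (e%:~R : C) = `|e|%N%:R.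
Proof.
case: e => k; first by rewrite -pmulrn nm_nat.
by rewrite NegzE mulrNz nmN -pmulrn nm_nat abszN.
Qed.

(** Once |e| reaches [E], [m0] is at most half of [l * e], so the divisor is at least |l| |e| / 2
    and even e times its inverse is bounded by 2 / |l|. The finitely many other integers enter the
    constant through [F k], which covers k and -k. A zero divisor has inverse 0 by convention. *)
Lemma small_div (l m0 : C) : l != 0 -> exists2 c : R, 1 <= c &
  forall e : int, nm ((l * e%:~R - m0)^-1) <= c /\ nm (e%:~R * (l * e%:~R - m0)^-1) <= c.
Proof.
move=> l0; have nl : 0 < nm l by rewrite nm_gt0.
pose d (e : int) := l * e%:~R - m0.
pose E := (Num.bound (2 * nm m0 / nm l)).+1.
have hE (k : nat) : (E <= k)%N -> nm m0 <= nm l * k%:R / 2.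
  move=> Ek; have h := archi_boundP (divr_ge0 (mulr_ge0 (ler0n R 2) (nm_ge0 m0)) (ltW nl)).
  have : 2 * nm m0 / nm l <= k%:R.
    by apply: le_trans (ltW h) _; rewrite ler_nat; apply: leq_trans Ek; exact: leqnSn.
  rewrite ler_pdivrMr //; lra.
pose F (k : nat) := (k.+1)%:R * (nm (d k%:Z)^-1 + nm (d (- k%:Z))^-1).
have F0 k : 0 <= F k by rewrite mulr_ge0 ?addr_ge0 ?nm_ge0.
exists (1 + 2 / nm l + \sum_(k < E) F k).
  have : 0 <= 2 / nm l by rewrite divr_ge0 // ltW.
  have : 0 <= \sum_(k < E) F k by apply: sumr_ge0.
  lra.
move=> e; rewrite -/(d e); set k := `|e|%N.
have S0 : 0 <= \sum_(k < E) F k by apply: sumr_ge0.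
have T0 : 0 <= 2 / nm l by rewrite divr_ge0 // ltW.
suff h : nm (d e)^-1 <= 2 / nm l + \sum_(k < E) F k /\ k%:R * nm (d e)^-1 <= 2 / nm l + \sum_(k < E) F k.
  by rewrite nmM nm_int; case: h => h1 h2; split; lra.
have [kE|Ek] := ltnP k E.
  have hF : F k <= \sum_(k < E) F k.
    rewrite (bigD1 (Ordinal kE)) //= lerDl; exact: sumr_ge0.
  have hd : nm (d e)^-1 <= nm (d k%:Z)^-1 + nm (d (- k%:Z))^-1.
    have [->|->] : e = k%:Z \/ e = - k%:Z by rewrite /k; lia.
      by rewrite lerDl nm_ge0.
    by rewrite lerDr nm_ge0.
  have k1 : (k.+1)%:R = k%:R + 1 :> R by rewrite -natr1.
  have kp : 0 <= k%:R :> R by [].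
  have dp := nm_ge0 (d e)^-1.
  have : (k%:R + 1) * nm (d e)^-1 <= F k by rewrite /F k1; apply: ler_wpM2l => //; lra.
  have : 0 <= k%:R * nm (d e)^-1 by rewrite mulr_ge0.
  by split; lra.
have kp : 1 <= k%:R :> R by rewrite ler1n; apply: leq_trans Ek.
have nd : nm l * k%:R / 2 <= nm (d e).
  have h1 := nmD (d e) m0; rewrite /d subrK nmM nm_int -/k in h1.
  have := hE k Ek; rewrite -/(d e) in h1; lra.
have lk : 0 < nm l * k%:R by rewrite mulr_gt0 //; lra.
have ndp : 0 < nm (d e) by lra.
have h2 : k%:R * nm (d e)^-1 <= 2 / nm l.
  rewrite nmV ler_pdivrMr // mulrAC ler_pdivlMr //; lra.
have : nm (d e)^-1 <= k%:R * nm (d e)^-1 by rewrite ler_peMl ?nm_ge0.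
by split; lra.
Qed.

End SmallDivisors.

Definition xi : 'I_2 := locked ord0.
Definition eta : 'I_2 := locked ord_max.

Lemma ord2P (P : 'I_2 -> Prop) : P xi -> P eta -> forall i, P i.
Proof.
rewrite /xi /eta -!lock => h0 h1 [[|[|k]] hk] //; first by rewrite (_ : Ordinal hk = ord0) //; exact: val_inj.
by rewrite (_ : Ordinal hk = ord_max) //; exact: val_inj.
Qed.
Lemma xi_eta : (xi == eta) = false. Proof. by rewrite /xi /eta -!lock. Qed.
Lemma eta_xi : (eta == xi) = false. Proof. by rewrite /xi /eta -!lock. Qed.

Definition ed (m : mon 2) : int := (m xi)%:Z - (m eta)%:Z.

Section Manifold.
Variables (R : realType) (n : nat) (i1 : 'I_n).
Local Notation C := (Cplx R).
Variables (lambda : 'I_n -> C) (Nf : 'I_(n + n) -> mon (n + n) -> C).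
Implicit Types (U V : option 'I_(n + n) -> mon 2 -> C).

(* The unknown [U] encodes w_i = W_i - base_i = kap_i U_i and xi * alpha = U_None, and
   [Dop] is xi d/dxi - eta d/deta, acting as [ed m] on the monomial m.  The equation
   (lambda_1 + alpha) Dop W_i = mu_i W_i + N_i(W) is solved coefficientwise, dividing by
   [dv i m].  This divisor vanishes on the resonant monomials of the coordinates x_1 and
   y_1: those of x_1 determine alpha, those of y_1 are left unsolved (see [defect]), and
   the free resonant part of w_(x_1) is used to make W symplectic, through [cQ]. *)
Definition Dop (a : mon 2 -> C) := smul (fun m => (ed m)%:~R) a.

Definition dv i m : C := lambda i1 * (ed m)%:~R - mu lambda i.
(** On a resonant monomial the factor is 1, so that the unknown is there the free coefficient
    itself. *)
Definition kap i m : C := if dv i m == 0 then 1 else (dv i m)^-1.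
Definition cbase (i : 'I_(n + n)) : mon 2 -> C :=
  if i == lshift n i1 then svar R xi else if i == rshift n i1 then svar R eta else spol 0.
Definition cw U i := smul (kap i) (U (Some i)).
(** Derivative and division form one multiplier, bounded although its first factor is not. This is
    how the derivative term of the equation costs no radius. *)
Definition cdw U i := smul (fun m => (ed m)%:~R * kap i m) (U (Some i)).
Definition cW U i := sadd (cbase i) (cw U i).
Definition cal U := sshift (mnm1 xi) (U None).
Definition crhs U i := ssub (scomp (Nf i) (cW U)) (sprod (cal U) (cdw U i)).
(** The part of the sum of W_(y_j) Dop W_(x_j) that is quadratic in the corrections. [cT] prescribes
    minus its quotient by eta as the resonant part of w_(x_1), to cancel it in [action_diag]. *)
Definition cQ U := ssum predT (fun j : 'I_n => sprod (cw U (rshift n j)) (cdw U (lshift n j))).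
Definition cT U o := match o with
  | None => smul (fun m => (ed m == 1)%:R) (crhs U (lshift n i1))
  | Some i => ssub (smul (fun m => (dv i m != 0)%:R) (crhs U i))
      (smul (fun m => ((i == lshift n i1) && (ed m == 1))%:R) (sshift (mnm1 eta) (cQ U)))
  end.

Lemma cdwE U i : cdw U i = Dop (cw U i).
Proof. by apply/funext => m; rewrite /cdw /Dop /cw /smul mulrA. Qed.

Lemma sord_spol0 d : sord d (spol (0 : mpoly 2 C)).
Proof. by move=> m _; rewrite /spol mcoeff0. Qed.

Lemma sord_cbase i : sord 1 (cbase i).
Proof.
by rewrite /cbase; do 2?[case: ifP => _]; [exact: sord_svar|exact: sord_svar|exact: sord_spol0].
Qed.

Lemma sord_cW U i : (forall o, sord 2 (U o)) -> sord 1 (cW U i).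
Proof.
move=> h; apply: sord_sadd; first exact: sord_cbase.
by apply: sord_smul; apply: sord_le (h _).
Qed.

Lemma sord_cal U : (forall o, sord 2 (U o)) -> sord 1 (cal U).
Proof. by move=> h; apply: sord_sshift; rewrite mdeg1. Qed.

Lemma sord_cT U o : (forall i, sord 2 (Nf i)) -> (forall o, sord 2 (U o)) -> sord 2 (cT U o).
Proof.
move=> hN h.
have hr i : sord 2 (crhs U i).
  apply: sord_ssub; first by apply: sord_scomp => // j; exact: sord_cW.
  by apply: (@sord_sprod _ _ 1 2) => //; [exact: sord_cal | exact: sord_smul].
case: o => [i|] /=; last exact: sord_smul.
apply: sord_ssub; first exact: sord_smul.
apply: sord_smul; apply: sord_sshift; apply: sord_ssum => j _; rewrite mdeg1.
by apply: (@sord_sprod _ _ 2 2) => //; exact: sord_smul.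
Qed.

(** Each term gains a degree: [Nf] has order 2; dividing by xi loses a degree in [cal], but its
    partner has order 2; dividing [cQ] by eta loses one of the two degrees gained from its
    factors. *)
Lemma eqd_cT U V d o : (forall i, sord 2 (Nf i)) ->
  (forall o, sord 2 (U o)) -> (forall o, sord 2 (V o)) ->
  (forall o, eqd d (U o) (V o)) -> eqd d.+1 (cT U o) (cT V o).
Proof.
move=> hN hU hV hUV.
have hal : eqd d.-1 (cal U) (cal V).
  case: d hUV => [|d] hUV //; apply: eqd_sshift; rewrite mdeg1 addn1; exact: hUV.
have hr i : eqd d.+1 (crhs U i) (crhs V i).
  apply: eqd_ssub.
    apply: (@eqd_scomp _ _ _ d 2) => //; try (by move=> j; exact: sord_cW).
      by move=> j m hm; rewrite /cW /sadd /cw /smul hUV.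
    by rewrite addn1.
  apply: (@eqd_sprod _ _ d.-1 d 2 1) => //.
  - exact: sord_smul.
  - exact: sord_cal.
  - exact: eqd_smul.
  - by rewrite addn2; case: (d).
  - by rewrite addn1.
case: o => [i|] /=; last exact: eqd_smul.
apply: eqd_ssub; first exact: eqd_smul.
apply: eqd_smul; apply: eqd_sshift; apply: eqd_ssum => j _; rewrite mdeg1.
apply: (@eqd_sprod _ _ d d 2 2) => //; try exact: sord_smul; try exact: eqd_smul; rewrite addn1 addn2 //.
Qed.

Lemma bnd_spol0 r K : 0 <= r -> 0 <= K -> bnd r (spol (0 : mpoly 2 C)) K.
Proof. by move=> r0 K0 d; apply: le_trans (bnd_spol _ r0 d) _; rewrite nrm0. Qed.

(** In units of r^2 the nonlinearity contributes [A], while every product of unknowns carries a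
    spare factor [r]. The condition on [c * (K * r ^+ 2)] keeps W inside the radius [2 * r] where
    [Nf] is controlled. *)
Lemma bnd_cT U o r A c K : 0 < r -> 1 <= c -> 0 <= K -> 0 <= A ->
  (forall i m, nm (kap i m) <= c /\ nm ((ed m)%:~R * kap i m) <= c) ->
  (forall i, bnd (2 * r) (Nf i) (A * r ^+ 2)) ->
  (forall i, sord 2 (Nf i)) -> (forall o, sord 2 (U o)) ->
  c * (K * r ^+ 2) <= r ->
  A + (c + n%:R * c ^+ 2) * K ^+ 2 * r <= K ->
  (forall o, bnd r (U o) (K * r ^+ 2)) -> bnd r (cT U o) (K * r ^+ 2).
Proof.
move=> r0 c1 K0 A0 hk hN sN sU hr1 hr2 hU.
have r0' := ltW r0.
have c0 : 0 <= c by lra.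
have bw i : bnd r (cw U i) (c * (K * r ^+ 2)).
  by apply: bnd_smul => // m; case: (hk i m).
have bdw i : bnd r (cdw U i) (c * (K * r ^+ 2)).
  by apply: bnd_smul => // m; case: (hk i m).
have bb i : bnd r (cbase i) r.
  rewrite /cbase; do 2?[case: ifP => _]; [exact: bnd_svar|exact: bnd_svar|exact: bnd_spol0].
have bW i : bnd r (cW U i) (2 * r).
  by apply: (@bnd_le _ _ r r _ (r + c * (K * r ^+ 2))); [rewrite r0' lexx | lra | exact: bnd_sadd].
have bal : bnd r (cal U) (K * r ^+ 2 / r).
  by have := @bnd_sshift _ _ r (mnm1 xi) _ _ r0 (hU None); rewrite mdeg1 expr1.
have br i : bnd r (crhs U i) (A * r ^+ 2 + K * r ^+ 2 / r * (c * (K * r ^+ 2))).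
  apply: bnd_ssub => //; last exact: bnd_sprod.
  by apply: (bnd_scomp r0' (hN i)) => // j; exact: sord_cW.
have bQ : bnd r (cQ U) (n%:R * (c * (K * r ^+ 2) * (c * (K * r ^+ 2)))).
  have -> : n%:R * (c * (K * r ^+ 2) * (c * (K * r ^+ 2)))
      = \sum_(j < n | predT j) (c * (K * r ^+ 2) * (c * (K * r ^+ 2))).
    by rewrite sumr_const card_ord mulr_natl.
  by apply: bnd_ssum => // j _; exact: bnd_sprod.
have bs : bnd r (sshift (mnm1 eta) (cQ U)) (n%:R * (c * (K * r ^+ 2) * (c * (K * r ^+ 2))) / r).
  by have := @bnd_sshift _ _ r (mnm1 eta) _ _ r0 bQ; rewrite mdeg1 expr1.
have ind (b : bool) : nm (b%:R : C) <= 1 by case: b; rewrite ?nm1 ?nm0.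
have e1 : A * r ^+ 2 + K * r ^+ 2 / r * (c * (K * r ^+ 2)) + n%:R * (c * (K * r ^+ 2) * (c * (K * r ^+ 2))) / r
   = (A + (c + n%:R * c ^+ 2) * K ^+ 2 * r) * r ^+ 2 by field; rewrite gt_eqF.
have e2 := ler_wpM2r (exprn_ge0 2 r0') hr2.
have p1 : 0 <= n%:R * (c * (K * r ^+ 2) * (c * (K * r ^+ 2))) / r.
  by rewrite !mulr_ge0 ?invr_ge0 // exprn_ge0.
case: o => [i|] /=; last first.
  apply: (@bnd_le _ _ r r _ (1 * (A * r ^+ 2 + K * r ^+ 2 / r * (c * (K * r ^+ 2))))).
  - by rewrite r0' lexx.
  - lra.
  - exact: bnd_smul.
apply: (@bnd_le _ _ r r _ (1 * (A * r ^+ 2 + K * r ^+ 2 / r * (c * (K * r ^+ 2))) +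
   1 * (n%:R * (c * (K * r ^+ 2) * (c * (K * r ^+ 2))) / r))).
- by rewrite r0' lexx.
- lra.
- by apply: bnd_ssub => //; exact: bnd_smul.
Qed.

(** Off resonance this is [small_div]. On a resonant monomial [ed m] equals mu_i / lambda_1, hence
    it is bounded although [kap] is 1 there. *)
Lemma kap_bound : lambda i1 != 0 ->
  exists2 c : R, 1 <= c & forall i m, nm (kap i m) <= c /\ nm ((ed m)%:~R * kap i m) <= c.
Proof.
move=> l0.
have : forall i, exists c : R, 1 <= c /\ forall m, nm (kap i m) <= c /\ nm ((ed m)%:~R * kap i m) <= c.
  move=> i; have [c c1 hc] := small_div (mu lambda i) l0.
  pose q := nm (mu lambda i) / nm (lambda i1).
  have nl : 0 < nm (lambda i1) by rewrite nm_gt0.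
  have q0 : 0 <= q by rewrite divr_ge0 ?nm_ge0.
  exists (c + q); split; first lra.
  move=> m; rewrite /kap; case: eqP => [e|_]; last by have [] := hc (ed m); rewrite -/(dv i m); split; lra.
  rewrite nm1 mulr1; split; first lra.
  have : (ed m)%:~R = mu lambda i / lambda i1 :> C.
    by move/eqP: e; rewrite /dv subr_eq0 => /eqP <-; rewrite mulrAC mulfV ?mul1r.
  by move=> ->; rewrite nmM nmV -/q; lra.
move=> /boolp.choice[f hf].
exists (1 + \sum_i f i).
  have : 0 <= \sum_i f i by apply: sumr_ge0 => i _; case: (hf i); lra.
  lra.
move=> i m; have [f1 h] := hf i; have [h1 h2] := h m.
have : f i <= \sum_i f i.
  by rewrite (bigD1 i) //= lerDl; apply: sumr_ge0 => j _; case: (hf j); lra.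
by split; lra.
Qed.

Lemma manifold_fixpoint : lambda i1 != 0 -> (forall i, sconv (Nf i)) -> (forall i, sord 2 (Nf i)) ->
  exists U, [/\ forall o, sord 2 (U o), forall o, sconv (U o) & cT U = U].
Proof.
move=> l0 cN sN; have [c c1 hk] := kap_bound l0.
have [s s0 [L hL]] := sconv_family cN.
have L0 : 0 <= L by exact: bnd_ge0 (ltW s0) (hL (lshift n i1)).
(* Order 2 gives [Nf] the bound (2 r / s)^2 L at radius 2 r, which is [A * r ^+ 2]. *)
pose A := 4 * L / s ^+ 2.
have A0 : 0 <= A by rewrite divr_ge0 ?exprn_ge0 ?mulr_ge0 // ltW.
pose K := A + 1; have K1 : 1 <= K by rewrite /K; lra.
(* The sum of the coefficients of [r] in both smallness conditions, so that [B * r <= 1] secures the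
   two at once; the margin 1 in [K] absorbs the second. *)
pose B := c * K + (c + n%:R * c ^+ 2) * K ^+ 2.
have nc : 0 <= n%:R * c ^+ 2 by rewrite mulr_ge0 // exprn_ge0; lra.
have P1 : 1 <= c * K by nra.
have P2 : 0 <= (c + n%:R * c ^+ 2) * K ^+ 2 by rewrite mulr_ge0 ?exprn_ge0; lra.
have B0 : 0 < B by rewrite /B; lra.
pose r := Num.min (s / 2) B^-1.
have r0 : 0 < r by rewrite lt_min invr_gt0 B0; lra.
have rs : r <= s / 2 by rewrite ge_min lexx.
have rB : B * r <= 1.
  have : r <= B^-1 by rewrite ge_min lexx orbT.
  by move/(ler_wpM2l (ltW B0)); rewrite mulfV ?gt_eqF.
have hB1 : c * K * r <= 1.
  have : 0 <= (c + n%:R * c ^+ 2) * K ^+ 2 * r by rewrite mulr_ge0 // ltW.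
  by move: rB; rewrite /B; lra.
have hB2 : (c + n%:R * c ^+ 2) * K ^+ 2 * r <= 1.
  have : 0 <= c * K * r by rewrite mulr_ge0 ?(ltW r0) //; lra.
  by move: rB; rewrite /B; lra.
have hN i : bnd (2 * r) (Nf i) (A * r ^+ 2).
  have r2 : 0 <= 2 * r by lra.
  have r2s : 2 * r <= s by lra.
  have -> : A * r ^+ 2 = (2 * r / s) ^+ 2 * L by rewrite /A; field; rewrite gt_eqF.
  exact: bnd_sord r2 s0 r2s (sN i) (hL i).
have [U [h1 h2 h3]] := @formal_fixpoint R 2 _ cT r (fun _ => K * r ^+ 2) (ltW r0)
  (fun _ => mulr_ge0 (le_trans ler01 K1) (exprn_ge0 2 (ltW r0)))
  (fun U o hU => sord_cT o sN hU)
  (fun U V d hU hV hUV o => eqd_cT o sN hU hV hUV)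
  (fun U hU hb o => bnd_cT o r0 c1 (le_trans ler01 K1) A0 hk hN sN hU
     (ltac:(rewrite expr2; have := ler_wpM2r (ltW r0) hB1; lra))
     (ltac:(rewrite /K in hB2 *; lra)) hb).
by exists U; split => // o; exists r => //; exists (K * r ^+ 2).
Qed.

End Manifold.

Section Algebra.
Variables (R : realType) (N : nat).
Local Notation C := (Cplx R).
Implicit Types (a b c : mon N -> C).

Lemma sprodC a b : sprod a b = sprod b a.
Proof. by apply/funext => m; rewrite !sprod_coef mulrC. Qed.
Lemma sprodDr a b c : sprod a (sadd b c) = sadd (sprod a b) (sprod a c).
Proof. by apply/funext => m; rewrite /sadd !sprod_coef tr_sadd mulrDr mcoeffD. Qed.
Lemma sprodDl a b c : sprod (sadd b c) a = sadd (sprod b a) (sprod c a).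
Proof. by rewrite sprodC sprodDr ![sprod a _]sprodC. Qed.

Lemma sprods0 a : sprod a (spol 0) = spol 0.
Proof.
have t0 d : tr d (spol (0 : mpoly N C)) = 0.
  by apply/mpolyP => k; rewrite mcoeff_tr /spol mcoeff0 if_same.
by apply/funext => m; rewrite sprod_coef t0 mulr0 /spol.
Qed.
Lemma sprod0s a : sprod (spol 0) a = spol 0.
Proof. by rewrite sprodC sprods0. Qed.

Lemma sprod_svarE i b m : sprod (svar R i) b m = (mpolyX C (mnm1 i) * tr (mdeg m).+1 b)@_m.
Proof.
rewrite sprod_coef svarE.
apply: (@coef_ordge _ _ (mdeg m).+1 _ _ m _ (ltnSn _)); apply: ordge_prodB; last first.
  by rewrite subrr; exact: ordge_0.
by rewrite -opprB; apply: ordgeN; exact: ordge_tr_spol.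
Qed.

Lemma sprod_svar i b m : sprod (svar R i) b (mnm_add m (mnm1 i)) = b m.
Proof.
rewrite sprod_svarE mulrC addmC mcoeffMX mcoeff_tr_lt //.
by rewrite mdegD mdeg1 ltnS leq_addl.
Qed.

Lemma sprod_svar0 i b (m : mon N) : m i = 0%N -> sprod (svar R i) b m = 0.
Proof.
move=> mi; rewrite sprod_svarE; apply: memN_msupp_eq0; apply/negP => /msuppM_le /allpairsP.
move=> [[m1 m2] /= [h1 _ e]]; move: h1; rewrite msuppX inE => /eqP e1.
by move: mi; rewrite e e1 mnmDE mnm1E eqxx.
Qed.

Lemma sprod_svar_sder i a m : sprod (svar R i) (sder i a) m = a m *+ m i.
Proof.
have [mi|mi] := eqVneq (m i) 0%N; first by rewrite sprod_svar0 // mi mulr0n.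
have le : mpoly.lem (mnm1 i) m by rewrite lep1mP.
rewrite -{1}(submK le) sprod_svar sderE submK // mnmBE mnm1E eqxx subn1 prednK //.
by rewrite lt0n.
Qed.

(** Pulls a property valid near 0 back through a substitution without constant term. *)
Lemma sconv_compr (M : nat) (P : 'rV[C]_M -> Prop) (g : 'I_M -> mon N -> C) :
  (forall i, sconv (g i)) -> (forall i, sord 1 (g i)) ->
  (\forall x \near (0 : 'rV[C]_M), P x) ->
  \forall z \near (0 : 'rV[C]_N), P (\row_i ev (g i) z).
Proof.
move=> cg hg /near0P[e e0 he].
have e4 : 0 < e / 4 by lra.
have [r r0 hr] := bnd_small cg hg e4.
apply/near0P; exists (r / 2); first lra.
move=> z hz; apply: he => i; rewrite mxE.
by have := ev_bound r0 (hr i) hz; lra.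
Qed.

Lemma near_all (I : finType) (P : I -> 'rV[C]_N -> Prop) :
  (forall i, \forall z \near (0 : 'rV[C]_N), P i z) ->
  \forall z \near (0 : 'rV[C]_N), forall i, P i z.
Proof.
move=> h; have : forall i, exists r : R, 0 < r /\ forall z, inball r z -> P i z.
  by move=> i; have /near0P[r r0 hr] := h i; exists r.
move=> /boolp.choice[f hf]; apply/near0P; exists (\big[Num.min/1]_i f i).
  by apply: (big_ind (fun x => 0 < x)) => // [x y hx hy|i _]; [rewrite lt_min hx | case: (hf i)].
move=> z hz i; have [_ h1] := hf i; apply: h1 => j; apply: le_trans (hz j) _.
exact: bigmin_le_cond.
Qed.

Lemma ev_near_neq0 a : sconv a -> a mnm0 != 0 -> \forall z \near (0 : 'rV[C]_N), ev a z != 0.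
Proof.
move=> ca a0.
have ca' : sconv (ssub a (spol (mpolyC N (a mnm0)))) by apply: sconv_ssub => //; exact: sconv_spol.
have sa : sord 1 (ssub a (spol (mpolyC N (a mnm0)))).
  move=> m; rewrite ltnS leqn0 mdeg_eq0 => /eqP ->.
  by rewrite /ssub /spol mcoeffC eqxx mulr1 subrr.
(* [ev_bound] multiplies by 3, so the value differs from the constant term by at most half of its
   modulus. *)
have e0 : 0 < nm (a mnm0) / 6 by rewrite divr_gt0 // nm_gt0.
have [r r0 hr] := @bnd_small R 1 N (fun _ => ssub a (spol (mpolyC N (a mnm0)))) _ (fun _ => ca') (fun _ => sa) e0.
have hb : \forall z \near (0 : 'rV[C]_N), inball (r / 2) z.
  by apply/near0P; exists (r / 2); first lra.
apply: filterS2 hb (ev_ssub ca (sconv_spol (mpolyC N (a mnm0)))) => z hz e.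
have := ev_bound r0 (hr ord0) hz; rewrite e ev_spol mevalC => h.
by apply: (@nm_inv_bound _ _ (a mnm0)) => //; lra.
Qed.

End Algebra.

Section Euler.
Variable R : realType.
Local Notation C := (Cplx R).
Implicit Types (a b : mon 2 -> C).

Lemma Dop_sder a : Dop a = ssub (sprod (svar R xi) (sder xi a)) (sprod (svar R eta) (sder eta a)).
Proof.
apply/funext => m; rewrite /Dop /smul /ssub !sprod_svar_sder /ed.
by rewrite intrB -!pmulrn mulrBl !mulr_natl.
Qed.

Lemma sconv_Dop a : sconv a -> sconv (Dop a).
Proof.
move=> ca; rewrite Dop_sder; apply: sconv_ssub; apply: sconv_sprod; try exact: sconv_svar; exact: sconv_sder.
Qed.

Lemma ev_Dop a : sconv a -> \forall z \near (0 : 'rV[C]_2),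
  ev (Dop a) z = z ord0 xi * ev (sder xi a) z - z ord0 eta * ev (sder eta a) z.
Proof.
move=> ca; rewrite Dop_sder.
have c1 := sconv_sder xi ca; have c2 := sconv_sder eta ca.
have v1 := sconv_svar R xi; have v2 := sconv_svar R eta.
apply: filterS3 (ev_ssub (sconv_sprod v1 c1) (sconv_sprod v2 c2)) (ev_sprod v1 c1) (ev_sprod v2 c2).
move=> z e1 e2 e3. rewrite e1.
rewrite e2 e3.
rewrite (ev_svar xi z).
by rewrite (ev_svar eta z).
Qed.

Lemma DopE_eq0 a : Dop a = spol 0 -> forall m, ed m != 0 -> a m = 0.
Proof.
move=> h m hm; have := congr1 (fun f => f m) h.
rewrite /Dop /smul /spol mcoeff0 => /eqP; rewrite mulf_eq0 intr_eq0 (negbTE hm) /=.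
by move/eqP.
Qed.

Lemma Dop_eq0 a : (forall m, ed m != 0 -> a m = 0) -> Dop a = spol 0.
Proof.
move=> h; apply/funext => m; rewrite /Dop /smul /spol mcoeff0.
by have [->|/h ->] := eqVneq (ed m) 0; rewrite ?mul0r ?mulr0.
Qed.

(** Leibniz rule, deduced from the form of [Dop] with partial derivatives. The local [key] is the
    one instance of associativity required, with a variable as first factor. *)
Lemma Dop_sprod a b : Dop (sprod a b) = sadd (sprod (Dop a) b) (sprod a (Dop b)).
Proof.
have key (i : 'I_2) (c d : mon 2 -> C) m : sprod (svar R i) (sprod c d) m = sprod (sprod (svar R i) c) d m.
  pose k := (mdeg m).+1.
  rewrite -(@sprodE _ _ k _ _ m (ltnSn _)) -(@sprodE _ _ k _ _ m (ltnSn _)).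
  apply: (@coef_ordge _ _ k _ _ m _ (ltnSn _)).
  have tri (x y z : mpoly 2 C) : x - z = (y - z) - (y - x).
    by rewrite opprB [RHS]addrC addrA subrK.
  rewrite (tri _ (tr k (svar R i) * tr k c * tr k d)) -[X in _ - (X - _)]mulrA.
  apply: ordgeB; apply: ordge_prodB; rewrite ?subrr; try exact: ordge_0.
    by move=> m' hm; rewrite mcoeffB mcoeff_tr_lt // sprodE // subrr.
  by move=> m' hm; rewrite mcoeffB mcoeff_tr_lt // sprodE // subrr.
apply/funext => m; rewrite !Dop_sder /ssub /sadd !sder_sprod.
have bl c d e : sprod (ssub c d) e m = sprod c e m - sprod d e m.
  by rewrite -!(@sprodE _ _ (mdeg m).+1 _ _ m (ltnSn _)) tr_ssub mulrBl mcoeffB.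
have hc i c d : sprod (sprod (svar R i) c) d m = sprod (sprod (svar R i) d) c m.
  by rewrite -!key [sprod c d]sprodC.
rewrite bl [sprod a (ssub _ _)]sprodC bl !sprodDr /sadd !key.
by rewrite (hc xi (sder xi b) a) (hc eta (sder eta b) a); ring.
Qed.

End Euler.

Section ChainRule.
Variables (R : realType) (M N : nat).
Local Notation C := (Cplx R).

Lemma ev_chain (h : mon M -> C) (g : 'I_M -> mon N -> C) :
  sconv h -> (forall i, sconv (g i)) -> (forall i, sord 1 (g i)) ->
  \forall z \near (0 : 'rV[C]_N), forall t, ev (sder t (scomp h g)) z =
    \sum_k ev (sder k h) (\row_i ev (g i) z) * ev (sder t (g k)) z.
Proof.
move=> ch cg sg; apply: near_all => t; rewrite sder_scomp //.
have c1 k : sconv (scomp (sder k h) g) by apply: sconv_scomp => //; exact: sconv_sder.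
have c2 k : sconv (sder t (g k)) by exact: sconv_sder.
have f1 := @ev_ssum _ _ _ predT (fun k => sprod (scomp (sder k h) g) (sder t (g k)))
  (fun k _ => sconv_sprod (c1 k) (c2 k)).
have f2 := near_all (fun k => ev_sprod (c1 k) (c2 k)).
have f3 := near_all (fun k => ev_scomp (sconv_sder k ch) cg sg).
apply: filterS3 f1 f2 f3 => z e1 e2 e3; rewrite e1; apply: eq_bigr => k _.
by rewrite e2 e3.
Qed.

End ChainRule.

(** * Energy, invariance and symplecticity of the manifold *)

Section Consequences.
Variables (R : realType) (n : nat) (i1 : 'I_n).
Local Notation C := (Cplx R).
Variables (lambda : 'I_n -> C) (h2 : mon (n + n) -> C).

Definition Nf (i : 'I_(n + n)) : mon (n + n) -> C := sscl (sg R i) (sder (cj i) h2).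
Definition hser : mon (n + n) -> C := sadd (spol (H0poly lambda)) h2.

Hypotheses (ch2 : sconv h2) (s3 : sord 3 h2) (l0 : lambda i1 != 0).
Hypothesis nonres : forall nu : 'I_n, nu != i1 -> forall k : int, lambda nu - k%:~R * lambda i1 != 0.

Lemma sconv_Nf i : sconv (Nf i).
Proof. by apply: sconv_sscl; exact: sconv_sder. Qed.
Lemma sord_Nf i : sord 2 (Nf i).
Proof. by apply: sord_sscl; exact: sord_sder. Qed.

Variable U : option 'I_(n + n) -> mon 2 -> C.
Hypotheses (hU2 : forall o, sord 2 (U o)) (hUc : forall o, sconv (U o)).
Hypothesis hUT : cT i1 lambda Nf U = U.

Local Notation x1 := (lshift n i1).
Local Notation y1 := (rshift n i1).
Local Notation dv := (dv i1 lambda).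
Local Notation w := (cw i1 lambda U).
Local Notation dw := (cdw i1 lambda U).
Local Notation W := (cW i1 lambda U).
Local Notation al := (cal U).
Local Notation rhs := (crhs i1 lambda Nf U).
Local Notation dW := (fun i => Dop (W i)).
Local Notation Wrow := (fun z : 'rV[C]_2 => \row_i ev (W i) z).

Lemma x1_y1 : (x1 == y1) = false. Proof. exact: eq_lrshift. Qed.
Lemma y1_x1 : (y1 == x1) = false. Proof. exact: eq_rlshift. Qed.

Lemma dv_x1 m : (dv x1 m == 0) = (ed m == 1).
Proof.
rewrite /dv mu_lshift -[X in _ - X]mulr1 -mulrBr mulf_eq0 (negbTE l0) /= subr_eq0.
by rewrite -(inj_eq (@intr_inj C)).
Qed.

Lemma dv_y1 m : (dv y1 m == 0) = (ed m == -1).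
Proof.
rewrite /dv mu_rshift opprK -[X in _ + X]mulr1 -mulrDr mulf_eq0 (negbTE l0) /= addr_eq0.
by rewrite -(inj_eq (@intr_inj C)) mulrN1z.
Qed.

Lemma dv_other i m : i != x1 -> i != y1 -> dv i m != 0.
Proof.
elim/phaseP: i => j; rewrite ?eq_lrshift ?eq_rlshift ?eq_lshift ?eq_rshift /dv ?mu_lshift ?mu_rshift ?opprK => h h'.
  by rewrite -oppr_eq0 opprB [lambda i1 * _]mulrC; exact: nonres.
by have := nonres h' (- ed m); rewrite mulrNz mulNr opprK addrC mulrC.
Qed.

Lemma UNoneE m : U None m = (ed m == 1)%:R * rhs x1 m.
Proof. by rewrite -{1}hUT. Qed.

Lemma USomeE i m : U (Some i) m = (dv i m != 0)%:R * rhs i m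
  - ((i == x1) && (ed m == 1))%:R * cQ i1 lambda U (mnm_add m (mnm1 eta)).
Proof. by rewrite -{1}hUT. Qed.

(* Conservation of energy along W will show that this unsolved part is zero. *)
Definition defect : mon 2 -> C := smul (fun m => (dv y1 m == 0)%:R) (rhs y1).
(** The total error of the y_1 equation. Since [Dop] sends the base term eta to -eta, that equation
    holds exactly when the resonant right side equals -eta alpha. *)
Definition gam : mon 2 -> C := sadd defect (sprod (svar R eta) al).

(** The fixed point read backwards: off resonance the multiplication by [dv] undoes [kap]; the
    resonant right side is [U None] for x_1 and [defect] for y_1, and by nonresonance no other index
    has one. *)
Lemma rhsE i : rhs i = sadd (ssub (sscl (lambda i1) (dw i)) (sscl (mu lambda i) (w i)))
  (sadd (sscl (i == x1)%:R (U None)) (sscl (i == y1)%:R defect)).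
Proof.
apply/funext => m; rewrite /sadd /ssub /sscl /cdw /cw /defect /smul.
rewrite (_ : _ - _ = dv i m * (kap i1 lambda i m * U (Some i) m)); last by rewrite /dv; ring.
rewrite USomeE UNoneE /kap; have [d0|d0] := eqVneq (dv i m) 0.
  rewrite d0 mul0r add0r.
  have [e|nx] := eqVneq i x1; last have [e|ny] := eqVneq i y1.
  - move: d0; rewrite e => /eqP; rewrite dv_x1 => ->.
    by rewrite x1_y1 !mul0r addr0 !mul1r.
  - by move: d0; rewrite e => ->; rewrite eqxx !mul0r add0r !mul1r.
  - by have := dv_other m nx ny; rewrite d0 eqxx.
rewrite (_ : (i == x1) && (ed m == 1) = false) ?mul0r ?subr0; last first.
  by apply/negP => /andP[/eqP e]; rewrite -dv_x1 -e (negbTE d0).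
rewrite mul1r mulrA mulfV // mul1r.
have [e|nx] := eqVneq i x1; last have [e|ny] := eqVneq i y1.
- by rewrite e -dv_x1 -e (negbTE d0) mul0r mulr0 e x1_y1 mul0r !addr0.
- by rewrite -e (negbTE d0) !mul0r mulr0 !addr0.
- by rewrite !mul0r !addr0.
Qed.

Lemma UNone_al : U None = sprod (svar R xi) al.
Proof.
apply/funext => m; have [m0|mp] := eqVneq (m xi) 0%N.
  rewrite sprod_svar0 // UNoneE; case: eqP => [|_]; last by rewrite mul0r.
  by rewrite /ed m0; lia.
have le : mpoly.lem (mnm1 xi) m by rewrite lep1mP.
by rewrite -{2}(submK le) sprod_svar /cal /sshift submK.
Qed.

Lemma ed_add m k : ed (mnm_add m k) = ed m + ed k.
Proof. by rewrite /ed !mnmDE; lia. Qed.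
Lemma ed_xi : ed (mnm1 xi) = 1.
Proof. by rewrite /ed !mnm1E eqxx xi_eta. Qed.
Lemma ed_eta : ed (mnm1 eta) = -1.
Proof. by rewrite /ed !mnm1E eqxx eta_xi. Qed.

Lemma al_diag m : ed m != 0 -> al m = 0.
Proof.
move=> h; rewrite /cal /sshift UNoneE ed_add ed_xi.
by rewrite (_ : (_ == _) = false) ?mul0r //; apply/negbTE; move: h; lia.
Qed.

Lemma sconv_w i : sconv (w i).
Proof. by have [c _ hc] := kap_bound l0; apply: (@sconv_smul _ _ _ _ c) => // m; case: (hc i m). Qed.
Lemma sconv_dw i : sconv (dw i).
Proof. by have [c _ hc] := kap_bound l0; apply: (@sconv_smul _ _ _ _ c) => // m; case: (hc i m). Qed.
Lemma sconv_base i : sconv (cbase R i1 i).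
Proof.
by rewrite /cbase; do 2?[case: ifP => _]; [exact: sconv_svar|exact: sconv_svar|exact: sconv_spol].
Qed.
Lemma sconv_W i : sconv (W i).
Proof. by apply: sconv_sadd; [exact: sconv_base|exact: sconv_w]. Qed.
Lemma sord_W i : sord 1 (W i). Proof. exact: sord_cW. Qed.
Lemma sconv_al : sconv al. Proof. exact: sconv_sshift. Qed.
Lemma sconv_hser : sconv hser. Proof. by apply: sconv_sadd => //; exact: sconv_spol. Qed.
Lemma sconv_rhs i : sconv (rhs i).
Proof.
apply: sconv_ssub; last by apply: sconv_sprod; [exact: sconv_al|exact: sconv_dw].
by apply: sconv_scomp; [exact: sconv_Nf|exact: sconv_W|exact: sord_W].
Qed.
Lemma sconv_defect : sconv defect.
Proof.
apply: (@sconv_smul _ _ _ _ 1); last exact: sconv_rhs.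
by move=> m; case: (_ == _); rewrite ?nm1 ?nm0.
Qed.
Lemma sconv_gam : sconv gam.
Proof.
apply: sconv_sadd; first exact: sconv_defect.
by apply: sconv_sprod; [exact: sconv_svar|exact: sconv_al].
Qed.

Lemma ev_base i z : ev (cbase R i1 i) z = (i == x1)%:R * z ord0 xi + (i == y1)%:R * z ord0 eta.
Proof.
rewrite /cbase; have [->|nx] := eqVneq i x1; first by rewrite ev_svar x1_y1 mul0r addr0 mul1r.
have [e|ny] := eqVneq i y1; first by rewrite ev_svar mul0r add0r mul1r.
by rewrite ev_spol meval0 !mul0r addr0.
Qed.

Lemma Dop_svar k : Dop (svar R k) = sscl (ed (mnm1 k))%:~R (svar R k).
Proof.
apply/funext => m; rewrite /Dop /smul /sscl svarE /spol mcoeffX.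
by case: eqP => [->|_]; rewrite ?mulr0.
Qed.

Lemma ev_Dbase i z :
  ev (Dop (cbase R i1 i)) z = (i == x1)%:R * z ord0 xi - (i == y1)%:R * z ord0 eta.
Proof.
have e k : Dop (svar R k) = spol ((ed (mnm1 k))%:~R *: mpolyX C (mnm1 k)).
  by rewrite Dop_svar svarE; apply/funext => m; rewrite /sscl /spol mcoeffZ.
rewrite /cbase; have [->|nx] := eqVneq i x1.
  by rewrite e ev_spol mevalZ mevalXU ed_xi x1_y1 mul0r subr0.
have [e'|ny] := eqVneq i y1.
  by rewrite e ev_spol mevalZ mevalXU ed_eta mul0r sub0r mul1r mulrN1z mulN1r.
rewrite Dop_eq0; last by move=> m _; rewrite /spol mcoeff0.
by rewrite ev_spol meval0 !mul0r subr0.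
Qed.

Lemma DW_E i : Dop (W i) = sadd (Dop (cbase R i1 i)) (dw i).
Proof. by rewrite cdwE; apply/funext => m; rewrite /Dop /smul /sadd mulrDr. Qed.

Lemma sconv_Dbase i : sconv (Dop (cbase R i1 i)).
Proof. exact: sconv_Dop (sconv_base i). Qed.

(** Restores the base terms in [rhsE]: for x_1, [U None] is xi alpha, as [Dop xi = xi] requires; for
    y_1 the mismatch is [gam]. *)
Lemma field_along_W : \forall z \near (0 : 'rV[C]_2), forall i,
  sg R i * ev (sder (cj i) hser) (Wrow z) =
  (lambda i1 + ev al z) * ev (dW i) z + (i == y1)%:R * ev gam z.
Proof.
apply: near_all => i.
have cN : sconv (scomp (Nf i) W).
  by apply: sconv_scomp; [exact: sconv_Nf|exact: sconv_W|exact: sord_W].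
have cad : sconv (sprod al (dw i)) by apply: sconv_sprod; [exact: sconv_al|exact: sconv_dw].
have cl := sconv_sscl (lambda i1) (sconv_dw i).
have cm := sconv_sscl (mu lambda i) (sconv_w i).
have cx := sconv_sscl ((i == x1)%:R) (hUc None).
have cy := sconv_sscl ((i == y1)%:R) sconv_defect.
have f1 := ev_ssub cN cad.
have f2 := ev_sprod sconv_al (sconv_dw i).
have f3 := ev_sadd (sconv_ssub cl cm) (sconv_sadd cx cy).
have f4 := ev_ssub cl cm.
have f5 := ev_sadd cx cy.
have f6 := ev_sscl (lambda i1) (sconv_dw i).
have f7 := ev_sscl (mu lambda i) (sconv_w i).
have f8 := ev_sscl ((i == x1)%:R) (hUc None).
have f9 := ev_sscl ((i == y1)%:R) sconv_defect.
have f10 := ev_sprod (sconv_svar R xi) sconv_al.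
have f11 := ev_scomp (sconv_Nf i) sconv_W sord_W.
have csd := sconv_sder (cj i) ch2.
have f12 := sconv_compr sconv_W sord_W (ev_sscl (sg R i) csd).
have f13 := sconv_compr sconv_W sord_W
  (ev_sadd (sconv_sder (cj i) (sconv_spol (H0poly lambda))) csd).
have f14 := ev_sadd (sconv_base i) (sconv_w i).
have f15 := ev_sadd (sconv_Dbase i) (sconv_dw i).
have f16 := ev_sadd sconv_defect (sconv_sprod (sconv_svar R eta) sconv_al).
have f17 := ev_sprod (sconv_svar R eta) sconv_al.
near=> z.
have e1 : ev (rhs i) z = ev (scomp (Nf i) W) z - ev al z * ev (dw i) z.
  have e : ev (rhs i) z = ev (scomp (Nf i) W) z - ev (sprod al (dw i)) z by near: z; exact: f1.
  by rewrite e; congr (_ - _); near: z; exact: f2.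
have e2 : ev (rhs i) z = lambda i1 * ev (dw i) z - mu lambda i * ev (w i) z
   + ((i == x1)%:R * (z ord0 xi * ev al z) + (i == y1)%:R * ev defect z).
  rewrite rhsE.
  have e : ev (sadd (ssub (sscl (lambda i1) (dw i)) (sscl (mu lambda i) (w i)))
     (sadd (sscl (i == x1)%:R (U None)) (sscl (i == y1)%:R defect))) z =
    ev (ssub (sscl (lambda i1) (dw i)) (sscl (mu lambda i) (w i))) z
    + ev (sadd (sscl (i == x1)%:R (U None)) (sscl (i == y1)%:R defect)) z by near: z; exact: f3.
  have e' : ev (ssub (sscl (lambda i1) (dw i)) (sscl (mu lambda i) (w i))) z =
    ev (sscl (lambda i1) (dw i)) z - ev (sscl (mu lambda i) (w i)) z by near: z; exact: f4.
  have e'' : ev (sadd (sscl (i == x1)%:R (U None)) (sscl (i == y1)%:R defect)) z =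
    ev (sscl (i == x1)%:R (U None)) z + ev (sscl (i == y1)%:R defect) z by near: z; exact: f5.
  have g1 : ev (sscl (lambda i1) (dw i)) z = lambda i1 * ev (dw i) z by near: z; exact: f6.
  have g2 : ev (sscl (mu lambda i) (w i)) z = mu lambda i * ev (w i) z by near: z; exact: f7.
  have g3 : ev (sscl (i == x1)%:R (U None)) z = (i == x1)%:R * ev (U None) z by near: z; exact: f8.
  have g4 : ev (sscl (i == y1)%:R defect) z = (i == y1)%:R * ev defect z by near: z; exact: f9.
  have g5 : ev (U None) z = z ord0 xi * ev al z.
    by rewrite -(ev_svar xi) UNone_al; near: z; exact: f10.
  by rewrite e e' e'' g1 g2 g3 g4 g5.
have e3 : ev (scomp (Nf i) W) z = sg R i * ev (sder (cj i) h2) (Wrow z).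
  have e : ev (scomp (Nf i) W) z = ev (Nf i) (Wrow z) by near: z; exact: f11.
  by rewrite e; near: z; exact: f12.
have e4 : ev (sder (cj i) hser) (Wrow z) =
   (mderiv (cj i) (H0poly lambda)).@[fun k => Wrow z ord0 k] + ev (sder (cj i) h2) (Wrow z).
  rewrite /hser sder_sadd -ev_spol -sder_spol; near: z; exact: f13.
have e5 : ev (W i) z = ev (cbase R i1 i) z + ev (w i) z by near: z; exact: f14.
have e6 : ev (Dop (W i)) z = ev (Dop (cbase R i1 i)) z + ev (dw i) z.
  by rewrite DW_E; near: z; exact: f15.
have e7 : ev gam z = ev defect z + z ord0 eta * ev al z.
  have e : ev gam z = ev defect z + ev (sprod (svar R eta) al) z by near: z; exact: f16.
  by rewrite e; congr (_ + _); rewrite -(ev_svar eta); near: z; exact: f17.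
rewrite e4 mulrDr H0poly_deriv -e3 [Wrow z ord0 i]mxE e5 e6 e7.
rewrite ev_base ev_Dbase.
have -> : ev (scomp (Nf i) W) z = ev (rhs i) z + ev al z * ev (dw i) z by rewrite e1 subrK.
rewrite e2.
have [ex|nx] := eqVneq i x1.
  by rewrite ex x1_y1 mu_lshift /=; ring.
have [ey|ny] := eqVneq i y1.
  by rewrite ey mu_rshift /=; ring.
by rewrite /=; ring.
Unshelve. all: by end_near.
Qed.

Local Notation hW := (scomp hser W).
Local Notation G := (fun z k => ev (sder k hser) (Wrow z)).

Lemma sconv_hW : sconv hW.
Proof. by apply: sconv_scomp; [exact: sconv_hser|exact: sconv_W|exact: sord_W]. Qed.

Lemma sconv_dW i : sconv (dW i).
Proof. exact: sconv_Dop (sconv_W i). Qed.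

Lemma sord_al : sord 1 al. Proof. exact: sord_cal. Qed.

Lemma freq_neq0 : \forall z \near (0 : 'rV[C]_2), lambda i1 + ev al z != 0.
Proof.
have c : sconv (sadd (spol (mpolyC 2 (lambda i1))) al).
  by apply: sconv_sadd; [exact: sconv_spol | exact: sconv_al].
have n0 : sadd (spol (mpolyC 2 (lambda i1))) al mnm0 != 0.
  by rewrite /sadd /spol mcoeffC eqxx mulr1 sord_al ?mdeg0 // addr0.
apply: filterS2 (ev_near_neq0 c n0) (ev_sadd (sconv_spol (mpolyC 2 (lambda i1))) sconv_al).
by move=> z h e; rewrite e ev_spol mevalC in h.
Qed.

(** Conservation of energy: by the chain rule, (lambda_1 + alpha) Dop (h o W) pairs dh with the
    Hamiltonian field, which is 0 by antisymmetry, minus dh/dy_1 times [gam]. That derivative is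
    itself (lambda_1 + alpha) Dop W_(x_1), and the common factor cancels. *)
Lemma Dop_hW_defect : Dop hW = sscl (-1) (sprod (dW x1) gam).
Proof.
have cg := sconv_sprod (sconv_dW x1) sconv_gam.
apply: ev_inj; [exact: sconv_Dop sconv_hW | exact: sconv_sscl |].
have f1 := ev_Dop sconv_hW.
have f2 := ev_chain sconv_hser sconv_W sord_W.
have f3 := near_all (fun k => ev_Dop (sconv_W k)).
have f4 := ev_sscl (-1) cg.
have f5 := ev_sprod (sconv_dW x1) sconv_gam.
apply: filterS (filterI f1 (filterI f2 (filterI f3 (filterI f4 (filterI f5
  (filterI field_along_W freq_neq0)))))) => z [e1 [e2 [e3 [e4 [e5 [e6 e7]]]]]].
rewrite e4 e5 e1 !e2.
have -> : z ord0 xi * (\sum_k G z k * ev (sder xi (W k)) z)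
    - z ord0 eta * (\sum_k G z k * ev (sder eta (W k)) z) = \sum_k G z k * ev (dW k) z.
  rewrite !mulr_sumr -sumrB; apply: eq_bigr => k _; rewrite e3; ring.
apply: (mulfI e7); rewrite mulr_sumr.
have -> : \sum_k (lambda i1 + ev al z) * (G z k * ev (dW k) z) =
    \sum_k sg R k * G z k * G z (cj k) - \sum_k (k == y1)%:R * (G z k * ev gam z).
  rewrite -sumrB; apply: eq_bigr => k _.
  have -> : sg R k * G z k * G z (cj k) = G z k * (sg R k * G z (cj k)) by ring.
  rewrite e6; ring.
have -> : \sum_k sg R k * G z k * G z (cj k) = 0.
  rewrite sum_phase big1 // => j _; rewrite sgl sgr cjl cjr; ring.
rewrite (bigD1 y1) //= big1 ?addr0 => [|k /negbTE ->]; last by rewrite mul0r.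
have := e6 x1; rewrite sgl cjl x1_y1 mul1r mul0r addr0 eqxx => ->; rewrite /=; ring.
Qed.

Lemma gam_support m : ed m != -1 -> gam m = 0.
Proof.
move=> h; rewrite /gam /sadd /defect /smul dv_y1 (negbTE h) mul0r add0r.
have [m0|mp] := eqVneq (m eta) 0%N; first by rewrite sprod_svar0.
have le : mpoly.lem (mnm1 eta) m by rewrite lep1mP.
rewrite -(submK le) sprod_svar; apply: al_diag.
by move: h; rewrite -{1}(submK le) ed_add ed_eta; lia.
Qed.

(** [Dop] annihilates every power of xi eta, so the product of Dop W_(x_1) = xi + O(2) and [gam] has
    no such coefficient. As [gam] only contains monomials of [ed] -1, multiplication by xi moves all
    of it onto that diagonal. *)
Lemma gam_eq0 : gam = spol 0.
Proof.
have h : forall d, sord d gam.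
  elim=> [//|d IH] m; rewrite ltnS leq_eqVlt => /orP[/eqP md|]; last exact: IH.
  have [em|] := eqVneq (ed m) (-1); last exact: gam_support.
  pose m' := mnm_add m (mnm1 xi).
  have : sprod (dW x1) gam m' = 0.
    have := congr1 (fun f => f m') Dop_hW_defect.
    rewrite /Dop /smul /sscl ed_add em ed_xi mul0r => /esym/eqP.
    by rewrite mulN1r oppr_eq0 => /eqP.
  rewrite DW_E sprodDl /sadd.
  have -> : Dop (cbase R i1 x1) = svar R xi.
    rewrite /cbase eqxx Dop_svar ed_xi; apply/funext => k; by rewrite /sscl mul1r.
  rewrite sprod_svar.
  (* With [gam] already of order [d], the correction [dw] pushes the other product beyond degree d +
     1, the degree of [m']; only [gam m] remains. *)
  rewrite (@sord_sprod _ _ 2 d d.+2 (dw x1) gam) ?addr0 //.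
  - by apply: sord_smul.
  - by rewrite mdegD mdeg1 md addn1.
by apply/funext => m; rewrite /spol mcoeff0; apply: (h (mdeg m).+1).
Qed.

Lemma Dop_hW : Dop hW = spol 0.
Proof.
rewrite Dop_hW_defect gam_eq0 sprods0; apply/funext => m.
by rewrite /sscl /spol mcoeff0 mulr0.
Qed.

Lemma field_W : \forall z \near (0 : 'rV[C]_2), forall i,
  sg R i * G z (cj i) = (lambda i1 + ev al z) *
    (z ord0 xi * ev (sder xi (W i)) z - z ord0 eta * ev (sder eta (W i)) z).
Proof.
have f3 := near_all (fun k => ev_Dop (sconv_W k)).
apply: filterS2 field_along_W f3 => z e1 e2 i.
by rewrite e1 gam_eq0 ev_spol meval0 mulr0 addr0 e2.
Qed.

(** The coefficient of dxi /\ deta in the pullback of the symplectic form by W. *)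
Definition bracket : mon 2 -> C := ssum predT (fun j : 'I_n =>
  ssub (sprod (sder xi (W (lshift n j))) (sder eta (W (rshift n j))))
       (sprod (sder eta (W (lshift n j))) (sder xi (W (rshift n j))))).

Lemma sconv_bracket : sconv bracket.
Proof.
apply: sconv_ssum => j _; apply: sconv_ssub; apply: sconv_sprod; apply: sconv_sder; exact: sconv_W.
Qed.

Lemma ev_bracket : \forall z \near (0 : 'rV[C]_2), ev bracket z = \sum_(j < n)
  (ev (sder xi (W (lshift n j))) z * ev (sder eta (W (rshift n j))) z
   - ev (sder eta (W (lshift n j))) z * ev (sder xi (W (rshift n j))) z).
Proof.
have c t i : sconv (sder t (W i)) by apply: sconv_sder; exact: sconv_W.
pose F j := sprod (sder xi (W (lshift n j))) (sder eta (W (rshift n j))).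
pose F' j := sprod (sder eta (W (lshift n j))) (sder xi (W (rshift n j))).
have cF j : sconv (F j) by exact: sconv_sprod.
have cF' j : sconv (F' j) by exact: sconv_sprod.
have f1 := @ev_ssum _ _ _ predT (fun j => ssub (F j) (F' j)) (fun j _ => sconv_ssub (cF j) (cF' j)).
have f2 := near_all (fun j => ev_ssub (cF j) (cF' j)).
have f3 := near_all (fun j => ev_sprod (c xi (lshift n j)) (c eta (rshift n j))).
have f4 := near_all (fun j => ev_sprod (c eta (lshift n j)) (c xi (rshift n j))).
apply: filterS (filterI f1 (filterI f2 (filterI f3 f4))) => z [e1 [e2 [e3 e4]]].
by rewrite [ev bracket z]e1; apply: eq_bigr => j _; rewrite e2 e3 e4.
Qed.

Definition flux : mon 2 -> C := sadd (sscl (lambda i1) bracket) (sprod al bracket).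

Lemma sconv_flux : sconv flux.
Proof.
apply: sconv_sadd; first exact: sconv_sscl sconv_bracket.
exact: sconv_sprod sconv_al sconv_bracket.
Qed.

Lemma ev_flux : \forall z \near (0 : 'rV[C]_2),
  ev flux z = (lambda i1 + ev al z) * ev bracket z.
Proof.
have f1 := ev_sadd (sconv_sscl (lambda i1) sconv_bracket) (sconv_sprod sconv_al sconv_bracket).
have f2 := ev_sscl (lambda i1) sconv_bracket.
have f3 := ev_sprod sconv_al sconv_bracket.
apply: filterS3 f1 f2 f3 => z e1 e2 e3.
by rewrite /flux e1 e2 e3 mulrDl.
Qed.

(** Replacing dh by the Hamiltonian field, tangent to W, cancels the terms in xi d/dxi and leaves
    eta (lambda_1 + alpha) times the bracket. Since h o W is a function of xi eta, so is [flux]. *)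
Lemma sder_hW : sder xi hW = sprod (svar R eta) flux.
Proof.
have v := sconv_svar R eta.
apply: ev_inj; [exact: sconv_sder sconv_hW | exact: sconv_sprod v sconv_flux |].
have f2 := ev_chain sconv_hser sconv_W sord_W.
have f5 := ev_sprod v sconv_flux.
apply: filterS (filterI f2 (filterI f5 (filterI ev_flux (filterI ev_bracket field_W))))
  => z [e2 [e5 [e6 [e7 e8]]]].
rewrite e5 e6 e7 e2 ev_svar sum_phase.
rewrite !mulr_sumr; apply: eq_bigr => j _.
have := e8 (lshift n j); have := e8 (rshift n j).
rewrite sgl sgr cjl cjr mul1r mulN1r => /eqP; rewrite eqr_oppLR => /eqP -> ->; ring.
Qed.

Lemma flux_diag m : ed m != 0 -> flux m = 0.
Proof.
move=> h; rewrite -(sprod_svar eta) -sder_hW sderE (DopE_eq0 Dop_hW) ?mul0rn //.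
by rewrite !ed_add ed_xi ed_eta; move: h; lia.
Qed.

(** By Leibniz, [Dop] of (lambda_1 + alpha) [bracket] is (lambda_1 + alpha) times [Dop bracket],
    because alpha is diagonal; the frequency is nonzero near 0 and can be divided out. *)
Lemma bracket_diag m : ed m != 0 -> bracket m = 0.
Proof.
move: m; apply: DopE_eq0; apply: ev_inj; [exact: sconv_Dop sconv_bracket | exact: sconv_spol |].
have cD := sconv_Dop sconv_bracket.
have e : Dop flux = sadd (sscl (lambda i1) (Dop bracket)) (sprod al (Dop bracket)).
  rewrite /flux; apply/funext => m.
  have := congr1 (fun f => f m) (Dop_sprod al bracket).
  rewrite (Dop_eq0 al_diag) /Dop /smul /sadd /sscl => h.
  by rewrite mulrDr h sprod0s /spol mcoeff0 add0r; ring.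
have f1 := ev_sadd (sconv_sscl (lambda i1) cD) (sconv_sprod sconv_al cD).
have f2 := ev_sscl (lambda i1) cD.
have f3 := ev_sprod sconv_al cD.
apply: filterS (filterI f1 (filterI f2 (filterI f3 freq_neq0))) => z [e1 [e2 [e3 e4]]].
rewrite ev_spol meval0; apply: (mulfI e4); rewrite mulr0 mulrDl -e2 -e3 -e1 -e.
by rewrite (Dop_eq0 flux_diag) ev_spol meval0.
Qed.

(** With [act_eta], the two components of the pullback by W of the primitive sum of y_j dx_j. *)
Definition act_xi : mon 2 -> C :=
  ssum predT (fun j : 'I_n => sprod (W (rshift n j)) (sder xi (W (lshift n j)))).
Definition act_eta : mon 2 -> C :=
  ssum predT (fun j : 'I_n => sprod (W (rshift n j)) (sder eta (W (lshift n j)))).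

Lemma bracketE : bracket = ssub (sder eta act_xi) (sder xi act_eta).
Proof.
rewrite /act_xi /act_eta !sder_ssum; apply/funext => m.
rewrite /bracket /ssum /ssub -sumrB; apply: eq_bigr => j _.
rewrite !sder_sprod [sder eta (sder xi _)]sderC /sadd.
rewrite [sprod (sder xi (W (lshift n j))) _]sprodC [sprod (sder eta (W (lshift n j))) _]sprodC.
by ring.
Qed.

(** That pulled-back primitive contracted with the field xi d/dxi - eta d/deta. *)
Definition action : mon 2 -> C := ssub (sprod (svar R xi) act_xi) (sprod (svar R eta) act_eta).

Lemma actionE m : action m = \sum_(j < n) sprod (W (rshift n j)) (dW (lshift n j)) m.
Proof.
have e : action = ssum predT (fun j : 'I_n => sprod (W (rshift n j)) (dW (lshift n j))).
  have c t i : sconv (sder t (W i)) by apply: sconv_sder; exact: sconv_W.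
  have cs t j : sconv (sprod (W (rshift n j)) (sder t (W (lshift n j)))).
    by apply: sconv_sprod => //; exact: sconv_W.
  have cd j : sconv (sprod (W (rshift n j)) (dW (lshift n j))).
    by apply: sconv_sprod; [exact: sconv_W | exact: sconv_dW].
  have ca : sconv act_xi by apply: sconv_ssum => j _; exact: cs.
  have cb : sconv act_eta by apply: sconv_ssum => j _; exact: cs.
  have vx := sconv_svar R xi; have ve := sconv_svar R eta.
  apply: ev_inj; [exact: sconv_ssub (sconv_sprod vx ca) (sconv_sprod ve cb) | exact: sconv_ssum |].
  have f1 := ev_ssub (sconv_sprod vx ca) (sconv_sprod ve cb).
  have f2 := ev_sprod vx ca.
  have f3 := ev_sprod ve cb.
  have f4 := @ev_ssum _ _ _ predT _ (fun (j : 'I_n) _ => cs xi j).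
  have f5 := @ev_ssum _ _ _ predT _ (fun (j : 'I_n) _ => cs eta j).
  have f6 := @ev_ssum _ _ _ predT _ (fun (j : 'I_n) _ => cd j).
  have f7 := near_all (fun j => ev_sprod (sconv_W (rshift n j)) (c xi (lshift n j))).
  have f8 := near_all (fun j => ev_sprod (sconv_W (rshift n j)) (c eta (lshift n j))).
  have f9 := near_all (fun j => ev_sprod (sconv_W (rshift n j)) (sconv_dW (lshift n j))).
  have f10 := near_all (fun k => ev_Dop (sconv_W k)).
  apply: filterS (filterI f1 (filterI f2 (filterI f3 (filterI f4 (filterI f5 (filterI f6
    (filterI f7 (filterI f8 (filterI f9 f10))))))))) =>
    z [e1 [e2 [e3 [e4 [e5 [e6 [e7 [e8 [e9 e10]]]]]]]]].
  rewrite [ev action z]e1 e2 e3 !ev_svar [ev act_xi z]e4 [ev act_eta z]e5 e6.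
  rewrite !mulr_sumr -sumrB; apply: eq_bigr => j _.
  by rewrite e7 e8 e9 e10; ring.
by rewrite e.
Qed.

(** On a diagonal monomial the action is xi eta plus eta Dop w_(x_1), xi w_(y_1) and [cQ]. The
    resonant part of w_(y_1) is 0 and that of w_(x_1) was prescribed to cancel [cQ]: only xi eta
    survives. *)
Lemma action_diag m : ed m = 0 ->
  action (mnm_add (mnm_add m (mnm1 xi)) (mnm1 eta)) = (m == mnm0)%:R.
Proof.
move=> h; set M := mnm_add _ _.
have sbase j : j != i1 -> W (lshift n j) = w (lshift n j) /\ W (rshift n j) = w (rshift n j).
  move=> ji; split; apply/funext => k; rewrite /cW /sadd /cbase.
    by rewrite eq_lshift (negbTE ji) eq_lrshift /spol mcoeff0 add0r.
  by rewrite eq_rlshift eq_rshift (negbTE ji) /spol mcoeff0 add0r.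
have -> : action M = sprod (svar R eta) (svar R xi) M + sprod (svar R eta) (dw x1) M
    + sprod (svar R xi) (w y1) M + cQ i1 lambda U M.
  rewrite actionE (bigD1 i1) //= /cQ /ssum [in RHS](bigD1 i1) //=.
  have -> : \sum_(j < n | j != i1) sprod (W (rshift n j)) (dW (lshift n j)) M
      = \sum_(j < n | j != i1) sprod (w (rshift n j)) (dw (lshift n j)) M.
    by apply: eq_bigr => j ji; have [-> ->] := sbase j ji; rewrite cdwE.
  rewrite DW_E sprodDr {1}/sadd !addrA; congr (_ + _).
  have -> : Dop (cbase R i1 x1) = svar R xi.
    by rewrite /cbase eqxx Dop_svar ed_xi; apply/funext => k; rewrite /sscl mul1r.
  have -> : W y1 = sadd (svar R eta) (w y1) by rewrite /cW /cbase y1_x1 eqxx.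
  by rewrite !sprodDl /sadd [sprod (w y1) (svar R xi)]sprodC; ring.
have M_xi : sprod (svar R xi) (w y1) M = w y1 (mnm_add m (mnm1 eta)).
  rewrite (_ : M = mnm_add (mnm_add m (mnm1 eta)) (mnm1 xi)) ?sprod_svar //.
  by rewrite /M -!addmA [mnm_add (mnm1 xi) _]addmC.
rewrite M_xi {1 2}/M !sprod_svar.
have -> : svar R xi (mnm_add m (mnm1 xi)) = (m == mnm0)%:R.
  by rewrite svarE /spol mcoeffX -{1}[mnm1 xi]add0m eqm_add2r eq_sym.
have -> : dw x1 (mnm_add m (mnm1 xi)) = - cQ i1 lambda U M.
  have e : ed (mnm_add m (mnm1 xi)) = 1 by rewrite ed_add h ed_xi.
  rewrite /cdw /smul /kap dv_x1 e eqxx USomeE dv_x1 e !eqxx /= -/M.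
  by rewrite mul0r sub0r !mul1r.
have -> : w y1 (mnm_add m (mnm1 eta)) = 0.
  have e : ed (mnm_add m (mnm1 eta)) = -1 by rewrite ed_add h ed_eta.
  by rewrite /cw /smul USomeE dv_y1 e eqxx /= y1_x1 !mul0r subr0 mulr0.
by rewrite addr0 addrNK.
Qed.

(** Off the diagonal [bracket_diag] applies. At exponents (k, k) both mixed derivatives carry the
    factor k + 1, so the bracket is k + 1 times the action coefficient one step up the diagonal. *)
Lemma bracket1 : bracket = spol 1.
Proof.
apply/funext => m; rewrite /spol mcoeff1.
have [h|h] := eqVneq (ed m) 0; last first.
  rewrite bracket_diag //; case: eqP => // e; move: h; rewrite e /ed !mnm0E.
  by [].
have a := action_diag h.
have e : m xi = m eta by move: h; rewrite /ed; lia.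
move: a; rewrite /action /ssub sprod_svar.
have -> : mnm_add (mnm_add m (mnm1 xi)) (mnm1 eta) = mnm_add (mnm_add m (mnm1 eta)) (mnm1 xi).
  by rewrite -!addmA [mnm_add (mnm1 xi) _]addmC.
rewrite sprod_svar bracketE /ssub !sderE e -mulrnBl => ->.
by case: eqP => [->|_]; rewrite ?mul0rn // mnm0E.
Qed.

Lemma ev_bracket1 : \forall z \near (0 : 'rV[C]_2), \sum_(j < n)
  (ev (sder xi (W (lshift n j))) z * ev (sder eta (W (rshift n j))) z
   - ev (sder eta (W (lshift n j))) z * ev (sder xi (W (rshift n j))) z) = 1.
Proof.
by apply: filterS ev_bracket => z <-; rewrite bracket1 ev_spol meval1.
Qed.

End Consequences.

Section CenterManifold.
Variables (R : realType) (n : nat) (i1 : 'I_n).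
Local Notation C := (Cplx R).

(* The last three conclusions say that [W] conjugates the field
   (lambda_1 + al) (xi d/dxi - eta d/deta) to the Hamiltonian field, that it pulls the
   symplectic form back to dxi /\ deta, and that h o W depends on xi * eta only. *)
Lemma center_manifold (lambda : 'I_n -> C) (h2 : mon (n + n) -> C) :
  sconv h2 -> sord 3 h2 -> lambda i1 != 0 ->
  (forall nu : 'I_n, nu != i1 -> forall k : int, lambda nu - k%:~R * lambda i1 != 0) ->
  exists (W : 'I_(n + n) -> mon 2 -> C) (al : mon 2 -> C),
    [/\ forall i, sconv (W i), forall i, sord 2 (ssub (W i) (cbase R i1 i)),
      \forall z \near (0 : 'rV[C]_2), forall i,
        sg R i * ev (sder (cj i) (hser lambda h2)) (\row_k ev (W k) z) =
        (lambda i1 + ev al z) *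
          (z ord0 xi * ev (sder xi (W i)) z - z ord0 eta * ev (sder eta (W i)) z),
      \forall z \near (0 : 'rV[C]_2), \sum_(j < n)
        (ev (sder xi (W (lshift n j))) z * ev (sder eta (W (rshift n j))) z
         - ev (sder eta (W (lshift n j))) z * ev (sder xi (W (rshift n j))) z) = 1 &
      forall m, ed m != 0 -> scomp (hser lambda h2) W m = 0].
Proof.
move=> ch2 s3 l0 nonres.
have [U [U2 Uc UT]] := manifold_fixpoint l0 (sconv_Nf ch2) (sord_Nf s3).
exists (cW i1 lambda U), (cal U); split.
- by move=> i; exact: sconv_W.
- move=> i m hm; rewrite /ssub /cW /sadd [cbase _ _ _ m + _]addrC addrK.
  by rewrite /cw /smul U2 ?mulr0.
- exact: field_W UT.
- exact: ev_bracket1 UT.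
- by apply: DopE_eq0; exact: Dop_hW UT.
Qed.

End CenterManifold.

Section MoreComposition.
Variables (R : realType) (M N : nat).
Local Notation C := (Cplx R).

Lemma scompDl (a b : mon M -> C) (g : 'I_M -> mon N -> C) :
  scomp (sadd a b) g = sadd (scomp a g) (scomp b g).
Proof. by apply/funext => m; rewrite /sadd !scomp_coef tr_sadd polycD mcoeffD. Qed.

Lemma scomp_svar k (g : 'I_M -> mon N -> C) : (forall i, sord 1 (g i)) -> scomp (svar R k) g = g k.
Proof.
move=> hg; apply/funext => m; rewrite scomp_coef; set e := (mdeg m).+1.
have -> : g k m = (polyc (mpolyX C (mnm1 k)) (fun i => tr e (g i)))@_m.
  by rewrite polycX -[mnm1 k]addm0 mprodU mprod0 mulr1 mcoeff_tr_lt.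
apply: (@coef_ordge _ _ e _ _ m _ (ltnSn _)); rewrite -polycB.
apply: ordge_polyc => [i|]; first exact: ordge_tr_sord.
by rewrite svarE -opprB; apply: ordgeN; exact: ordge_tr_spol.
Qed.

Lemma scomp0 (g : 'I_M -> mon N -> C) : scomp (spol 0) g = spol 0.
Proof.
apply/funext => m; rewrite scomp_coef (_ : tr _ _ = 0) ?polyc0 /spol ?mcoeff0 //.
by apply/mpolyP => k; rewrite mcoeff_tr mcoeff0 if_same.
Qed.

End MoreComposition.

(** * Directional derivatives and the algebra of the extension *)

Section Directional.
Variables (R : realType) (N : nat).
Local Notation C := (Cplx R).
Implicit Types (a b : mon N -> C) (z u : 'rV[C]_N).

Definition dd a z u : C := \sum_t u ord0 t * ev (sder t a) z.

Lemma dd_svar k z u : dd (svar R k) z u = u ord0 k.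
Proof.
rewrite /dd (bigD1 k) //= big1 ?addr0 => [|t tk]; rewrite sder_svar ev_spol.
  by rewrite eqxx meval1 mulr1.
by rewrite (negbTE tk) meval0 mulr0.
Qed.

Lemma dd_spol0 z u : dd (spol 0) z u = 0.
Proof. by rewrite /dd big1 // => t _; rewrite sder_spol mderiv0 ev_spol meval0 mulr0. Qed.

Lemma dd_sadd a b : sconv a -> sconv b ->
  \forall z \near (0 : 'rV[C]_N), forall u, dd (sadd a b) z u = dd a z u + dd b z u.
Proof.
move=> ca cb; have f := near_all (fun t => ev_sadd (sconv_sder t ca) (sconv_sder t cb)).
apply: filterS f => z e u; rewrite /dd -big_split; apply: eq_bigr => t _.
by rewrite sder_sadd e mulrDr.
Qed.

Lemma dd_ssub a b : sconv a -> sconv b ->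
  \forall z \near (0 : 'rV[C]_N), forall u, dd (ssub a b) z u = dd a z u - dd b z u.
Proof.
move=> ca cb; have f := near_all (fun t => ev_ssub (sconv_sder t ca) (sconv_sder t cb)).
apply: filterS f => z e u; rewrite /dd -sumrB; apply: eq_bigr => t _.
by rewrite sder_ssub e mulrBr.
Qed.

Lemma dd_ssum (I : finType) (P : pred I) (F : I -> mon N -> C) : (forall i, sconv (F i)) ->
  \forall z \near (0 : 'rV[C]_N), forall u, dd (ssum P F) z u = \sum_(i | P i) dd (F i) z u.
Proof.
move=> cF; have f := near_all (fun t => @ev_ssum _ _ _ P _ (fun i _ => sconv_sder t (cF i))).
apply: filterS f => z e u; rewrite /dd exchange_big; apply: eq_bigr => t _ /=.
by rewrite sder_ssum e mulr_sumr.
Qed.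

Lemma dd_sprod a b : sconv a -> sconv b -> \forall z \near (0 : 'rV[C]_N), forall u,
  dd (sprod a b) z u = dd a z u * ev b z + ev a z * dd b z u.
Proof.
move=> ca cb.
have f1 := near_all (fun t => ev_sadd (sconv_sprod (sconv_sder t ca) cb) (sconv_sprod ca (sconv_sder t cb))).
have f2 := near_all (fun t => ev_sprod (sconv_sder t ca) cb).
have f3 := near_all (fun t => ev_sprod ca (sconv_sder t cb)).
apply: filterS3 f1 f2 f3 => z e1 e2 e3 u; rewrite /dd mulr_suml mulr_sumr -big_split.
apply: eq_bigr => t _ /=; rewrite sder_sprod e1 e2 e3; ring.
Qed.

Lemma dd_scomp M (h : mon M -> C) (g : 'I_M -> mon N -> C) :
  sconv h -> (forall i, sconv (g i)) -> (forall i, sord 1 (g i)) ->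
  \forall z \near (0 : 'rV[C]_N), forall u, dd (scomp h g) z u =
    \sum_k ev (sder k h) (\row_i ev (g i) z) * dd (g k) z u.
Proof.
move=> ch cg sg; apply: filterS (ev_chain ch cg sg) => z e u.
under [RHS]eq_bigr do rewrite /dd mulr_sumr.
rewrite exchange_big; apply: eq_bigr => t _ /=.
by rewrite e mulr_sumr; apply: eq_bigr => k _; rewrite mulrCA.
Qed.

End Directional.

(** Pointwise content of the symplectic extension. For tangent vectors u (plain letters) and v
    (primed), [X], [Y] are the transverse components, [T], [E], [P] the differentials of tau, y_1
    and pi; [xx], [xe], [yx], [ye] are the first derivatives of W, [uxx], [uxe], [uee] the second
    ones of W_(x_1). The hypotheses are the bracket identity and the differentiated equations of tau
    and pi. *)
Lemma symplectic_algebra (F : comNzRingType) (n : nat) (i1 : 'I_n)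
  (xx xe yx ye X Y X' Y' : 'I_n -> F) (T E P T' E' P' U1 U1' pi uxx uxe uee Qxx Qxe Qee : F) :
  \sum_(j < n) (xx j * ye j - xe j * yx j) = 1 ->
  P * xx i1 + pi * (uxx * T + uxe * E)
    = \sum_(j < n | j != i1) (X j * yx j - Y j * xx j) + (Qxx * T + Qxe * E) ->
  U1 = T + \sum_(j < n | j != i1) (X j * ye j - Y j * xe j) + (Qxe * T + Qee * E)
    - P * xe i1 - pi * (uxe * T + uee * E) ->
  P' * xx i1 + pi * (uxx * T' + uxe * E')
    = \sum_(j < n | j != i1) (X' j * yx j - Y' j * xx j) + (Qxx * T' + Qxe * E') ->
  U1' = T' + \sum_(j < n | j != i1) (X' j * ye j - Y' j * xe j) + (Qxe * T' + Qee * E')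
    - P' * xe i1 - pi * (uxe * T' + uee * E') ->
  \sum_(j < n) (
     ((j != i1)%:R * X j + xx j * T + xe j * E)
       * ((j != i1)%:R * Y' j + yx j * T' + ye j * E' + (j == i1)%:R * P')
     - ((j != i1)%:R * Y j + yx j * T + ye j * E + (j == i1)%:R * P)
       * ((j != i1)%:R * X' j + xx j * T' + xe j * E'))
  = U1 * E' - E * U1' + \sum_(j < n | j != i1) (X j * Y' j - Y j * X' j).
Proof.
move=> hb h1 h2 h1' h2'.
rewrite (bigD1 i1) //= in hb; rewrite (bigD1 i1) //= eqxx /=.
set Bt := \sum_(j < n | _) _ in hb.
set S1 := \sum_(j < n | _) _ in h1; set S2 := \sum_(j < n | _) _ in h2.
set S1' := \sum_(j < n | _) _ in h1'; set S2' := \sum_(j < n | _) _ in h2'.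
set S0 := \sum_(j < n | j != i1) (X j * Y' j - Y j * X' j).
(* The transverse sum is bilinear in u and v, hence a combination of the sums occurring in the
   hypotheses; after this everything concerns the pair [i1] alone. *)
have -> : \sum_(j < n | j != i1) (
     ((j != i1)%:R * X j + xx j * T + xe j * E)
       * ((j != i1)%:R * Y' j + yx j * T' + ye j * E' + (j == i1)%:R * P')
     - ((j != i1)%:R * Y j + yx j * T + ye j * E + (j == i1)%:R * P)
       * ((j != i1)%:R * X' j + xx j * T' + xe j * E'))
  = S0 + (T' * S1 + (E' * S2 + (- T * S1' + (- E * S2' + (T * E' - E * T') * Bt)))).
  rewrite /S0 /S1 /S2 /S1' /S2' /Bt !mulr_sumr -!big_split /=.
  apply: eq_bigr => j ji; rewrite ji (negbTE ji) /=; ring.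
have e1 : S1 = P * xx i1 + pi * (uxx * T + uxe * E) - (Qxx * T + Qxe * E) by rewrite h1; ring.
have e1' : S1' = P' * xx i1 + pi * (uxx * T' + uxe * E') - (Qxx * T' + Qxe * E') by rewrite h1'; ring.
have eB : Bt = 1 - (xx i1 * ye i1 - xe i1 * yx i1) by rewrite -hb; ring.
rewrite h2 h2' e1 e1' eB; ring.
Qed.

(** * Symplectic extension of the manifold *)

Section Extension.
Variables (R : realType) (n : nat) (i1 : 'I_n).
Local Notation C := (Cplx R).
Variable W : 'I_(n + n) -> mon 2 -> C.
Hypotheses (cW : forall i, sconv (W i)) (sW : forall i, sord 2 (ssub (W i) (cbase R i1 i))).

Local Notation x1 := (lshift n i1).
Local Notation y1 := (rshift n i1).
Implicit Types U V : bool -> mon (n + n) -> C.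

(* The extension Phi of W is sought in the form X_i -> W_i(tau, Y_1) + (X_i transverse),
   with y_1-component shifted by pi and tau = X_1 + tau'.  The form Phi^* omega - omega is
   exact, and asking that its primitive vanish gives two equations for [U true] = tau' and
   [U false] = pi, in which [eS] is the pairing of the transverse variables with dW. *)
Definition dW (t : 'I_2) (i : 'I_(n + n)) : mon 2 -> C := sder t (ssub (W i) (cbase R i1 i)).
Definition etau U := sadd (svar R x1) (U true).
Definition einner U (k : 'I_2) := if k == xi then etau U else svar R y1.
Definition ecmp U (a : mon 2 -> C) := scomp a (einner U).
Definition eS U (t : 'I_2) := ssum (fun j : 'I_n => j != i1) (fun j =>
  ssub (sprod (svar R (lshift n j)) (ecmp U (dW t (rshift n j))))
       (sprod (svar R (rshift n j)) (ecmp U (dW t (lshift n j))))).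
(** The equations are pi d_xi W_(x_1) = S_xi and tau' = pi d_eta W_(x_1) - S_eta. In the first, d_xi
    W_(x_1) is 1 plus the entry of [dW]; isolating the 1 gives a fixed-point equation that raises
    degrees. *)
Definition eT U (b : bool) :=
  if b then ssub (sprod (U false) (ecmp U (dW eta x1))) (eS U eta)
  else ssub (eS U xi) (sprod (ecmp U (dW xi x1)) (U false)).

Lemma sconv_dWt t i : sconv (dW t i).
Proof.
apply: sconv_sder; apply: sconv_ssub => //.
by rewrite /cbase; do 2?[case: ifP => _]; [exact: sconv_svar|exact: sconv_svar|exact: sconv_spol].
Qed.

Lemma sord_dW t i : sord 1 (dW t i). Proof. exact: sord_sder. Qed.

Lemma sord_einner U k : (forall b, sord 2 (U b)) -> sord 1 (einner U k).
Proof.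
move=> h; rewrite /einner; case: ifP => _; last exact: sord_svar.
by apply: sord_sadd; [exact: sord_svar | exact: sord_le (h true)].
Qed.

Lemma sord_ecmp U a d : (forall b, sord 2 (U b)) -> sord d a -> sord d (ecmp U a).
Proof. by move=> h ha; apply: sord_scomp => // k; exact: sord_einner. Qed.

Lemma sord_eS U t : (forall b, sord 2 (U b)) -> sord 2 (eS U t).
Proof.
move=> h; apply: sord_ssum => j _; apply: sord_ssub; apply: (@sord_sprod _ _ 1 1) => //;
  try exact: sord_svar; apply: sord_ecmp => //; exact: sord_dW.
Qed.

Lemma sord_eT U b : (forall b, sord 2 (U b)) -> sord 2 (eT U b).
Proof.
move=> h; case: b => /=; apply: sord_ssub; try exact: sord_eS.
  by apply: (@sord_sprod _ _ 2 0) => //.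
by apply: (@sord_sprod _ _ 0 2) => //.
Qed.

Lemma eqd_ecmp U V d t i : (forall b, sord 2 (U b)) -> (forall b, sord 2 (V b)) ->
  (forall b, eqd d (U b) (V b)) -> eqd d (ecmp U (dW t i)) (ecmp V (dW t i)).
Proof.
move=> hU hV h; apply: (@eqd_scomp _ _ _ d 1); rewrite ?addn0 //.
- exact: sord_dW.
- by move=> k; exact: sord_einner.
- by move=> k; exact: sord_einner.
by move=> k; rewrite /einner; case: ifP => // _; exact: eqd_sadd.
Qed.

Lemma eqd_eS U V d t : (forall b, sord 2 (U b)) -> (forall b, sord 2 (V b)) ->
  (forall b, eqd d (U b) (V b)) -> eqd d.+1 (eS U t) (eS V t).
Proof.
move=> hU hV h; apply: eqd_ssum => j _; apply: eqd_ssub.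
  apply: (@eqd_sprod _ _ d.+1 d 0 1) => //; rewrite ?addn0 ?addn1 //.
    exact: sord_svar.
  exact: eqd_ecmp.
apply: (@eqd_sprod _ _ d.+1 d 0 1) => //; rewrite ?addn0 ?addn1 //.
  exact: sord_svar.
exact: eqd_ecmp.
Qed.

Lemma eqd_eT U V d b : (forall b, sord 2 (U b)) -> (forall b, sord 2 (V b)) ->
  (forall b, eqd d (U b) (V b)) -> eqd d.+1 (eT U b) (eT V b).
Proof.
move=> hU hV h; case: b => /=; apply: eqd_ssub; try exact: eqd_eS.
  apply: (@eqd_sprod _ _ d d 1 2) => //; rewrite ?addn1 ?addn2 //.
    by apply: sord_ecmp => //; exact: sord_dW.
  exact: eqd_ecmp.
apply: (@eqd_sprod _ _ d d 2 1) => //; rewrite ?addn1 ?addn2 //.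
  by apply: sord_ecmp => //; exact: sord_dW.
exact: eqd_ecmp.
Qed.

Lemma bnd_eT U b r A K : 0 < r -> 0 <= A -> 0 <= K ->
  (forall t i, bnd (2 * r) (dW t i) (A * r)) ->
  K * r <= 1 -> n%:R * (2 * A) + A * K * r <= K ->
  (forall b, sord 2 (U b)) -> (forall b, bnd r (U b) (K * r ^+ 2)) -> bnd r (eT U b) (K * r ^+ 2).
Proof.
move=> r0 A0 K0 hA h1 h2 sU hU; have r0' := ltW r0.
have hin k : bnd r (einner U k) (2 * r).
  have e := ler_wpM2r r0' h1.
  rewrite /einner; case: ifP => _.
    apply: (@bnd_le _ _ r r _ (r + K * r ^+ 2)); first by rewrite r0' lexx.
      by rewrite expr2; lra.
    by apply: bnd_sadd => //; exact: bnd_svar.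
  by apply: (@bnd_le _ _ r r _ r); [rewrite r0' lexx | lra | exact: bnd_svar].
have hc t i : bnd r (ecmp U (dW t i)) (A * r).
  by apply: (bnd_scomp r0' (hA t i)) => // k; exact: sord_einner.
have hS t : bnd r (eS U t) (n%:R * (2 * A) * r ^+ 2).
  apply: (@bnd_le _ _ r r _ (\sum_(j < n | j != i1) (r * (A * r) + r * (A * r)))).
  - by rewrite r0' lexx.
  - rewrite (_ : n%:R * (2 * A) * r ^+ 2 = \sum_(j < n) (r * (A * r) + r * (A * r))).
      rewrite [X in _ <= X](bigD1 i1) //= lerDr.
      by rewrite addr_ge0 // !mulr_ge0.
    by rewrite sumr_const card_ord -mulr_natl; ring.
  - by apply: bnd_ssum => // j _; apply: bnd_ssub => //; apply: bnd_sprod => //; exact: bnd_svar.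
have e2 := ler_wpM2r (exprn_ge0 2 r0') h2.
case: b => /=.
  apply: (@bnd_le _ _ r r _ (K * r ^+ 2 * (A * r) + n%:R * (2 * A) * r ^+ 2)).
  - by rewrite r0' lexx.
  - lra.
  - by apply: bnd_ssub => //; exact: bnd_sprod.
apply: (@bnd_le _ _ r r _ (n%:R * (2 * A) * r ^+ 2 + A * r * (K * r ^+ 2))).
- by rewrite r0' lexx.
- lra.
- by apply: bnd_ssub => //; exact: bnd_sprod.
Qed.

Lemma extension_fixpoint :
  exists U, [/\ forall b, sord 2 (U b), forall b, sconv (U b) & eT U = U].
Proof.
have [s s0 [L hL]] := @sconv_family _ _ ('I_2 * 'I_(n + n))%type (fun p => dW p.1 p.2)
  (fun p => sconv_dWt p.1 p.2).
have L0 : 0 <= L by exact: bnd_ge0 (ltW s0) (hL (xi, x1)).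
(* [dW] has order 1, whence the bound (2 r / s) L = [A * r] at radius 2 r. As before, [B] adds up
   the coefficients of [r] in the two conditions of [bnd_eT]. *)
pose A := 2 * L / s.
have A0 : 0 <= A by rewrite divr_ge0 ?mulr_ge0 // ltW.
have nA : 0 <= n%:R * (2 * A) by apply: mulr_ge0 => //; exact: mulr_ge0.
pose K := n%:R * (2 * A) + 1; have K1 : 1 <= K by rewrite /K; lra.
pose B := K + A * K.
have AK : 0 <= A * K by rewrite mulr_ge0 //; lra.
have B0 : 0 < B by rewrite /B; lra.
pose r := Num.min (s / 2) B^-1.
have r0 : 0 < r by rewrite lt_min invr_gt0 B0; lra.
have rs : r <= s / 2 by rewrite ge_min lexx.
have rB : B * r <= 1.
  have : r <= B^-1 by rewrite ge_min lexx orbT.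
  by move/(ler_wpM2l (ltW B0)); rewrite mulfV ?gt_eqF.
have p1 : 0 <= K * r by rewrite mulr_ge0 ?(ltW r0) //; lra.
have p2 : 0 <= A * K * r by rewrite mulr_ge0 // ltW.
have hB1 : K * r <= 1 by move: rB; rewrite /B; lra.
have KE : K = n%:R * (2 * A) + 1 by [].
have hB3 : A * K * r <= 1 by move: rB; rewrite /B; lra.
have hB2 : n%:R * (2 * A) + A * K * r <= K by lra.
have hA t i : bnd (2 * r) (dW t i) (A * r).
  have r2 : 0 <= 2 * r by lra.
  have r2s : 2 * r <= s by lra.
  have -> : A * r = (2 * r / s) ^+ 1 * L by rewrite /A expr1; field; rewrite gt_eqF.
  exact: bnd_sord r2 s0 r2s (@sord_dW t i) (hL (t, i)).
have K0 : 0 <= K by lra.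
have [U [h1 h2 h3]] := @formal_fixpoint R (n + n) _ eT r (fun _ => K * r ^+ 2) (ltW r0)
  (fun _ => mulr_ge0 K0 (exprn_ge0 2 (ltW r0)))
  (fun U b hU => sord_eT b hU)
  (fun U V d hU hV hUV b => eqd_eT b hU hV hUV)
  (fun U hU hb b => bnd_eT b r0 A0 K0 hA hB1 hB2 hU hb).
by exists U; split => // b; exists r => //; exists (K * r ^+ 2).
Qed.

Variable U : bool -> mon (n + n) -> C.
Hypotheses (hU2 : forall b, sord 2 (U b)) (hUc : forall b, sconv (U b)) (hUT : eT U = U).

Definition ephi (i : 'I_(n + n)) : mon (n + n) -> C :=
  sadd (ecmp U (W i)) (if i == x1 then spol 0 else if i == y1 then U false else svar R i).

Lemma sconv_einner k : sconv (einner U k).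
Proof.
rewrite /einner; case: ifP => _; last exact: sconv_svar.
by apply: sconv_sadd => //; exact: sconv_svar.
Qed.
Lemma sord_in k : sord 1 (einner U k). Proof. exact: sord_einner. Qed.
Lemma sconv_ecmp a : sconv a -> sconv (ecmp U a).
Proof. by move=> ca; apply: sconv_scomp => // k; [exact: sconv_einner | exact: sord_in]. Qed.
Lemma sconv_ephi i : sconv (ephi i).
Proof.
apply: sconv_sadd; first exact: sconv_ecmp.
by do 2?[case: ifP => _ //]; [exact: sconv_spol | exact: sconv_svar].
Qed.

Lemma W_split i : W i = sadd (cbase R i1 i) (ssub (W i) (cbase R i1 i)).
Proof. by apply/funext => m; rewrite /sadd /ssub addrC subrK. Qed.

(** The base part of W composed with the inner map is tau for x_1, y_1 for y_1 and 0 otherwise,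
    which with the added term of [ephi] produces the variable itself; all the rest has order 2. *)
Lemma ephi_near_id i : sord 2 (ssub (ephi i) (svar R i)).
Proof.
have sw : sord 2 (ecmp U (ssub (W i) (cbase R i1 i))) by apply: sord_ecmp.
rewrite /ephi W_split /ecmp scompDl.
set q := scomp (ssub (W i) (cbase R i1 i)) _; have {}sw : sord 2 q by [].
rewrite /cbase.
have [e|nx] := eqVneq i x1.
  rewrite /= scomp_svar; last exact: sord_in.
  move=> m hm; rewrite /ssub /einner eqxx /etau /sadd sw // (hU2 true) // /spol mcoeff0 e; ring.
have [e|ny] := eqVneq i y1.
  rewrite /= scomp_svar; last exact: sord_in.
  move=> m hm; rewrite /ssub /einner eta_xi /sadd sw // (hU2 false) // e; ring.
rewrite scomp0 => m hm; rewrite /ssub /sadd sw // /spol mcoeff0; ring.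
Qed.

Local Notation zeta := (fun z : 'rV[C]_(n + n) => \row_k ev (einner U k) z).
Local Notation p := (fun z t i => ev (dW t i) (zeta z)).
Local Notation p2 := (fun z s t i => ev (sder s (dW t i)) (zeta z)).
Local Notation q := (fun z t i => ev (sder t (W i)) (zeta z)).
Local Notation Tz := (fun z u => dd (etau U) z u).

Lemma sum_ord2 (F : 'I_2 -> C) : \sum_k F k = F xi + F eta.
Proof.
rewrite (bigD1 xi) //= (bigD1 eta) ?eta_xi //= big1 ?addr0 //.
by elim/ord2P; rewrite ?eqxx ?xi_eta ?eta_xi ?andbF.
Qed.

Lemma dd_ecmp a : sconv a -> \forall z \near (0 : 'rV[C]_(n + n)), forall u,
  dd (ecmp U a) z u = ev (sder xi a) (zeta z) * Tz z u + ev (sder eta a) (zeta z) * u ord0 y1.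
Proof.
move=> ca; apply: filterS (dd_scomp ca sconv_einner sord_in) => z e u.
by rewrite e sum_ord2 /einner eqxx eta_xi dd_svar.
Qed.

Lemma ev_ecmp a : sconv a -> \forall z \near (0 : 'rV[C]_(n + n)),
  ev (ecmp U a) z = ev a (zeta z).
Proof. by move=> ca; exact: (ev_scomp ca sconv_einner sord_in). Qed.

Lemma dd_ecmp_dW : \forall z \near (0 : 'rV[C]_(n + n)), forall t i u,
  dd (ecmp U (dW t i)) z u = p2 z xi t i * Tz z u + p2 z eta t i * u ord0 y1.
Proof. by apply: near_all => t; apply: near_all => i; apply: dd_ecmp; exact: sconv_dWt. Qed.

Lemma ev_ecmp_dW : \forall z \near (0 : 'rV[C]_(n + n)), forall t i,
  ev (ecmp U (dW t i)) z = p z t i.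
Proof. by apply: near_all => t; apply: near_all => i; apply: ev_ecmp; exact: sconv_dWt. Qed.

Let cl j t i : sconv (sprod (svar R j) (ecmp U (dW t i))).
Proof. by apply: sconv_sprod; [exact: sconv_svar | apply: sconv_ecmp; exact: sconv_dWt]. Qed.

Lemma sconv_eS t : sconv (eS U t).
Proof. by apply: sconv_ssum => j _; apply: sconv_ssub. Qed.

Lemma ev_eS : \forall z \near (0 : 'rV[C]_(n + n)), forall t, ev (eS U t) z =
  \sum_(j < n | j != i1) (z ord0 (lshift n j) * p z t (rshift n j)
                          - z ord0 (rshift n j) * p z t (lshift n j)).
Proof.
apply: near_all => t.
have f1 := @ev_ssum _ _ _ (fun j : 'I_n => j != i1) _
  (fun j _ => sconv_ssub (cl (lshift n j) t (rshift n j)) (cl (rshift n j) t (lshift n j))).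
have f2 := near_all (fun j => ev_ssub (cl (lshift n j) t (rshift n j)) (cl (rshift n j) t (lshift n j))).
have cc i := sconv_ecmp (sconv_dWt t i).
have f3 := near_all (fun j => ev_sprod (sconv_svar R (lshift n j)) (cc (rshift n j))).
have f4 := near_all (fun j => ev_sprod (sconv_svar R (rshift n j)) (cc (lshift n j))).
apply: filterS (filterI f1 (filterI f2 (filterI f3 (filterI f4 ev_ecmp_dW))))
  => z [e1 [e2 [e3 [e4 e5]]]].
rewrite [ev (eS U t) z]e1; apply: eq_bigr => j _.
by rewrite e2 e3 e4 !ev_svar !e5.
Qed.

Lemma dd_eS : \forall z \near (0 : 'rV[C]_(n + n)), forall t u, dd (eS U t) z u =
  \sum_(j < n | j != i1) (u ord0 (lshift n j) * p z t (rshift n j)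
                          - u ord0 (rshift n j) * p z t (lshift n j)) +
  ((\sum_(j < n | j != i1) (z ord0 (lshift n j) * p2 z xi t (rshift n j)
                           - z ord0 (rshift n j) * p2 z xi t (lshift n j))) * Tz z u +
   (\sum_(j < n | j != i1) (z ord0 (lshift n j) * p2 z eta t (rshift n j)
                           - z ord0 (rshift n j) * p2 z eta t (lshift n j))) * u ord0 y1).
Proof.
apply: near_all => t.
have f1 := @dd_ssum _ _ _ (fun j : 'I_n => j != i1) _
  (fun j => sconv_ssub (cl (lshift n j) t (rshift n j)) (cl (rshift n j) t (lshift n j))).
have f2 := near_all (fun j => dd_ssub (cl (lshift n j) t (rshift n j)) (cl (rshift n j) t (lshift n j))).
have cc i := sconv_ecmp (sconv_dWt t i).
have f3 := near_all (fun j => dd_sprod (sconv_svar R (lshift n j)) (cc (rshift n j))).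
have f4 := near_all (fun j => dd_sprod (sconv_svar R (rshift n j)) (cc (lshift n j))).
apply: filterS (filterI f1 (filterI f2 (filterI f3 (filterI f4 (filterI ev_ecmp_dW dd_ecmp_dW)))))
  => z [e1 [e2 [e3 [e4 [e5 e6]]]]] u.
rewrite [dd (eS U t) z u]e1 !mulr_suml -!big_split; apply: eq_bigr => j _.
rewrite e2 e3 e4 !dd_svar !ev_svar !e5 !e6 /=; ring.
Qed.

Lemma eU_true : U true = ssub (sprod (U false) (ecmp U (dW eta x1))) (eS U eta).
Proof. by rewrite -{1}hUT. Qed.
Lemma eU_false : U false = ssub (eS U xi) (sprod (ecmp U (dW xi x1)) (U false)).
Proof. by rewrite -{1}hUT. Qed.

Lemma ev_U : \forall z \near (0 : 'rV[C]_(n + n)),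
  ev (U true) z = ev (U false) z * p z eta x1 - ev (eS U eta) z /\
  ev (U false) z = ev (eS U xi) z - p z xi x1 * ev (U false) z.
Proof.
have c1 := sconv_ecmp (sconv_dWt eta x1); have c2 := sconv_ecmp (sconv_dWt xi x1).
have f1 := ev_ssub (sconv_sprod (hUc false) c1) (sconv_eS eta).
have f2 := ev_sprod (hUc false) c1.
have f3 := ev_ssub (sconv_eS xi) (sconv_sprod c2 (hUc false)).
have f4 := ev_sprod c2 (hUc false).
apply: filterS (filterI f1 (filterI f2 (filterI f3 (filterI f4 ev_ecmp_dW)))) => z [e1 [e2 [e3 [e4 e5]]]].
by split; [rewrite {1}eU_true e1 e2 e5 | rewrite {1}eU_false e3 e4 e5].
Qed.

Lemma dd_U : \forall z \near (0 : 'rV[C]_(n + n)), forall u,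
  dd (U true) z u = dd (U false) z u * p z eta x1
    + ev (U false) z * (p2 z xi eta x1 * Tz z u + p2 z eta eta x1 * u ord0 y1) - dd (eS U eta) z u /\
  dd (U false) z u = dd (eS U xi) z u
    - ((p2 z xi xi x1 * Tz z u + p2 z eta xi x1 * u ord0 y1) * ev (U false) z
       + p z xi x1 * dd (U false) z u).
Proof.
have c1 := sconv_ecmp (sconv_dWt eta x1); have c2 := sconv_ecmp (sconv_dWt xi x1).
have f1 := dd_ssub (sconv_sprod (hUc false) c1) (sconv_eS eta).
have f2 := dd_sprod (hUc false) c1.
have f3 := dd_ssub (sconv_eS xi) (sconv_sprod c2 (hUc false)).
have f4 := dd_sprod c2 (hUc false).
apply: filterS (filterI f1 (filterI f2 (filterI f3 (filterI f4 (filterI ev_ecmp_dW dd_ecmp_dW)))))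
  => z [e1 [e2 [e3 [e4 [e5 e6]]]]] u.
by split; [rewrite {1}eU_true e1 e2 e5 e6 | rewrite {1}eU_false e3 e4 e5 e6].
Qed.

Lemma ev_dW_W : \forall z \near (0 : 'rV[C]_(n + n)), forall t i,
  q z t i = ((t == xi) && (i == x1) || (t == eta) && (i == y1))%:R + p z t i.
Proof.
have y1x1 : (y1 == x1) = false by exact: eq_rlshift.
have cb i : sconv (cbase R i1 i).
  by rewrite /cbase; do 2?[case: ifP => _]; [exact: sconv_svar|exact: sconv_svar|exact: sconv_spol].
apply: near_all => t; apply: near_all => i.
have f := sconv_compr sconv_einner sord_in (ev_sadd (sconv_sder t (cb i)) (sconv_dWt t i)).
apply: filterS f => z e.
rewrite {1}W_split sder_sadd e; congr (_ + _); rewrite /cbase.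
have [->|nx] := eqVneq i x1.
  by rewrite sder_svar ev_spol rmorph_nat eq_lrshift andbF orbF andbT.
have [_|ny] := eqVneq i y1; first by rewrite sder_svar ev_spol rmorph_nat andbF andbT.
by rewrite sder_spol mderiv0 ev_spol meval0 !andbF.
Qed.

Lemma dd_ephi : \forall z \near (0 : 'rV[C]_(n + n)), forall i u,
  dd (ephi i) z u = q z xi i * Tz z u + q z eta i * u ord0 y1
    + (if i == x1 then 0 else if i == y1 then dd (U false) z u else u ord0 i).
Proof.
apply: near_all => i.
have c2 : sconv (if i == x1 then spol 0 else if i == y1 then U false else svar R i).
  by do 2?[case: ifP => _ //]; [exact: sconv_spol | exact: sconv_svar].
apply: filterS2 (dd_sadd (sconv_ecmp (cW i)) c2) (dd_ecmp (cW i)) => z e1 e2 u.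
rewrite e1 e2; congr (_ + _); case: ifP => _; first by rewrite dd_spol0.
by case: ifP => _ //; rewrite dd_svar.
Qed.

Lemma dd_etau : \forall z \near (0 : 'rV[C]_(n + n)), forall u,
  Tz z u = u ord0 x1 + dd (U true) z u.
Proof.
by apply: filterS (dd_sadd (sconv_svar R x1) (hUc true)) => z e u; rewrite e dd_svar.
Qed.

Hypothesis hbr : \forall z \near (0 : 'rV[C]_2), \sum_(j < n)
  (ev (sder xi (W (lshift n j))) z * ev (sder eta (W (rshift n j))) z
   - ev (sder eta (W (lshift n j))) z * ev (sder xi (W (rshift n j))) z) = 1.

(** At each point this is [symplectic_algebra], fed with the differentials of the two equations
    along [u] and [v] and with the symmetry of the second derivatives of W. *)
Lemma ephi_symplectic : \forall z \near (0 : 'rV[C]_(n + n)), forall u v,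
  \sum_(j < n) (dd (ephi (lshift n j)) z u * dd (ephi (rshift n j)) z v
    - dd (ephi (rshift n j)) z u * dd (ephi (lshift n j)) z v) =
  \sum_(j < n) (u ord0 (lshift n j) * v ord0 (rshift n j) - u ord0 (rshift n j) * v ord0 (lshift n j)).
Proof.
have y1x1 j : (rshift n j == x1) = false by exact: eq_rlshift.
have x1y1 j : (lshift n j == y1) = false by exact: eq_lrshift.
have hb := sconv_compr sconv_einner sord_in hbr.
apply: filterS (filterI hb (filterI dd_eS (filterI dd_U (filterI ev_dW_W (filterI dd_ephi dd_etau)))))
  => z [b [e1 [e2 [e3 [e4 e5]]]]] u v.
have sC s t i : p2 z s t i = p2 z t s i by rewrite /dW sderC.
have dx j u' : dd (ephi (lshift n j)) z u' =
    (j != i1)%:R * u' ord0 (lshift n j) + q z xi (lshift n j) * Tz z u' + q z eta (lshift n j) * u' ord0 y1.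
  by rewrite e4 eq_lshift x1y1; case: eqP => [->|_] /=; ring.
have dy j u' : dd (ephi (rshift n j)) z u' =
    (j != i1)%:R * u' ord0 (rshift n j) + q z xi (rshift n j) * Tz z u' + q z eta (rshift n j) * u' ord0 y1
    + (j == i1)%:R * dd (U false) z u'.
  by rewrite e4 y1x1 eq_rshift; case: eqP => [->|_] /=; ring.
have qp t i j : j != i1 -> (i == lshift n j) || (i == rshift n j) -> q z t i = p z t i.
  move=> ji /orP[] /eqP ->; rewrite e3 ?eq_lshift ?eq_rshift ?x1y1 ?y1x1 (negbTE ji) !andbF /=; ring.
have qx t : q z t x1 = (t == xi)%:R + p z t x1 by rewrite e3 eqxx x1y1 andbT andbF orbF.
have sq t u' : \sum_(j < n | j != i1) (u' ord0 (lshift n j) * p z t (rshift n j)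
                          - u' ord0 (rshift n j) * p z t (lshift n j))
  = \sum_(j < n | j != i1) (u' ord0 (lshift n j) * q z t (rshift n j)
                          - u' ord0 (rshift n j) * q z t (lshift n j)).
  by apply: eq_bigr => j ji; rewrite (qp t _ j ji) ?eqxx ?orbT // (qp t _ j ji) ?eqxx.
have A (u' : 'rV[C]_(n + n)) := e2 u'.
set Qxx := (\sum_(j < n | j != i1) (z ord0 (lshift n j) * p2 z xi xi (rshift n j)
                           - z ord0 (rshift n j) * p2 z xi xi (lshift n j))).
set Qxe := (\sum_(j < n | j != i1) (z ord0 (lshift n j) * p2 z eta xi (rshift n j)
                           - z ord0 (rshift n j) * p2 z eta xi (lshift n j))).
set Qee := (\sum_(j < n | j != i1) (z ord0 (lshift n j) * p2 z eta eta (rshift n j)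
                           - z ord0 (rshift n j) * p2 z eta eta (lshift n j))).
have QxeE : (\sum_(j < n | j != i1) (z ord0 (lshift n j) * p2 z xi eta (rshift n j)
                           - z ord0 (rshift n j) * p2 z xi eta (lshift n j))) = Qxe.
  by apply: eq_bigr => j _; rewrite !(sC xi eta).
(* The differential of pi d_xi W_(x_1) = S_xi, with the 1 of [q z xi x1] restored. *)
have C1 u' : dd (U false) z u' * q z xi x1
    + ev (U false) z * (p2 z xi xi x1 * Tz z u' + p2 z eta xi x1 * u' ord0 y1)
    = \sum_(j < n | j != i1) (u' ord0 (lshift n j) * q z xi (rshift n j)
                          - u' ord0 (rshift n j) * q z xi (lshift n j))
    + (Qxx * Tz z u' + Qxe * u' ord0 y1).
  have [_ h] := A u'; rewrite -sq qx eqxx mulrDr mulr1 {1}h e1 -/Qxx -/Qxe; ring.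
(* The differential of the tau' equation, solved for the x_1 component by means of d tau = dx_1 + d
   tau'. *)
have C2 (u' : 'rV[C]_(n + n)) : u' ord0 x1 = Tz z u' + \sum_(j < n | j != i1) (u' ord0 (lshift n j) * q z eta (rshift n j)
                          - u' ord0 (rshift n j) * q z eta (lshift n j))
    + (Qxe * Tz z u' + Qee * u' ord0 y1) - dd (U false) z u' * q z eta x1
    - ev (U false) z * (p2 z eta xi x1 * Tz z u' + p2 z eta eta x1 * u' ord0 y1).
  have [h _] := A u'; rewrite -sq qx eta_xi {1}e5 h e1 QxeE -/Qee (sC eta xi) /=; ring.
have key := @symplectic_algebra C n i1 (fun j => q z xi (lshift n j)) (fun j => q z eta (lshift n j))
  (fun j => q z xi (rshift n j)) (fun j => q z eta (rshift n j))
  (fun j => u ord0 (lshift n j)) (fun j => u ord0 (rshift n j))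
  (fun j => v ord0 (lshift n j)) (fun j => v ord0 (rshift n j))
  (Tz z u) (u ord0 y1) (dd (U false) z u) (Tz z v) (v ord0 y1) (dd (U false) z v)
  (u ord0 x1) (v ord0 x1) (ev (U false) z) (p2 z xi xi x1) (p2 z eta xi x1) (p2 z eta eta x1)
  Qxx Qxe Qee b (C1 u) (C2 u) (C1 v) (C2 v).
rewrite [RHS](bigD1 i1) //= -key; apply: eq_bigr => j _.
by rewrite !dx !dy.
Qed.

(* The sums [eS] are zero on the plane of the first pair, which forces
   pi = tau' = 0 together with their derivatives: there Phi reduces to [W]. *)
Lemma ephi_plane : \forall z \near (0 : 'rV[C]_(n + n)),
  (forall i, i != x1 -> i != y1 -> (z : 'rV[C]_(n + n)) ord0 i = 0) ->
  [/\ ev (einner U xi) z = z ord0 x1, forall i, ev (ephi i) z = ev (W i) (zeta z) &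
    forall (u : 'rV[C]_(n + n)), (forall i, i != x1 -> i != y1 -> u ord0 i = 0) ->
      forall i, dd (ephi i) z u = q z xi i * u ord0 x1 + q z eta i * u ord0 y1].
Proof.
have y1x1 j : (rshift n j == x1) = false by exact: eq_rlshift.
have x1y1 j : (lshift n j == y1) = false by exact: eq_lrshift.
have cW1 : sconv (sder xi (W x1)) by exact: sconv_sder.
(* On the plane the equation of pi becomes d_xi W_(x_1) * pi = 0, and likewise for its tangential
   derivatives; this factor is 1 at the origin, hence invertible nearby. *)
have n0 : sder xi (W x1) mnm0 != 0.
  rewrite sderE add0m mnm0E mulr1n W_split /sadd sW ?mdeg1 // addr0 /cbase eqxx.
  by rewrite svarE /spol mcoeffX eqxx oner_neq0.
have f0 := sconv_compr sconv_einner sord_in (ev_near_neq0 cW1 n0).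
have f1 := ev_sadd (sconv_svar R x1) (hUc true).
have c2 i : sconv (if i == x1 then spol 0 else if i == y1 then U false else svar R i).
  by do 2?[case: ifP => _ //]; [exact: sconv_spol | exact: sconv_svar].
have f2 := near_all (fun i => ev_sadd (sconv_ecmp (cW i)) (c2 i)).
have f3 := near_all (fun i => ev_ecmp (cW i)).
apply: filterS (filterI f0 (filterI f1 (filterI f2 (filterI f3 (filterI ev_eS (filterI dd_eS
  (filterI ev_U (filterI dd_U (filterI ev_dW_W (filterI dd_ephi dd_etau))))))))))
  => z [q0 [e1 [e2 [e3 [e4 [e5 [[e6 e7] [e8 [e9 [e10 e11]]]]]]]]]] hz.
have zl j : j != i1 -> z ord0 (lshift n j) = 0.
  by move=> ji; apply: hz; rewrite ?eq_lshift ?x1y1.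
have zr j : j != i1 -> z ord0 (rshift n j) = 0.
  by move=> ji; apply: hz; rewrite ?eq_rshift ?y1x1.
have sz (F F' : 'I_n -> C) :
  \sum_(j < n | j != i1) (z ord0 (lshift n j) * F j - z ord0 (rshift n j) * F' j) = 0.
  by apply: big1 => j ji; rewrite zl // zr // !mul0r subrr.
have qx : q z xi x1 = 1 + p z xi x1 by rewrite e9 !eqxx.
have pi0 : ev (U false) z = 0.
  apply: (mulfI q0); rewrite mulr0 qx mulrDl mul1r {1}e7 e4 sz; ring.
have tau0 : ev (U true) z = 0 by rewrite e6 pi0 e4 sz mul0r subrr.
split.
- by rewrite /einner eqxx /etau e1 tau0 addr0 ev_svar.
- move=> i; rewrite e2 e3.
  have [_|nx] := eqVneq i x1; first by rewrite ev_spol meval0 addr0.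
  have [_|ny] := eqVneq i y1; first by rewrite pi0 addr0.
  by rewrite ev_svar hz // addr0.
- move=> u hu i.
  have ul j : j != i1 -> u ord0 (lshift n j) = 0.
    by move=> ji; apply: hu; rewrite ?eq_lshift ?x1y1.
  have ur j : j != i1 -> u ord0 (rshift n j) = 0.
    by move=> ji; apply: hu; rewrite ?eq_rshift ?y1x1.
  have su (F F' : 'I_n -> C) :
    \sum_(j < n | j != i1) (u ord0 (lshift n j) * F j - u ord0 (rshift n j) * F' j) = 0.
    by apply: big1 => j ji; rewrite ul // ur // !mul0r subrr.
  have dS t : dd (eS U t) z u = 0 by rewrite e5 su !sz !mul0r !addr0.
  have [h1 h2] := e8 u.
  have P0 : dd (U false) z u = 0.
    apply: (mulfI q0); rewrite mulr0 qx mulrDl mul1r {1}h2 dS pi0; ring.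
  have T0 : Tz z u = u ord0 x1 by rewrite e11 h1 P0 pi0 dS; ring.
  rewrite e10 T0 P0.
  have [_|nx] := eqVneq i x1; first by rewrite addr0.
  have [_|ny] := eqVneq i y1; first by rewrite addr0.
  by rewrite (hu i) // addr0.
Qed.

End Extension.

(** * The normal form *)

Section NormalForm.
Variables (R : realType) (n : nat) (i1 : 'I_n).
Local Notation C := (Cplx R).
Variables (h : mon (n + n) -> C) (W : 'I_(n + n) -> mon 2 -> C) (om : 'rV[C]_2 -> C).
Variable U : bool -> mon (n + n) -> C.
Local Notation x1 := (lshift n i1).
Local Notation y1 := (rshift n i1).
Hypotheses (ch : sconv h) (cW : forall i, sconv (W i))
  (sW : forall i, sord 2 (ssub (W i) (cbase R i1 i))).
Hypothesis fieldW : \forall z \near (0 : 'rV[C]_2), forall i,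
  sg R i * ev (sder (cj i) h) (\row_k ev (W k) z) =
  om z * (z ord0 xi * ev (sder xi (W i)) z - z ord0 eta * ev (sder eta (W i)) z).
Hypothesis brW : \forall z \near (0 : 'rV[C]_2), \sum_(j < n)
  (ev (sder xi (W (lshift n j))) z * ev (sder eta (W (rshift n j))) z
   - ev (sder eta (W (lshift n j))) z * ev (sder xi (W (rshift n j))) z) = 1.
Hypotheses (hU2 : forall b, sord 2 (U b)) (hUc : forall b, sconv (U b))
  (hUT : eT i1 W U = U).
Local Notation phi := (ephi i1 W U).
Local Notation hW := (scomp h W).

Definition plane2 (k : 'I_2) : mon (n + n) -> C := if k == xi then svar R x1 else svar R y1.
Definition plane : pred 'I_(n + n) := fun i => (i == x1) || (i == y1).
Definition remainder := ssub (scomp h phi) (scomp hW plane2).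

Lemma sord1_of_base (a : mon (n + n) -> C) i : sord 2 (ssub a (svar R i)) -> sord 1 a.
Proof.
move=> s m hm; have e := s m (ltn_trans hm (ltnSn 1)).
by move/eqP: e; rewrite /ssub subr_eq0 => /eqP ->; apply: sord_svar.
Qed.

Lemma sord_phi i : sord 1 (phi i).
Proof. exact: sord1_of_base (ephi_near_id sW hU2 i). Qed.

Lemma sord_Wi i : sord 1 (W i).
Proof.
move=> m hm; have e := sW i (ltn_trans hm (ltnSn 1)).
by move/eqP: e; rewrite /ssub subr_eq0 => /eqP ->; apply: sord_cbase.
Qed.

Lemma sconv_phi i : sconv (phi i). Proof. exact: sconv_ephi. Qed.

Lemma sconv_plane2 k : sconv (plane2 k).
Proof. by rewrite /plane2; case: ifP => _; exact: sconv_svar. Qed.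
Lemma sord_plane2 k : sord 1 (plane2 k).
Proof. by rewrite /plane2; case: ifP => _; exact: sord_svar. Qed.
Lemma sconv_hWi : sconv hW.
Proof. by apply: sconv_scomp => // i; exact: sord_Wi. Qed.
Lemma sconv_hP : sconv (scomp h phi).
Proof. by apply: sconv_scomp => // i; [exact: sconv_phi | exact: sord_phi]. Qed.
Lemma sconv_hq : sconv (scomp hW plane2).
Proof.
apply: sconv_scomp; [exact: sconv_hWi | exact: sconv_plane2 | exact: sord_plane2].
Qed.
Lemma sconv_remainder : sconv remainder.
Proof. exact: sconv_ssub sconv_hP sconv_hq. Qed.

Lemma plane_zeta (z : 'rV[C]_(n + n)) : ev (einner i1 U xi) z = z ord0 x1 ->
  \row_k ev (einner i1 U k) z = \row_k ev (plane2 k) z.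
Proof.
move=> e; apply/rowP => k; rewrite !mxE; move: k; apply: ord2P.
  by rewrite e /plane2 eqxx ev_svar.
by rewrite /einner /plane2 eta_xi.
Qed.

Lemma not_plane i : ~~ plane i = (i != x1) && (i != y1).
Proof. by rewrite /plane negb_or. Qed.

(** On the plane Phi coincides with W at (x_1, y_1), so the two compositions have the same value. *)
Lemma remainder_vanish : vanish plane remainder.
Proof.
have f1 := ev_ssub sconv_hP sconv_hq.
have f2 := ev_scomp ch sconv_phi sord_phi.
have f3 := ev_scomp sconv_hWi sconv_plane2 sord_plane2.
have f4 := sconv_compr sconv_plane2 sord_plane2 (ev_scomp ch cW sord_Wi).
have f5 := ephi_plane cW sW hU2 hUc hUT.
apply: filterS (filterI f1 (filterI f2 (filterI f3 (filterI f4 f5))))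
  => z [e1 [e2 [e3 [e4 e5]]]] hz.
have [i|h1 h2 _] := e5; first by move=> nx ny; apply: hz; rewrite not_plane nx.
rewrite e1 e2 e3 e4 -(plane_zeta h1).
rewrite (_ : \row_i ev (phi i) z = \row_i ev (W i) (\row_k ev (einner i1 U k) z)) ?subrr //.
by apply/rowP => i; rewrite !mxE h2.
Qed.

Lemma dd_delta (a : mon (n + n) -> C) z i : dd a z (delta_mx ord0 i) = ev (sder i a) z.
Proof.
rewrite /dd (bigD1 i) //= big1 ?addr0 => [|t ti]; first by rewrite mxE !eqxx mul1r.
by rewrite mxE eqxx (negbTE ti) mul0r.
Qed.

(** The second composition does not involve the coordinate [i]. For the first, dh at the image point
    is [om] times the symplectic form paired with dPhi(u), u the Euler vector of the plane; so the
    derivative is [om] times omega(dPhi u, dPhi e_i) = omega(u, e_i), and e_i is symplectically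
    orthogonal to the plane. *)
Lemma remainder_sder_vanish i : ~~ plane i -> vanish plane (sder i remainder).
Proof.
rewrite not_plane => /andP[nx ny].
have f1 := ev_ssub (sconv_sder i sconv_hP) (sconv_sder i sconv_hq).
have f2 := ev_chain ch sconv_phi sord_phi.
have f3 := ev_chain sconv_hWi sconv_plane2 sord_plane2.
have f5 := ephi_plane cW sW hU2 hUc hUT.
have f6 := ephi_symplectic cW hU2 hUc hUT brW.
have f7 := sconv_compr sconv_plane2 sord_plane2 fieldW.
apply: filterS (filterI f1 (filterI f2 (filterI f3 (filterI f5 (filterI f6 f7)))))
  => z [e1 [e2 [e3 [e5 [e6 e7]]]]] hz.
have [k|h1 h2 h3] := e5; first by move=> kx ky; apply: hz; rewrite not_plane kx.
rewrite /remainder sder_ssub e1 e2 e3.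
rewrite [X in _ - X]big1 ?subr0 => [|k _]; last first.
  rewrite /plane2; case: ifP => _; rewrite sder_svar ev_spol rmorph_nat.
    by rewrite (negbTE nx) mulr0.
  by rewrite (negbTE ny) mulr0.
set Z := \row_k ev (plane2 k) z in e7.
have pz : \row_k ev (einner i1 U k) z = Z by rewrite (plane_zeta h1).
have Zx : Z ord0 xi = z ord0 x1 by rewrite mxE /plane2 eqxx ev_svar.
have Zy : Z ord0 eta = z ord0 y1 by rewrite mxE /plane2 eta_xi ev_svar.
have -> : \row_k ev (phi k) z = \row_k ev (W k) Z.
  by apply/rowP => k; rewrite !mxE h2 pz.
(* The vector (x_1, -y_1) of the plane, which dPhi sends to xi d_xi W - eta d_eta W; times [om] this
   is the Hamiltonian field by [fieldW]. *)
pose u : 'rV[C]_(n + n) := \row_k (if k == x1 then z ord0 x1 else if k == y1 then - z ord0 y1 else 0).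
have ux : u ord0 x1 = z ord0 x1 by rewrite mxE eqxx.
have uy : u ord0 y1 = - z ord0 y1 by rewrite mxE eq_rlshift eqxx.
have u0 k : k != x1 -> k != y1 -> u ord0 k = 0.
  by move=> kx ky; rewrite mxE (negbTE kx) (negbTE ky).
have hd k : sg R k * ev (sder (cj k) h) (\row_k ev (W k) Z) = om Z * dd (phi k) z u.
  by rewrite e7 h3 // pz ux uy Zx Zy; ring.
have gr j : ev (sder (rshift n j) h) (\row_k ev (W k) Z) = om Z * dd (phi (lshift n j)) z u.
  by rewrite -hd sgl cjl mul1r.
have gl j : ev (sder (lshift n j) h) (\row_k ev (W k) Z) = - (om Z * dd (phi (rshift n j)) z u).
  by rewrite -hd sgr cjr mulN1r opprK.
have := e6 u (delta_mx ord0 i); rewrite [X in _ = X]big1 => [|j _]; last first.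
  have [->|ji] := eqVneq j i1.
    by rewrite !mxE !eqxx ![_ == i]eq_sym (negbTE nx) (negbTE ny) !mulr0 subrr.
  by rewrite !u0 ?mul0r ?subrr // ?eq_lshift ?eq_rshift ?eq_lrshift ?eq_rlshift.
move=> s0; rewrite sum_phase -[RHS](mulr0 (om Z)) -[in RHS]s0 mulr_sumr; apply: eq_bigr => j _.
rewrite gl gr !dd_delta; ring.
Qed.

(** In transverse degree 0 the remainder itself vanishes on the plane. In transverse degree 1
    exactly one transverse variable [i] occurs, once; lowering it gives a coefficient of the
    derivative along [i], which also vanishes there. *)
Lemma remainder_quadratic m : (transverse_deg i1 m < 2)%N -> remainder m = 0.
Proof.
have tle j : j != i1 -> (m (lshift n j) + m (rshift n j) <= transverse_deg i1 m)%N.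
  by move=> ji; rewrite /transverse_deg (bigD1 j) //= leq_addr.
rewrite ltnS leq_eqVlt => /orP[/eqP t1|].
  have [j ji jm] : exists2 j, j != i1 & (m (lshift n j) + m (rshift n j) != 0)%N.
    apply/exists_inP; move: t1; apply: contra_eqT; rewrite negb_exists_in => /forall_inP hf.
    by rewrite /transverse_deg big1 // => j ji; apply/eqP; have := hf j ji; rewrite negbK.
  have others k : k != i1 -> k != j -> (m (lshift n k) = 0 /\ m (rshift n k) = 0)%N.
    move=> ki kj; move: t1; rewrite /transverse_deg (bigD1 j) //= (bigD1 k) ?ki //=; lia.
  have [i hi mi] : exists2 i, i = lshift n j \/ i = rshift n j & m i != 0%N.
    by have [e|] := eqVneq (m (lshift n j)) 0%N; [exists (rshift n j); [right|move: jm; rewrite e] | exists (lshift n j); [left|]].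
  have ni : ~~ plane i.
    by rewrite /plane; case: hi => ->; rewrite ?eq_lshift ?eq_rshift ?eq_lrshift ?eq_rlshift ?orbF.
  have le : mpoly.lem (mnm1 i) m by rewrite lep1mP.
  have := vanish_coef (sconv_sder i sconv_remainder) (remainder_sder_vanish ni) (m := mnm_sub m (mnm1 i)).
  rewrite sderE submK // => hv.
  have : remainder m *+ (mnm_sub m (mnm1 i) i).+1 = 0.
    apply: hv; elim/phaseP => k; rewrite mnmBE mnm1E /plane ?eq_lshift ?eq_rshift ?eq_lrshift ?eq_rlshift ?orbF /=.
      have [//|ki] := eqVneq k i1; have [e|kj] := eqVneq k j; last by have [-> _] := others k ki kj.
      have := tle j ji; rewrite t1 e; case: hi mi => -> mi; rewrite ?eqxx ?eq_rlshift; lia.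
    have [//|ki] := eqVneq k i1; have [e|kj] := eqVneq k j; last by have [_ ->] := others k ki kj.
    have := tle j ji; rewrite t1 e; case: hi mi => -> mi; rewrite ?eqxx ?eq_lrshift; lia.
  by move/eqP; rewrite mulrn_eq0 /= => /eqP.
rewrite ltnS leqn0 => /eqP t0; apply: (vanish_coef sconv_remainder remainder_vanish).
elim/phaseP => k; rewrite /plane ?eq_lshift ?eq_rshift ?eq_lrshift ?eq_rlshift ?orbF /=;
  have [//|ki] := eqVneq k i1; have := tle k ki; rewrite t0; lia.
Qed.

End NormalForm.

(** * Low-order coefficients from decay along rays *)

Section LowOrder.
Variables (R : realType) (N : nat).
Local Notation C := (Cplx R).
Implicit Types (a : mon N -> C) (z : 'rV[C]_N).

Lemma inballZ r (t : R) z : 0 <= t <= 1 -> inball r z -> inball (t * r) ((t%:C)%C *: z).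
Proof.
move=> /andP[t0 t1] hz i; rewrite mxE nmM nm_real ger0_norm //.
by apply: ler_wpM2l => //; exact: hz.
Qed.

Lemma meval_trZ d a (t : C) z : sord d a ->
  (tr d.+1 a).@[fun i => (t *: z) ord0 i] = t ^+ d * (tr d.+1 a).@[fun i => z ord0 i].
Proof.
move=> sa; rewrite trE !(raddf_sum (meval _)) /= mulr_sumr; apply: eq_bigr => m _.
rewrite !mevalZ; have [md|dm] := ltnP (mdeg m) d; first by rewrite sa // !mul0r mulr0.
have e : mdeg m = d by apply/eqP; rewrite eqn_leq dm andbT -ltnS bmdeg.
rewrite mulrCA; congr (_ * _); rewrite !mevalX -[X in t ^+ X]e mdegE.
rewrite (big_morph (fun k => t ^+ k) (exprD t) (expr0 t)) -big_split.
by apply: eq_bigr => i _; rewrite mxE exprMn.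
Qed.

(** Induction on the order: if [a] has order [d < D], its truncation at [d.+1] is homogeneous of
    degree [d], so the value at [t z] is [t^d] times the value of that polynomial at [z], up to
    O(t^(d+1)). The decay assumption makes it 0. *)
Lemma sord_decay D a : sconv a ->
  (\forall z \near (0 : 'rV[C]_N), exists B : R, forall t : R, 0 < t -> t <= 1 / 2 ->
     nm (ev a ((t%:C)%C *: z)) <= B * t ^+ D) ->
  sord D a.
Proof.
move=> ca hB; suff h d : (d <= D)%N -> sord d a by exact: h.
elim: d => [_ m //|d IH dD]; have {IH} sa := IH (ltnW dD).
pose p := tr d.+1 a; pose b := ssub a (spol p).
have sb : sord d.+1 b by move=> m hm; rewrite /b /ssub /spol mcoeff_tr_lt // subrr.
have cb : sconv b by apply: sconv_ssub => //; exact: sconv_spol.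
have [r r0 [L hL]] := cb; have L0 := bnd_ge0 (ltW r0) hL.
suff pz : p = 0.
  by move=> m hm; rewrite -(mcoeff_tr_lt a hm) -/p pz mcoeff0.
have e : spol p = spol (0 : mpoly N C).
  apply: ev_inj; try exact: sconv_spol.
  have /near0P[s s0 hs] := ev_ssub ca (sconv_spol p).
  have nr : \forall z \near (0 : 'rV[C]_N), inball (Num.min s (r / 2)) z.
    by apply/near0P; exists (Num.min s (r / 2)) => //; rewrite lt_min s0; lra.
  apply: filterS2 hB nr => z [B hz] hr; rewrite !ev_spol meval0.
  set w := p.@[_]; apply/eqP; rewrite -nm_eq0; apply/negPn/negP => n0.
  have w0 : 0 < nm w by rewrite lt_neqAle nm_ge0 eq_sym n0.
  have key t : 0 < t -> t <= 1 / 2 -> nm w <= (`|B| + 3 * L) * t.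
    move=> t0 t2; have t1 : 0 <= t <= 1 by rewrite (ltW t0); lra.
    have zs : inball s ((t%:C)%C *: z).
      move=> i; apply: le_trans (inballZ t1 hr i) _; apply: (@le_trans _ _ (1 * s)); last by rewrite mul1r.
      apply: ler_pM; [exact: ltW | by rewrite le_min ltW //; lra | by case/andP: t1 | by rewrite ge_min lexx].
    have zr : inball (t * r / 2) ((t%:C)%C *: z).
      move=> i; apply: le_trans (inballZ t1 hr i) _; rewrite -mulrA; apply: ler_wpM2l; first exact: ltW.
      by rewrite ge_min lexx orbT.
    have h1 : nm (ev b ((t%:C)%C *: z)) <= 3 * (t ^+ d.+1 * L).
      have tr0 : 0 < t * r by rewrite mulr_gt0.
      have trr : t * r <= r by rewrite ger_pMl //; case/andP: t1.
      have := bnd_sord (ltW tr0) r0 trr sb hL.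
      by rewrite mulfK ?gt_eqF // => h; exact: ev_bound tr0 h zr.
    have h2 := hz t t0 t2.
    have h3 := hs _ zs; rewrite ev_spol -/p (meval_trZ _ _ sa) -/p -/w in h3.
    rewrite -/b in h3; rewrite h3 in h1.
    have td0 : 0 < t ^+ d by rewrite exprn_gt0.
    have tD : t ^+ D <= t ^+ d.+1 by apply: ler_wiXn2l => //; case/andP: t1.
    rewrite -(ler_pM2l td0).
    have e1 : nm ((t%:C)%C ^+ d * w) = t ^+ d * nm w by rewrite nmM nmX nm_real ger0_norm // ltW.
    rewrite -e1; set x := ev a _ in h1 h2; set y := _ * w in h1 *.
    have := nmB x (x - y); rewrite (_ : x - (x - y) = y); last ring.
    have : B * t ^+ D <= `|B| * t ^+ d.+1.
      apply: (@le_trans _ _ (`|B| * t ^+ D)); last exact: ler_wpM2l.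
      by apply: ler_wpM2r; [rewrite exprn_ge0 // ltW | exact: ler_norm].
    rewrite exprSr in h1 *; lra.
  pose M := `|B| + 3 * L + 1; have M0 : 0 < M by rewrite /M; have := normr_ge0 B; lra.
  pose t := Num.min (1 / 2) (nm w / (2 * M)).
  have t0 : 0 < t by rewrite lt_min; apply/andP; split; [lra | rewrite divr_gt0 //; lra].
  have := key t t0; rewrite ge_min lexx => /(_ isT) h1.
  have : t <= nm w / (2 * M) by rewrite ge_min lexx orbT.
  rewrite ler_pdivlMr; last lra.
  rewrite /M in M0 *; nra.
by apply/mpolyP => m; rewrite -[p@_m]/(spol p m) e.
Qed.

End LowOrder.

Lemma homog_mevalZ (R : realType) (N d : nat) (p : mpoly N (Cplx R)) (t : Cplx R)
    (z : 'rV[Cplx R]_N) : p \is ishomog1 d mdeg -> peval p (t *: z) = t ^+ d * peval p z.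
Proof.
move=> /dhomogP hp; rewrite /peval !mevalE mulr_sumr; apply: eq_big_seq => m hm.
have e : mdeg m = d := hp m hm.
rewrite mulrCA; congr (_ * _); rewrite -[X in t ^+ X]e mdegE.
rewrite (big_morph (fun k => t ^+ k) (exprD t) (expr0 t)) -big_split.
by apply: eq_bigr => i _; rewrite mxE exprMn.
Qed.

(* For fixed small z the terms H_s(z) are bounded, so the part of degree at least 3 of
   H(t z) is O(t^3); this determines the coefficients of H of degree at most 2. *)
Lemma sord_higher_terms (R : realType) (N : nat) (H : 'rV[Cplx R]_N -> Cplx R)
    (Hs : nat -> mpoly N (Cplx R)) (a : mon N -> Cplx R) :
  sconv a -> (\forall z \near (0 : 'rV[Cplx R]_N), H z = ev a z) ->
  (\forall z \near (0 : 'rV[Cplx R]_N), [series peval (Hs s) z]_s @ \oo --> H z) ->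
  (forall s, Hs s \is ishomog1 (s + 2)%N mdeg) ->
  sord 3 (ssub a (spol (Hs 0%N))).
Proof.
move=> ca hH hS hh; apply: sord_decay; first by apply: sconv_ssub => //; exact: sconv_spol.
have [r r0 hr] := (near0P _).1 (filterI hH (filterI hS (ev_ssub ca (sconv_spol (Hs 0%N))))).
apply/near0P; exists r => // z hz; have [_ [hSz _]] := hr z hz.
pose c s := peval (Hs s) z.
have [B hB] : exists B : R, forall s, nm (c s) <= B.
  have /cplx_cvgP/(_ 1 ltr01)[D hD] := hSz.
  exists (2 + \sum_(s < D) nm (c s)) => s.
  have S0 (P : pred 'I_D) : 0 <= \sum_(s < D | P s) nm (c s) by apply: sumr_ge0 => k _; exact: nm_ge0.
  have [sD|Ds] := ltnP s D.
    rewrite (bigD1 (Ordinal sD)) //=; have := S0 (fun k => k != Ordinal sD); lra.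
  have h1 := hD s Ds; have h2 := hD s.+1 (leqW Ds).
  move: h1 h2; rewrite /series /= big_nat_recr //= -/(c s).
  set x := \sum_(0 <= k < s) _ => h1 h2.
  have := nmB (x + c s - H z) (x - H z); rewrite (_ : _ - _ - (_ - _) = c s); last ring.
  have := S0 predT; lra.
have B0 : 0 <= B by apply: le_trans (hB 0%N); exact: nm_ge0.
exists (2 * B) => t t0 t2; have t1 : 0 <= t <= 1 by rewrite (ltW t0); lra.
have zr : inball r ((t%:C)%C *: z).
  move=> i; apply: le_trans (inballZ t1 hz i) _; rewrite ger_pMl //; by case/andP: t1.
have [e1 [h2 e3]] := hr _ zr; rewrite e3 -e1 ev_spol -/(peval (Hs 0%N) _).
have h3 : (fun d => [series peval (Hs s) ((t%:C)%C *: z)]_s d.+1 - peval (Hs 0%N) ((t%:C)%C *: z)) @ \oo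
    --> H ((t%:C)%C *: z) - peval (Hs 0%N) ((t%:C)%C *: z).
  apply: cvgB; last exact: cvg_cst.
  by rewrite -cvg_shiftS in h2.
apply: (nm_lim_le h3) => d; rewrite /series /= big_nat_recl //= addrAC subrr add0r.
rewrite big_mkord; apply: le_trans (nm_sum _ _ _) _.
(* The term of index k + 1 scales by t^(k + 3), and [t <= 1 / 2] turns the tail into a geometric sum
   of total at most 2. *)
apply: (@le_trans _ _ (\sum_(k < d) (B * t ^+ 3) * 2^-1 ^+ k)); last first.
  rewrite -mulr_sumr mulrAC; have t3 : 0 <= B * t ^+ 3 by rewrite mulr_ge0 // exprn_ge0 // ltW.
  have := ler_wpM2l t3 (geom_sum_le R d); lra.
apply: ler_sum => k _; rewrite (homog_mevalZ _ _ (hh k.+1)) -/(c k.+1) nmM nmX nm_real ger0_norm; last exact: ltW.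
rewrite (_ : k.+1 + 2 = k + 3)%N; last by rewrite addSnnS.
rewrite exprD mulrC mulrA [X in _ <= X]mulrAC; apply: ler_pM.
- by rewrite mulr_ge0 ?nm_ge0 // exprn_ge0 // ltW.
- by rewrite exprn_ge0 // ltW.
- apply: ler_pM => //; [exact: nm_ge0 | by rewrite exprn_ge0 // ltW |].
  by apply: lerXn2r; rewrite ?nnegrE ?invr_ge0 ?(ltW t0) //; lra.
- by [].
Qed.

(** * Series in the product of two variables *)

Section Diagonal.
Variable R : realType.
Local Notation C := (Cplx R).

Definition diag_mnm (k : nat) : mon 2 := mnm_muln (mnm_add (mnm1 xi) (mnm1 eta)) k.

Lemma diag_mnmE k i : diag_mnm k i = k.
Proof.
by rewrite mulmnE mnmDE !mnm1E; move: i; apply: ord2P; rewrite eqxx ?xi_eta ?eta_xi mul1n.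
Qed.

Lemma mdeg_diag k : mdeg (diag_mnm k) = k.*2.
Proof. by rewrite mdegE !big_ord_recl big_ord0 !diag_mnmE addn0 addnn. Qed.

Lemma ed_eq0 m : ed m = 0 -> m = diag_mnm (m xi).
Proof.
move=> e; apply/mnmP; apply: ord2P; rewrite diag_mnmE //.
by move: e; rewrite /ed; lia.
Qed.

Lemma ed_diag k : ed (diag_mnm k) = 0.
Proof. by rewrite /ed !diag_mnmE subrr. Qed.

Variables (a : mon 2 -> C) (ca : sconv a) (da : forall m, ed m != 0 -> a m = 0).
Let c k := a (diag_mnm k).

(** The truncation at twice [d] keeps exactly the powers (xi eta)^k with k < d, so it is a partial
    sum of a series in one variable. *)
Lemma tr_diag d : tr d.*2 a = \sum_(k < d) c k *: mpolyX C (diag_mnm k).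
Proof.
apply/mpolyP => m; rewrite mcoeff_tr raddf_sum /=.
under eq_bigr => k _ do rewrite mcoeffZ mcoeffX.
have [e|n0] := eqVneq (ed m) 0; last first.
  rewrite da // if_same big1 // => k _; case: eqP => [e|_]; last by rewrite mulr0.
  by rewrite -e ed_diag eqxx in n0.
rewrite (ed_eq0 e) mdeg_diag ltn_double; set j := m xi; case: ltnP => jd.
  rewrite (bigD1 (Ordinal jd)) //= eqxx mulr1 big1 ?addr0 // => k kj; case: eqP => [e'|_]; last by rewrite mulr0.
  by move: kj; rewrite -val_eqE /= -(diag_mnmE k xi) e' diag_mnmE eqxx.
rewrite big1 // => k _; case: eqP => [e'|_]; last by rewrite mulr0.
by move: jd; rewrite -(diag_mnmE j xi) -e' diag_mnmE leqNgt ltn_ord.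
Qed.

Lemma series_diag : \forall z \near (0 : 'rV[C]_2),
  [series c k * ((z : 'rV[C]_2) ord0 xi * z ord0 eta) ^+ k]_k @ \oo --> ev a z.
Proof.
apply: filterS (sconv_cvg ca) => z /cplx_cvgP h; apply/cplx_cvgP => e /h[D hD].
exists D => d Dd; have := hD d.*2; rewrite -addnn => /(_ (leq_trans Dd (leq_addr _ _))).
rewrite addnn tr_diag raddf_sum /series /= big_mkord.
rewrite (eq_bigr (fun k : 'I_d => c k * (z ord0 xi * z ord0 eta) ^+ k)) // => k _.
rewrite /= mevalZ mevalX; congr (_ * _).
rewrite (bigD1 xi) //= (big_pred1 eta) ?diag_mnmE ?exprMn //.
by apply: ord2P; rewrite /= ?eta_xi ?xi_eta !eqxx.
Qed.

(** The one-variable function is the sum evaluated at (sqrt t, sqrt t). At any other point with the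
    same product the defining series is the same, and limits are unique. *)
Lemma diagonal_function : exists2 G : C -> C, analytic1_at0 G &
  \forall z \near (0 : 'rV[C]_2), ev a z = G ((z : 'rV[C]_2) ord0 xi * z ord0 eta).
Proof.
have /near0P[r r0 hr] := series_diag.
pose s (t : C) : 'rV[C]_2 := \row_k sqrtC t.
have hs t : nm t <= r ^+ 2 -> inball r (s t).
  move=> ht i; rewrite mxE -(ler_pXn2r (n := 2)) ?nnegrE ?nm_ge0 ?(ltW r0) //.
  by rewrite -nmX sqrtCK.
have hG t : nm t <= r ^+ 2 -> [series c k * t ^+ k]_k @ \oo --> ev a (s t).
  by move=> ht; have := hr _ (hs t ht); rewrite !mxE -expr2 sqrtCK.
exists (fun t => ev a (s t)).
  exists c; apply/nbhs_ballP; exists ((r ^+ 2)%:C)%C; first by rewrite /= ltcR exprn_gt0.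
  move=> t; rewrite -ball_normE /ball_ /= sub0r normrN normE ltcR => ht.
  by apply: hG; exact: ltW.
apply/near0P; exists r => // z hz; apply: (cplx_cvg_unique (hr z hz)).
by apply: hG; rewrite nmM expr2; apply: ler_pM; rewrite ?nm_ge0.
Qed.

End Diagonal.

Section Transverse.
Variables (R : realType) (n : nat) (i1 : 'I_n) (lambda : 'I_n -> Cplx R).

Definition H0_transverse : mpoly (n + n) (Cplx R) := \sum_(j < n | j != i1) lambda j *:
  (mpolyX (Cplx R) (mnm1 (lshift n j)) * mpolyX (Cplx R) (mnm1 (rshift n j))).

Lemma H0_split (z : 'rV[Cplx R]_(n + n)) :
  peval (H0poly lambda) z = lambda i1 * (xc z i1 * yc z i1) + peval H0_transverse z.
Proof.
rewrite /H0poly (bigD1 i1) //= /peval (mevalD _ _) mevalZ (mevalM _ _) !mevalXU.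
by [].
Qed.

Lemma H0_transverse_coef m : (transverse_deg i1 m < 2)%N -> H0_transverse@_m = 0.
Proof.
move=> hm; rewrite raddf_sum big1 //= => j ji.
rewrite mcoeffZ -mpolyXD mcoeffX; case: eqP => [e|_]; last by rewrite mulr0.
move: hm; rewrite -e /transverse_deg (bigD1 j) //= !mnmDE !mnm1E !eqxx.
by rewrite eq_lrshift eq_rlshift.
Qed.

End Transverse.

Theorem theorem1 (R : realType) (n : nat) (hn : (0 < n)%N)
    (lambda : 'I_n -> Cplx R)
    (H : 'rV[Cplx R]_(n + n) -> Cplx R)
    (Hs : nat -> mpoly (n + n) (Cplx R))
    (H_analytic : analytic_at0 H)
    (H_sum : \forall z \near (0 : 'rV[Cplx R]_(n + n)),
       [series peval (Hs s) z]_s @ \oo --> H z)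
    (Hs0 : Hs 0%N = H0poly lambda)
    (Hs_homog : forall s : nat, (1 <= s)%N -> Hs s \is ishomog1 (s + 2)%N mdeg)
    (lambda1_neq0 : lambda (Ordinal hn) != 0)
    (nonresonance : forall nu : 'I_n, nu != Ordinal hn ->
       forall k : int, lambda nu - k%:~R * lambda (Ordinal hn) != 0) :
  exists (Phi : 'rV[Cplx R]_(n + n) -> 'rV[Cplx R]_(n + n))
         (Gamma : Cplx R -> Cplx R)
         (F : 'rV[Cplx R]_(n + n) -> Cplx R),
    [/\ near_identity Phi,
        canonical_at0 Phi,
        analytic1_at0 Gamma,
        transverse_quadratic (Ordinal hn) F &
        \forall z \near (0 : 'rV[Cplx R]_(n + n)),
          H (Phi z) = peval (H0poly lambda) z
                      + Gamma (xc z (Ordinal hn) * yc z (Ordinal hn))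
                      + F z].
Proof.
set i1 := Ordinal hn in lambda1_neq0 nonresonance *.
have [h /ev_expands[ch hH]] := H_analytic.
have homog s : Hs s \is ishomog1 (s + 2)%N mdeg.
  case: s => [|s]; last exact: Hs_homog.
  rewrite Hs0; apply: rpred_sum => j _; apply: rpredZ.
  by rewrite -mpolyXD dhomogX /= mdegD !mdeg1.
have s3 := sord_higher_terms ch hH H_sum homog; rewrite Hs0 in s3.
pose h2 := ssub h (spol (H0poly lambda)).
have ch2 : sconv h2 by apply: sconv_ssub => //; exact: sconv_spol.
have eh : hser lambda h2 = h by apply/funext => m; rewrite /hser /h2 /sadd /ssub addrC subrK.
have [W [al []]] := center_manifold ch2 s3 lambda1_neq0 nonresonance.
rewrite eh => cW sW fW bW dW.
have [U [U2 Uc UT]] := extension_fixpoint cW sW.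
pose phi := ephi i1 W U; pose Phi (z : 'rV[Cplx R]_(n + n)) : 'rV[Cplx R]_(n + n) := \row_i ev (phi i) z.
have cphi i : sconv (phi i) by exact: sconv_ephi.
have sphi i : sord 1 (phi i) by exact: sord_phi.
have sW1 i : sord 1 (W i) by exact: (sord_Wi sW).
pose hW := scomp h W.
have chW : sconv hW by exact: sconv_scomp.
pose q := lambda i1 *: mpolyX (Cplx R) (mnm_add (mnm1 xi) (mnm1 eta)).
(* [Gamma] is h o W without the term lambda_1 xi eta, which the quadratic part H_0 of the normal
   form already contains. *)
pose a := ssub hW (spol q).
have ca : sconv a by apply: sconv_ssub => //; exact: sconv_spol.
have da m : ed m != 0 -> a m = 0.
  move=> em; rewrite /a /ssub [hW m]dW // sub0r /spol mcoeffZ mcoeffX.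
  case: eqP => [e|_]; last by rewrite mulr0 oppr0.
  by rewrite -e /ed !mnmDE !mnm1E !eqxx xi_eta eta_xi subrr in em.
have [Gamma aG hG] := diagonal_function ca da.
(* The final identity holds by this choice. The content is the expansion of [F]: the lambda_1 x_1
   y_1 of H_0 cancels against [Gamma], which leaves [remainder] minus the transverse part of H_0,
   both at least quadratic. *)
pose F z := H (Phi z) - (peval (H0poly lambda) z + Gamma (xc z i1 * yc z i1)).
exists Phi, Gamma, F; split => //.
- move=> i; exists (ssub (phi i) (svar R i)); split.
    move=> m; apply: contraR; rewrite -ltnNge => hm; apply/eqP; exact: (ephi_near_id sW U2 i hm).
  apply: expands_ev; first by apply: sconv_ssub; [exact: cphi | exact: sconv_svar].
  apply: filterS (ev_ssub (cphi i) (sconv_svar R i)) => z ->.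
  by rewrite mxE ev_svar.
- apply: filterS (filterI (differentiable_ev cphi) (ephi_symplectic cW U2 Uc UT bW)) => z [[dz dE] sz].
  split=> // u v; rewrite !dE /symp_form /xc /yc.
  by under eq_bigr => j _ do rewrite !mxE; exact: sz.
- exists (ssub (remainder i1 h W U) (spol (H0_transverse i1 lambda))); split.
    move=> m; apply: contraR; rewrite -ltnNge => hm; rewrite /ssub /spol H0_transverse_coef // subr0.
    by rewrite (remainder_quadratic ch cW sW fW bW U2 Uc UT).
  have cR : sconv (remainder i1 h W U) by exact: (sconv_remainder ch cW sW U2 Uc).
  apply: expands_ev; first by apply: sconv_ssub => //; exact: sconv_spol.
  have f1 := ev_ssub cR (sconv_spol (H0_transverse i1 lambda)).
  have f2 := ev_ssub (sconv_hP ch cW sW U2 Uc) (sconv_hq ch cW sW).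
  have f3 := ev_scomp ch cphi sphi.
  have f4 := ev_scomp chW (sconv_plane2 R i1) (@sord_plane2 R n i1).
  have f5 := sconv_compr (sconv_plane2 R i1) (@sord_plane2 R n i1) hG.
  have f7 := sconv_compr (sconv_plane2 R i1) (@sord_plane2 R n i1) (ev_ssub chW (sconv_spol q)).
  have f6 := sconv_compr cphi sphi hH.
  apply: filterS (filterI f1 (filterI f2 (filterI f3 (filterI f4 (filterI f5 (filterI f6 f7))))))
    => z [e1 [e2 [e3 [e4 [e5 [e7 e6]]]]]].
  rewrite /F /Phi e7 (H0_split i1) e1 ev_spol e2 e3 e4.
  move: e5; rewrite e6 ev_spol mevalZ mpolyXD (mevalM _ _) !mevalXU; set w := \row_k ev (plane2 R i1 k) z.
  have -> : w ord0 xi = xc z i1 by rewrite mxE /plane2 eqxx ev_svar.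
  have -> : w ord0 eta = yc z i1 by rewrite mxE /plane2 eta_xi ev_svar.
  move=> <-; rewrite /peval; ring.
apply: (filterE (nbhs_filter _)) => z; rewrite /F; ring.
Qed.
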